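(* Assume [H1], [H2] and [H3] (stated in the context). Let $N\in\mathbb{N}$ and $\tau_0>0$ be fixed. Then there exist functions $\mu_1,\dots,\mu_N\in\mathcal{C}^\infty(\mathbb{T}^d,\mathbb{R})$ (independent of $\tau$), a constant $C_N$ and a polynomial $P_N(t)$ such that, for every $\tau\in(0,\tau_0]$, the modified density $$\mu^N(x)=\rho(x)+\tau\mu_1(x)+\cdots+\tau^N\mu_N(x)$$ satisfies $\int_{\mathbb{T}^d}\mu^N(x)\,\mathrm{d}x=1$, and for every smooth function $\varphi:\mathbb{T}^d\to\mathbb{R}$, $$\forall\,p\in\mathbb{N},\qquad \Big\|\mathbb{E}\,\varphi(X_p)-\int_{\mathbb{T}^d}\varphi(y)\,\mu^N(y)\,\mathrm{d}y\Big\|_\infty\le\big(P_N(t_p)e^{-\lambda t_p}+C_N\tau^N\big)\|\varphi\|_{\mathcal{C}^{8N+2}},$$ where $t_p=p\tau$, $(X_p)$ is the Euler scheme with step $\tau$ started from $X_0=x$, $\lambda$ is the constant of [H3], and the norm $\|\cdot\|_\infty$ is taken with respect to the initial point $x\in\mathbb{T}^d$.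
   Context: Smooth means $\mathcal{C}^\infty$. On the $d$-dimensional torus $\mathbb{T}^d$ consider the SDE $\mathrm{d}X^i(t)=f^i(X(t))\,\mathrm{d}t+\sum_{\ell=1}^m\sigma^i_\ell(X(t))\,\mathrm{d}W^\ell(t)$, $i=1,\dots,d$, where $f=(f^i)$ and $\sigma=(\sigma^i_\ell)$ are smooth on $\mathbb{T}^d$ (periodic), and $W=(W^1,\dots,W^m)$ is a standard $m$-dimensional Wiener process on a filtered probability space. Generator (summation over repeated indices): $L v(x)=L(x,\partial_x)v(x)=f^i(x)\partial_i v(x)+a^{ij}(x)\partial_{ij}v(x)$, with $a^{ij}(x)=\frac12\sum_{\ell=1}^m\sigma^i_\ell(x)\sigma^j_\ell(x)$. $L^*$ is the adjoint of $L$ with respect to the $L^2(\mathbb{T}^d,\mathrm{d}x)$ product. For smooth $\varphi$, $u(t,x)$ denotes the unique solution of $\partial_t u=Lu$, $u(0,x)=\varphi(x)$ on $\mathbb{T}^d$. Norms: $\|\psi\|_\infty=\sup_{x\in\mathbb{T}^d}|\psi(x)|$ and $\|\psi\|_{\mathcal{C}^k}=\sup_{|\boldsymbol{j}|\le k}\sup_{x\in\mathbb{T}^d}|\partial_{\boldsymbol{j}}\psi(x)|$ over multi-indices $\boldsymbol{j}\in\mathbb{N}^d$. Standing hypotheses: [H1] There exists $\rho\in\mathcal{C}^\infty(\mathbb{T}^d,\mathbb{R})$, $\rho\ge0$, with $L^*\rho=0$ and $\int_{\mathbb{T}^d}\rho\,\mathrm{d}x=1$. [H2] For every $g\in\mathcal{C}^\infty(\mathbb{T}^d,\mathbb{R})$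 with $\int_{\mathbb{T}^d} g\,\mathrm{d}x=0$ there exists a unique $\mu\in\mathcal{C}^\infty(\mathbb{T}^d,\mathbb{R})$ with $L^*\mu=g$ and $\int_{\mathbb{T}^d}\mu(x)\rho(x)\,\mathrm{d}x=0$. [H3] There exist a constant $\lambda>0$ and, for each $k\in\mathbb{N}$, a polynomial $p_k(t)$ such that for every $\varphi\in\mathcal{C}^\infty(\mathbb{T}^d,\mathbb{R})$ with $\int_{\mathbb{T}^d}\varphi\rho\,\mathrm{d}x=0$, $\|u(t,\cdot)\|_{\mathcal{C}^k}\le p_k(t)e^{-\lambda t}\|\varphi\|_{\mathcal{C}^k}$ for all $t\ge0$. Euler scheme with step $\tau>0$: $X_0=x\in\mathbb{T}^d$ and $X^i_{n+1}=X^i_n+\tau f^i(X_n)+\sigma^i_\ell(X_n)\big(W^\ell((n+1)\tau)-W^\ell(n\tau)\big)$, $n\ge0$ (points taken in $\mathbb{T}^d$). Constants and polynomials in estimates may depend on $f$, $\sigma$, $N$ and $\tau_0$, but not on $\varphi$, $p$, $\tau$ or $x$. *)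

(* Defs.v *)
(* The torus is T^d = R^d / Z^d: a function on T^d is a
   function on R^d = 'rV[R]_d which is Z^d-periodic, and a point of T^d is given
   by any of its representatives in R^d. *)
From HB Require Import structures.
From mathcomp Require Import all_boot all_order all_algebra.
From mathcomp Require Import all_classical all_reals all_analysis.
Set Implicit Arguments.
Unset Strict Implicit.
Unset Printing Implicit Defensive.
Import Order.TTheory GRing.Theory Num.Theory.
Import numFieldNormedType.Exports.
Local Open Scope classical_set_scope.
Local Open Scope ring_scope.

Section Torus.
Context {R : realType} {d : nat}.
Implicit Types (psi : 'rV[R]_d -> R) (i : 'I_d) (s : seq 'I_d).

Definition basis_vector i : 'rV[R]_d := delta_mx 0 i.

Definition partial i psi : 'rV[R]_d -> R :=
  fun x => 'D_(basis_vector i) psi x.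

Definition partials s psi : 'rV[R]_d -> R := foldr partial psi s.

Definition multi_partial (j : {ffun 'I_d -> nat}) psi : 'rV[R]_d -> R :=
  foldr (fun i g => iter (j i) (partial i) g) psi (enum 'I_d).

Definition multi_degree (j : {ffun 'I_d -> nat}) : nat := (\sum_i j i)%N.

Definition periodic psi : Prop :=
  forall x i, psi (x + basis_vector i) = psi x.

(* C^oo(R^d): partial derivatives of all orders, taken in any order of the
   variables, exist and are continuous. *)
Definition smooth psi : Prop :=
  forall s, continuous (partials s psi) /\
    forall i x, derivable (partials s psi) x (basis_vector i).

Definition smooth_torus psi : Prop := periodic psi /\ smooth psi.

(* The norms take their values in \bar R, so that no convention is involved
   when a supremum is infinite. *)
Definition sup_norm (g : 'rV[R]_d -> \bar R) : \bar R :=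
  ereal_sup [set `|g x|%E | x in [set: 'rV[R]_d]].

Definition Ck_norm (k : nat) psi : \bar R :=
  ereal_sup [set e : \bar R | exists (j : {ffun 'I_d -> nat}) (x : 'rV[R]_d),
    (multi_degree j <= k)%N /\ e = (`|multi_partial j psi x|)%:E].

End Torus.

(* Integral over [0, 1]^n, hence over T^n for periodic integrands, as an
   iterated Lebesgue integral (a Lebesgue measure on 'rV[R]_n is not available);
   it is only applied to continuous functions. *)
Fixpoint torus_int {R : realType} (n : nat) : ('rV[R]_n -> R) -> R :=
  match n return ('rV[R]_n -> R) -> R with
  | 0%N => fun g => g 0
  | n'.+1 => fun g =>
      \int[lebesgue_measure]_(t in `[0, 1]%classic)
         torus_int (fun y : 'rV[R]_n' => g (row_mx (const_mx t : 'rV[R]_1) y))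
  end.

Section Generator.
Context {R : realType} {d m : nat}.
Variables (f : 'I_d -> 'rV[R]_d -> R) (sigma : 'I_d -> 'I_m -> 'rV[R]_d -> R).
Implicit Types (v mu g phi : 'rV[R]_d -> R) (u : R -> 'rV[R]_d -> R).

Definition diffusion (i j : 'I_d) (x : 'rV[R]_d) : R :=
  2^-1 * \sum_(l < m) sigma i l x * sigma j l x.

Definition generator v : 'rV[R]_d -> R := fun x =>
  \sum_(i < d) f i x * partial i v x
  + \sum_(i < d) \sum_(j < d) diffusion i j x * partial i (partial j v) x.

(* g = L^* mu, where L^* is the adjoint of L for the L^2(T^d, dx) product:
   <L v, mu> = <v, g> for all v in C^oo(T^d). *)
Definition adjoint_generator mu g : Prop :=
  forall v, smooth_torus v ->
    torus_int (fun x => generator v x * mu x) = torus_int (fun x => v x * g x).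

(* u is a smooth solution on [0, +oo[ x T^d of d_t u = L u, u(0, .) = phi.
   The values u t for t < 0 are irrelevant.  The smoothness of u in t, up to
   t = 0, follows from the equation and the joint continuity. *)
Definition parabolic_solution phi u : Prop :=
  [/\ u 0 = phi,
      forall t : R, 0 <= t -> smooth_torus (u t),
      forall s : seq 'I_d,
        {within [set z : R * 'rV[R]_d | 0 <= z.1],
          continuous (fun z : R * 'rV[R]_d => partials s (u z.1) z.2)} &
      forall (t : R) (x : 'rV[R]_d), 0 < t ->
        is_derive t (1 : R) (fun r => u r x) (generator (u t) x)].

(* S phi is the unique solution with initial datum phi. *)
Definition solution_operator (S : ('rV[R]_d -> R) -> R -> 'rV[R]_d -> R) : Prop :=
  forall phi, smooth_torus phi ->
    parabolic_solution phi (S phi) /\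
    forall u, parabolic_solution phi u ->
      forall (t : R) x, 0 <= t -> u t x = S phi t x.

Definition H1 (rho : 'rV[R]_d -> R) : Prop :=
  [/\ smooth_torus rho,
      forall x, 0 <= rho x,
      adjoint_generator rho (fun=> 0) &
      torus_int rho = 1].

Definition H2 (rho : 'rV[R]_d -> R) : Prop :=
  forall g, smooth_torus g -> torus_int g = 0 ->
    exists! mu : 'rV[R]_d -> R,
      [/\ smooth_torus mu,
          adjoint_generator mu g &
          torus_int (fun x => mu x * rho x) = 0].

Definition H3 (S : ('rV[R]_d -> R) -> R -> 'rV[R]_d -> R)
    (rho : 'rV[R]_d -> R) (lambda : R) : Prop :=
  0 < lambda /\
  forall k : nat, exists p : {poly R},
    forall phi, smooth_torus phi -> torus_int (fun x => phi x * rho x) = 0 ->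
    forall t : R, 0 <= t ->
      (Ck_norm k (S phi t) <= (p.[t] * expR (- lambda * t))%:E * Ck_norm k phi)%E.

End Generator.

Section Euler.
Context {R : realType} {disp : measure_display} {Omega : measurableType disp}.

(* Only the times t >= 0 are considered. *)
Definition filtration (F : R -> set_system Omega) : Prop :=
  [/\ forall t : R, 0 <= t -> sigma_algebra [set: Omega] (F t),
      forall t : R, 0 <= t -> F t `<=` measurable &
      forall s t : R, 0 <= s -> s <= t -> F s `<=` F t].

(* The last clause says that W t - W s is independent of F s, with law
   N(0, (t - s) I_m); normal_prob is parametrized by the standard deviation. *)
Definition wiener (P : probability Omega R) (F : R -> set_system Omega)
    (m : nat) (W : 'I_m -> R -> Omega -> R) : Prop :=
  [/\ forall (l : 'I_m) (t : R) (B : set R), 0 <= t -> measurable B ->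
        F t (W l t @^-1` B),
      {ae P, forall w, forall l : 'I_m, W l 0 w = 0},
      {ae P, forall w, forall l : 'I_m,
        {within `[0, +oo[%classic, continuous (fun t => W l t w)}} &
      forall (s t : R) (A : set Omega) (B : 'I_m -> set R), 0 <= s -> s < t ->
        F s A -> (forall l, measurable (B l)) ->
        P (A `&` \bigcap_(l in [set: 'I_m])
                   ((fun w => W l t w - W l s w) @^-1` B l))
        = (P A * \prod_(l < m) normal_prob 0 (Num.sqrt (t - s)) (B l))%E].

Fixpoint euler (d m : nat) (f : 'I_d -> 'rV[R]_d -> R)
    (sigma : 'I_d -> 'I_m -> 'rV[R]_d -> R) (W : 'I_m -> R -> Omega -> R)
    (tau : R) (x : 'rV[R]_d) (n : nat) (w : Omega) : 'rV[R]_d :=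
  if n is n'.+1 then
    let X := euler f sigma W tau x n' w in
    \row_i (X 0 i + tau * f i X
      + \sum_(l < m) sigma i l X * (W l (n'.+1%:R * tau) w - W l (n'%:R * tau) w))
  else x.

End Euler.

(* Main.v *)
(* Conditionally on [X_n], the law of [X_(n+1)] is that of the diffusion with
   coefficients frozen at [X_n], run for a time [tau].  Hence one step of the scheme
   acts on test functions as [\sum_j tau^j N_j / j!], where [N_j psi (x)] is the [j]-th
   power of the generator with coefficients frozen at [x]; in particular [N_0 = id]
   and [N_1 = L], but [N_j <> L^j] for [j >= 2].  The density
   [rho + \sum_l tau^l mu_l] is formally invariant for this operator as soon as, for
   each [l], [L^* mu_l = - \sum_(j >= 2) N_j^* mu_(l+1-j) / j!], which [H2] solves
   recursively; the mean of [mu_l] is made zero by subtracting a multiple of [rho].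

   For the error one may assume that [phi] has mean zero for [rho].  Let [nu] be the
   integral against the modified density, [v t = u phi t] and [t_k = k tau], and
   telescope [E phi(X_p) - nu phi] into [E (v t_p)(X_0) - nu (v t_p)] and the
   differences of consecutive values of [E (v t_k)(X_(p-k)) - nu (v t_k)].  Comparing
   the above expansion with the Taylor expansion [\sum_j tau^j L^j (v t_k) / j!] of
   [v t_(k+1)], a difference reduces, up to [O(tau^(n+1))] times the decay of [v t_k]
   given by [H3], to the weak errors of the smooth functions [(N_j - L^j) (v t_k)],
   [2 <= j <= n], multiplied by [tau^j].  These are estimated by induction at the
   order [n + 1 - j < n], which costs [8 n + 2] derivatives in total, and the sums
   over [k] converge thanks to the exponential factors. *)
Require Import Defs.
From HB Require Import structures.
From mathcomp Require Import all_boot all_order all_algebra.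
From mathcomp Require Import all_classical all_reals all_analysis.
From mathcomp Require Import measurable_realfun.
From mathcomp Require Import zify ring lra.
Set Implicit Arguments.
Unset Strict Implicit.
Unset Printing Implicit Defensive.
Import Order.TTheory GRing.Theory Num.Theory.
Import numFieldNormedType.Exports.
Local Open Scope classical_set_scope.
Local Open Scope ring_scope.

(** * Calculus of one real variable *)

(** The expansion of one Euler step is obtained without Ito's formula and without conditional
    expectations. The step is interpolated in time with coefficients frozen at [X_n], and the
    functions [t |-> E (c(X_n) psi(Y_t))], [Y_t] being the interpolation, are studied for all smooth
    [c] and [psi] at once. A third order Taylor formula in space and the moments of the Gaussian
    increments give their forward increments up to [O(delta^(3/2))], which identifies the
    derivative.

    In the induction on the order, the transient part [exp(- lambda t_q)] of a lower order error
    meets the decay [exp(- lambda t_k)] of [v t_k], where [t_q + t_k = t_p - tau]. Each of the [p]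
    steps thus contributes [tau exp(- lambda t_p)] up to a polynomial factor, and the sum is of size
    [t_p exp(- lambda t_p)]: this is where the polynomial of the estimate gains degree. The
    stationary part is summed against the decay of [v t_k] and gives the constant. *)

Section DeriveRules.
Context {R : realType} {V : normedModType R}.
Implicit Types (f g : V -> R) (x v : V) (df dg k : R).

Lemma is_derD f g x v df dg : is_derive x v f df -> is_derive x v g dg ->
  is_derive x v (fun y => f y + g y) (df + dg).
Proof. by move=> Hf Hg; exact: (@is_deriveD R V R f g x v df dg). Qed.

Lemma is_derC k x v : is_derive x v (fun=> k) 0.
Proof. exact: is_derive_cst. Qed.

Lemma is_derZ k f x v df : is_derive x v f df ->
  is_derive x v (fun y => k * f y) (k * df).
Proof. by move=> Hf; exact: (@is_deriveZ R V R f k x v df). Qed.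

Lemma is_derB f g x v df dg : is_derive x v f df -> is_derive x v g dg ->
  is_derive x v (fun y => f y - g y) (df - dg).
Proof. by move=> Hf Hg; exact: (@is_deriveB R V R f g x v df dg). Qed.

Lemma is_derM f g x v df dg : is_derive x v f df -> is_derive x v g dg ->
  is_derive x v (fun y => f y * g y) (df * g x + f x * dg).
Proof.
move=> Hf Hg; have H := @is_deriveM R V f g x v df dg Hf Hg.
by apply: is_derive_eq H _; rewrite -![_ *: _]/(_ * _) addrC (mulrC (g x)).
Qed.

Lemma is_der_sum (I : Type) (r : seq I) (P : pred I) (F : I -> V -> R)
    (dF : I -> R) x v : (forall i, P i -> is_derive x v (F i) (dF i)) ->
  is_derive x v (fun y => \sum_(i <- r | P i) F i y) (\sum_(i <- r | P i) dF i).
Proof.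
move=> H; elim: r => [|i r IH].
  rewrite big_nil.
  by under eq_fun do rewrite big_nil; exact: is_derC.
rewrite big_cons; under eq_fun do rewrite big_cons.
by case: ifP => // Pi; apply: is_derD => //; exact: H.
Qed.

End DeriveRules.

Lemma is_derX {R : realType} n (s : R) :
  is_derive s (1 : R) (fun s => s ^+ n.+1) (n.+1%:R * s ^+ n).
Proof.
split; first exact: exprn_derivable.
by rewrite exp_derive -[LHS]/(_ * _ * 1) mulr1.
Qed.

Lemma is_derive_continuous {R : realType} (f : R -> R) (a l : R) :
  is_derive a (1 : R) f l -> {for a, continuous f}.
Proof.
by move=> [df _]; apply: differentiable_continuous; apply/derivable1_diffP.
Qed.

Section RealCalculus.
Context {R : realType}.
Implicit Types (f g : R -> R) (a b h l : R).

(** A form without quotient in which [h = 0] is allowed; derivatives are established below by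
    estimates of this type. *)
Lemma is_derive_epsP f a l :
  is_derive a (1 : R) f l <->
  forall e, 0 < e -> exists2 del, 0 < del &
    forall h, `|h| < del -> `|f (a + h) - f a - h * l| <= e * `|h|.
Proof.
split.
- move=> [df fl] e e0.
  have : h^-1 *: (f (h *: (1 : R) + a) - f a) @[h --> 0^'] --> l by rewrite -fl.
  move=> /cvgrPdist_le /(_ e e0); rewrite /= near_withinE.
  move=> /nbhs_ballP [del /= del0 H]; exists del => // h hdel.
  have [->|h0] := eqVneq h 0; first by rewrite addr0 subrr mul0r subrr normr0 mulr0.
  have := H h; rewrite /ball /= sub0r normrN => /(_ hdel h0).
  rewrite -[_ *: (1 : R)]/(h * 1) mulr1 -[_ *: _]/(h^-1 * _) (addrC h a) => H1.
  have -> : f (a + h) - f a - h * l = - (h * (l - h^-1 * (f (a + h) - f a))).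
    by field.
  by rewrite normrN normrM mulrC ler_wpM2r.
- move=> H.
  have cv : h^-1 *: (f (h *: (1 : R) + a) - f a) @[h --> 0^'] --> l.
    apply/cvgrPdist_le => e e0; rewrite near_withinE.
    have [del del0 Hd] := H e e0.
    apply/nbhs_ballP; exists del => // h; rewrite /ball /= sub0r normrN => hd h0.
    have := Hd h hd.
    rewrite -[_ *: (1 : R)]/(h * 1) mulr1 -[_ *: _]/(h^-1 * _) (addrC h a) => H1.
    have -> : l - h^-1 * (f (a + h) - f a) = - (h^-1 * (f (a + h) - f a - h * l)).
      by field.
    rewrite normrN normrM normfV mulrC ler_pdivrMr ?normr_gt0 //.
  by split; [apply/cvg_ex; exists l | apply/cvg_lim].
Qed.

(** The hypothesis is symmetric around [a], so that increments of either sign are treated alike. *)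
Lemma mean_value f f' a h :
  (forall c, `|c - a| <= `|h| -> is_derive c (1 : R) f (f' c)) ->
  exists2 c, `|c - a| <= `|h| & f (a + h) - f a = h * f' c.
Proof.
move=> H.
have Hc c : `|c - a| <= `|h| -> {for c, continuous f}.
  by move=> /H; exact: is_derive_continuous.
have [h0|h0|h0] := ltgtP 0 h; last first.
- by exists a; rewrite -h0 ?subrr ?normr0 // addr0 subrr mul0r.
- have lt : a + h < a by rewrite gtrDl.
  have inI c : c \in `[a + h, a] -> `|c - a| <= `|h|.
    rewrite in_itv /= => /andP[c1 c2].
    rewrite ler0_norm ?subr_le0 // ltr0_norm //; lra.
  have inO c : c \in `]a + h, a[ -> `|c - a| <= `|h|.
    by move=> cI; apply: inI; exact: subset_itv_oo_cc.
  have [||c cI ce] := @MVT R f f' _ _ lt.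
  + by move=> c cI; apply: H; apply: inO.
  + apply: continuous_in_subspaceT => c /set_mem cI.
    by apply: Hc; apply: inI.
  exists c; first exact: inO.
  have -> : f (a + h) - f a = - (f a - f (a + h)) by ring.
  by rewrite ce; ring.
- have lt : a < a + h by rewrite ltrDl.
  have inI c : c \in `[a, a + h] -> `|c - a| <= `|h|.
    rewrite in_itv /= => /andP[c1 c2].
    rewrite ger0_norm ?subr_ge0 // gtr0_norm //; lra.
  have inO c : c \in `]a, a + h[ -> `|c - a| <= `|h|.
    by move=> cI; apply: inI; exact: subset_itv_oo_cc.
  have [||c cI ce] := @MVT R f f' _ _ lt.
  + by move=> c cI; apply: H; apply: inO.
  + apply: continuous_in_subspaceT => c /set_mem cI.
    by apply: Hc; apply: inI.
  exists c; first exact: inO.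
  by rewrite ce; ring.
Qed.

(* The strong form of Schwarz' theorem: the existence of the second mixed
   derivative follows from the existence and continuity of the first. *)
Lemma schwarz (F Fa Fab : R -> R -> R) (Fb : R -> R) a0 b0 r : 0 < r ->
  (forall a b, `|a - a0| < r -> `|b - b0| < r ->
    is_derive a (1 : R) (F ^~ b) (Fa a b)) ->
  (forall a b, `|a - a0| < r -> `|b - b0| < r ->
    is_derive b (1 : R) (Fa a) (Fab a b)) ->
  (forall a, `|a - a0| < r -> is_derive b0 (1 : R) (F a) (Fb a)) ->
  (forall e, 0 < e -> exists2 del, 0 < del & forall a b,
    `|a - a0| < del -> `|b - b0| < del -> `|Fab a b - Fab a0 b0| <= e) ->
  is_derive a0 (1 : R) Fb (Fab a0 b0).
Proof.
move=> r0 HFa HFab HFb Hc; apply/is_derive_epsP => e e0.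
have [del del0 Hdel] := Hc (e / 2) (divr_gt0 e0 (ltr0Sn _ 1)).
exists (Num.min del r) => [|h]; first by rewrite lt_min del0.
rewrite lt_min => /andP[hd hr].
have [->|h0] := eqVneq h 0; first by rewrite addr0 subrr mul0r subrr normr0 mulr0.
have hh0 : 0 < `|h| by rewrite normr_gt0.
have near_a0 c : `|c - a0| <= `|h| -> `|c - a0| < r by move=> /le_lt_trans; apply.
(* The double difference of [F] is evaluated by two mean values, first in [a] and then in [b]. *)
have H1 k : `|k| < Num.min del r ->
    `|(F (a0 + h) (b0 + k) - F (a0 + h) b0) - (F a0 (b0 + k) - F a0 b0)
      - h * k * Fab a0 b0| <= `|h| * `|k| * (e / 2).
  rewrite lt_min => /andP[kd kr].
  have [|a' a'h ->] := @mean_value (fun a => F a (b0 + k) - F a b0)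
      (fun a => Fa a (b0 + k) - Fa a b0) a0 h.
  - move=> c /near_a0 cr.
    have H2 := HFa c (b0 + k) cr; have H3 := HFa c b0 cr.
    rewrite addrAC subrr add0r in H2; have {}H2 := H2 kr.
    rewrite subrr normr0 in H3; have {}H3 := H3 r0.
    exact: is_derB.
  - have [|b' b'k ->] := @mean_value (Fa a') (Fab a') b0 k.
    + move=> c ck; apply: HFab; first exact: near_a0.
      exact: le_lt_trans ck kr.
    + have -> : h * (k * Fab a' b') - h * k * Fab a0 b0
          = h * k * (Fab a' b' - Fab a0 b0) by ring.
      rewrite !normrM ler_wpM2l ?mulr_ge0 //; apply: Hdel.
        exact: le_lt_trans a'h hd.
      exact: le_lt_trans b'k kd.
have Hb1 : `|a0 + h - a0| < r by rewrite addrAC subrr add0r.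
have Hb0 : `|a0 - a0| < r by rewrite subrr normr0.
(* [F (a0 + h)] and [F a0] are differentiated in [b] at [b0] only, with no uniformity in [h]. Hence
   [k] is chosen after [h], small enough for an error [e / 4 * |h|] per unit of [k] in each of the
   two; the factor [k] cancels at the end. *)
have /is_derive_epsP/(_ (e / 4 * `|h|)) := HFb _ Hb1.
rewrite pmulr_lgt0 // => /(_ (divr_gt0 e0 (ltr0Sn _ 3))) [d1 d10 D1].
have /is_derive_epsP/(_ (e / 4 * `|h|)) := HFb _ Hb0.
rewrite pmulr_lgt0 // => /(_ (divr_gt0 e0 (ltr0Sn _ 3))) [d2 d20 D2].
pose k := Num.min (Num.min del r) (Num.min d1 d2) / 2.
have m0 : 0 < Num.min (Num.min del r) (Num.min d1 d2) by rewrite !lt_min del0 r0 d10 d20.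
have k0 : 0 < k by rewrite divr_gt0.
have km : `|k| < Num.min (Num.min del r) (Num.min d1 d2).
  by rewrite gtr0_norm // /k; lra.
move: (km); rewrite lt_min => /andP[km1]; rewrite lt_min => /andP[kd1 kd2].
have E1 := H1 k km1; have E2 := D1 k kd1; have E3 := D2 k kd2.
rewrite -(ler_pM2l k0).
have -> : k * `|Fb (a0 + h) - Fb a0 - h * Fab a0 b0|
    = `|k * (Fb (a0 + h) - Fb a0 - h * Fab a0 b0)| by rewrite normrM (gtr0_norm k0).
set A := (X in `|X - h * k * _| <= _) in E1.
have -> : k * (Fb (a0 + h) - Fb a0 - h * Fab a0 b0)
    = (A - h * k * Fab a0 b0) - (F (a0 + h) (b0 + k) - F (a0 + h) b0 - k * Fb (a0 + h))
      + (F a0 (b0 + k) - F a0 b0 - k * Fb a0) by rewrite /A; ring.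
apply: le_trans (ler_normD _ _) _.
apply: le_trans (lerD (ler_normB _ _) (lexx _)) _.
apply: le_trans (lerD (lerD E1 E2) E3) _.
rewrite (gtr0_norm k0).
have -> : `|h| * k * (e / 2) + e / 4 * `|h| * k + e / 4 * `|h| * k = k * (e * `|h|) by field.
exact: lexx.
Qed.

(** With [G] the primitive of the bound, both [G + f] and [G - f] are nondecreasing and vanish at 0.
    The derivative is only required inside the interval, because the equation satisfied by a
    parabolic solution holds for positive times only. *)
Lemma derivative_bound f f' (tau M : R) n : 0 < tau ->
  {within `[0, tau], continuous f} ->
  (forall t, 0 < t -> t < tau -> is_derive t (1 : R) f (f' t)) ->
  (forall t, 0 < t -> t < tau -> `|f' t| <= M * (t ^+ n / n`!%:R)) ->
  f 0 = 0 -> forall t, 0 <= t -> t <= tau ->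
  `|f t| <= M * (t ^+ n.+1 / n.+1`!%:R).
Proof.
move=> tau0 cf df bf f0 t t0 tt.
pose G (t : R) := M * (t ^+ n.+1 / n.+1`!%:R).
have dG (s : R) : is_derive s (1 : R) G (M * (s ^+ n / n`!%:R)).
  rewrite /G.
  have -> : (fun t : R => M * (t ^+ n.+1 / n.+1`!%:R)) = (fun t => M / n.+1`!%:R * t ^+ n.+1).
    by apply/funext => r; ring.
  apply: is_derive_eq (is_derZ _ (is_derX _ _)) _.
  rewrite factS natrM; field.
  by rewrite -[1]/(1%:R) -natrD !pnatr_eq0 -lt0n fact_gt0.
have cG : {within `[0, tau], continuous G}.
  by apply: continuous_in_subspaceT => c _; exact: is_derive_continuous (dG c).
have mono (e : R) : `|e| <= 1 -> 0 <= G t + e * f t.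
  move=> e1.
  have dH s : 0 < s -> s < tau ->
      is_derive s (1 : R) (fun s => G s + e * f s) (M * (s ^+ n / n`!%:R) + e * f' s).
    move=> s0 st; have := df s s0 st => H.
    by apply: is_derD => //; exact: is_derZ.
  have -> : (0 : R) = G 0 + e * f 0 by rewrite f0 /G expr0n /= mul0r mulr0 mulr0 addr0.
  have := @ger0_derive1_le_cc R (fun s => G s + e * f s) 0 tau.
  move=> /(_ _ _ _ 0 t); apply => //.
  - by move=> s; rewrite in_itv /= => /andP[s0 st]; case: (dH s s0 st).
  - move=> s; rewrite in_itv /= => /andP[s0 st].
    rewrite derive1E; have [_ ->] := dH s s0 st.
    have := bf s s0 st; rewrite ler_norml => /andP[b1 b2].
    move: e1; rewrite ler_norml => /andP[e1 e2].
    have : `|e * f' s| <= M * (s ^+ n / n`!%:R).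
      rewrite normrM; apply: le_trans (bf s s0 st).
      by rewrite ler_piMl // ler_norml e1.
    by rewrite ler_norml => /andP[+ _]; rewrite addrC -subr_ge0 opprK.
  - move=> x; apply: cvgD; first exact: cG.
    by apply: cvgM; [exact: cvg_cst | exact: cf].
  - by rewrite in_itv /= lexx ltW.
  - by rewrite in_itv /= t0.
have m1 := mono 1; have m2 := mono (-1).
rewrite normrN normr1 in m2; rewrite normr1 in m1.
have := m1 (lexx _); have := m2 (lexx _).
by rewrite mul1r mulN1r => h1 h2; rewrite ler_norml -/(G t); apply/andP; split; lra.
Qed.

(** The chain [h] stands for the successive derivatives of [h 0]. The remainder of [h 0] vanishes at
    0 and its derivative is the remainder, one order lower, of the shifted chain, so that
    [derivative_bound] gives the induction step. The lemma serves both for the solution of the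
    parabolic equation and for the expectation along one Euler step. *)
Lemma taylor_chain (h : nat -> R -> R) (tau M : R) n : 0 < tau ->
  (forall j, {within `[0, tau], continuous (h j)}) ->
  (forall j t, 0 < t -> t < tau -> is_derive t (1 : R) (h j) (h j.+1 t)) ->
  (forall t, 0 < t -> t < tau -> `|h n.+1 t| <= M) ->
  `|h 0%N tau - \sum_(j < n.+1) tau ^+ j / j`!%:R * h j 0|
    <= M * (tau ^+ n.+1 / n.+1`!%:R).
Proof.
move=> tau0 ch dh bh.
pose T n (h : nat -> R -> R) (t : R) := \sum_(j < n) t ^+ j / j`!%:R * h j 0.
suff H : forall t, 0 <= t -> t <= tau ->
    `|h 0%N t - T n.+1 h t| <= M * (t ^+ n.+1 / n.+1`!%:R).
  exact: (H tau (ltW tau0) (lexx _)).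
have dT m (h' : nat -> R -> R) (t : R) :
    is_derive t (1 : R) (T m.+1 h') (T m (fun j => h' j.+1) t).
  elim: m h' => [|m IH] h'.
    rewrite /T big_ord0.
    have -> : (fun t => \sum_(j < 1) t ^+ j / j`!%:R * h' j 0) = cst (h' 0%N 0).
      by apply/funext => s; rewrite big_ord1 expr0 fact0 divr1 mul1r.
    exact: is_derive_cst.
  have -> : T m.+2 h' = (fun s => T m.+1 h' s + h' m.+1 0 / m.+1`!%:R * s ^+ m.+1).
    by apply/funext => s /=; rewrite /T big_ord_recr /=; congr (_ + _); ring.
  have -> : T m.+1 (fun j => h' j.+1) t
      = T m (fun j => h' j.+1) t + h' m.+1 0 / m.+1`!%:R * (m.+1%:R * t ^+ m).
    rewrite /T big_ord_recr /=; congr (_ + _).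
    by rewrite factS natrM; field; rewrite -[1]/(1%:R) -natrD !pnatr_eq0 -lt0n fact_gt0.
  by apply: is_derD => //; apply: is_derZ; exact: is_derX.
have cT m (h' : nat -> R -> R) : {within `[0, tau], continuous (T m.+1 h')}.
  by apply: continuous_in_subspaceT => c _; exact: is_derive_continuous (dT m h' c).
have T0 m (h' : nat -> R -> R) : T m.+1 h' 0 = h' 0%N 0.
  rewrite /T big_ord_recl expr0 fact0 divr1 mul1r big1 ?addr0 // => i _.
  by rewrite expr0n /= mul0r mul0r.
elim: n h ch dh bh => [|n IH] h ch dh bh.
  move=> t t0 tt.
  apply: (@derivative_bound (fun t => h 0%N t - T 1%N h t) (h 1%N) tau) => //.
  - by move=> x; apply: cvgB; [exact: ch|exact: cT].
  - move=> s s0 st; have := dh 0%N s s0 st; have := dT 0%N h s.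
    rewrite /T big_ord0 => H1 H2.
    have -> : h 1%N s = h 1%N s - 0 by rewrite subr0.
    exact: is_derB.
  - by move=> s s0 st; rewrite expr0 fact0 divr1 mulr1; exact: bh.
  - by rewrite T0 subrr.
move=> t t0 tt.
apply: (@derivative_bound (fun t => h 0%N t - T n.+2 h t)
   (fun t => h 1%N t - T n.+1 (fun j => h j.+1) t) tau) => //.
- by move=> x; apply: cvgB; [exact: ch|exact: cT].
- move=> s s0 st; have := dh 0%N s s0 st; have := dT n.+1 h s => H1 H2.
  exact: is_derB.
- move=> s s0 st; apply: IH => //; by rewrite ltW.
- by rewrite T0 subrr.
Qed.

End RealCalculus.

(** * Smooth functions on the torus *)

Section SmoothFunctions.
Context {R : realType} {d : nat}.
Implicit Types (psi phi : 'rV[R]_d -> R) (x y v z : 'rV[R]_d) (i j : 'I_d) (s t : seq 'I_d).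

(* Unlike the quantification over words in [smooth], suited to induction. *)
Fixpoint smooth_upto n psi : Prop := continuous psi /\
  if n is n'.+1 then
    (forall i x, derivable psi x (basis_vector i)) /\
    (forall i, smooth_upto n' (partial i psi))
  else True.

Lemma partials_rcons s i psi : partials (rcons s i) psi = partials s (partial i psi).
Proof. exact: foldr_rcons. Qed.

Lemma smooth_uptoP psi : smooth psi <-> forall n, smooth_upto n psi.
Proof.
split=> [H n|H s].
  elim: n psi H => [|n IH] psi H /=; first by split => //; case: (H [::]).
  split; first by case: (H [::]).
  split; first by case: (H [::]).
  by move=> i; apply: IH => s; rewrite -partials_rcons.
elim/last_ind: s psi H => [|s i IH] psi H.
  by have [? [? ?]] := H 1%N.
rewrite partials_rcons; apply: IH => n.
by have /= [_ [_ ]] := H n.+1; apply.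
Qed.

Lemma smooth_uptoW n psi : smooth_upto n.+1 psi -> smooth_upto n psi.
Proof.
elim: n psi => [|n IH] psi /=; first by case.
by move=> [c [df H]]; split => //; split => // i; apply: IH; exact: H.
Qed.

Lemma smooth_continuous psi : smooth psi -> continuous psi.
Proof. by move=> /(_ [::]) []. Qed.

Lemma smooth_is_derive psi i x : smooth psi ->
  is_derive x (basis_vector i) psi (partial i psi x).
Proof. by move=> /(_ [::]) [_ H]; apply/derivableP/H. Qed.

Lemma partial_eq psi i dpsi :
  (forall x, is_derive x (basis_vector i) psi (dpsi x)) -> partial i psi = dpsi.
Proof. by move=> H; apply/funext => x; have [_ <-] := H x. Qed.

Lemma smooth_partial psi i : smooth psi -> smooth (partial i psi).
Proof. by move=> H s; rewrite -partials_rcons; exact: H. Qed.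

Lemma smooth_partials psi s : smooth psi -> smooth (partials s psi).
Proof. by move=> H; elim: s => [//|i s IH] /=; exact: smooth_partial. Qed.

Lemma partial_cst (c : R) i : partial i (fun=> c) = fun=> 0.
Proof. by apply: partial_eq => x; exact: is_derC. Qed.

Lemma partialD psi phi i : smooth psi -> smooth phi ->
  partial i (fun x => psi x + phi x) = fun x => partial i psi x + partial i phi x.
Proof.
by move=> H1 H2; apply: partial_eq => x; apply: is_derD; exact: smooth_is_derive.
Qed.

Lemma partialM psi phi i : smooth psi -> smooth phi ->
  partial i (fun x => psi x * phi x)
  = fun x => partial i psi x * phi x + psi x * partial i phi x.
Proof.
by move=> H1 H2; apply: partial_eq => x; apply: is_derM; exact: smooth_is_derive.
Qed.

Lemma smooth_upto_cst (c : R) n : smooth_upto n (fun=> c).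
Proof.
elim: n c => [|n IH] c /=; first by split => //; exact: cst_continuous.
split; first exact: cst_continuous.
split; first by move=> i x; case: (is_derC c x (basis_vector i)).
by move=> i; rewrite partial_cst.
Qed.

Lemma smooth_uptoD psi phi n : smooth_upto n psi -> smooth_upto n phi ->
  smooth_upto n (fun x => psi x + phi x).
Proof.
elim: n psi phi => [|n IH] psi phi /=.
  by move=> [c1 _] [c2 _]; split => // x; exact: (continuousD (c1 x) (c2 x)).
move=> [c1 [d1 H1]] [c2 [d2 H2]].
split; first by move=> x; exact: (continuousD (c1 x) (c2 x)).
have D i x : is_derive x (basis_vector i) (fun x => psi x + phi x)
    (partial i psi x + partial i phi x) by apply: is_derD; exact: derivableP.
split; first by move=> i x; case: (D i x).
by move=> i; rewrite (partial_eq (D i)); exact: IH.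
Qed.

Lemma smooth_uptoM psi phi n : smooth_upto n psi -> smooth_upto n phi ->
  smooth_upto n (fun x => psi x * phi x).
Proof.
elim: n psi phi => [|n IH] psi phi.
  by move=> /= [c1 _] [c2 _]; split => // x; exact: (continuousM (c1 x) (c2 x)).
move=> S1 S2; have W1 := smooth_uptoW S1; have W2 := smooth_uptoW S2.
move: S1 S2 => /= [c1 [d1 H1]] [c2 [d2 H2]].
split; first by move=> x; exact: (continuousM (c1 x) (c2 x)).
have D i x : is_derive x (basis_vector i) (fun x => psi x * phi x)
    (partial i psi x * phi x + psi x * partial i phi x).
  by apply: is_derM; exact: derivableP.
split; first by move=> i x; case: (D i x).
by move=> i; rewrite (partial_eq (D i)); apply: smooth_uptoD; exact: IH.
Qed.

Lemma smooth_cst (c : R) : smooth (fun _ : 'rV[R]_d => c).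
Proof. by apply/smooth_uptoP => n; exact: smooth_upto_cst. Qed.

Lemma smoothD psi phi : smooth psi -> smooth phi -> smooth (fun x => psi x + phi x).
Proof.
by move=> /smooth_uptoP H1 /smooth_uptoP H2; apply/smooth_uptoP => n; exact: smooth_uptoD.
Qed.

Lemma smoothM psi phi : smooth psi -> smooth phi -> smooth (fun x => psi x * phi x).
Proof.
by move=> /smooth_uptoP H1 /smooth_uptoP H2; apply/smooth_uptoP => n; exact: smooth_uptoM.
Qed.

Lemma is_derive_line (psi : 'rV[R]_d -> R) x v (r l : R) :
  is_derive (x + r *: v) v psi l ->
  is_derive r (1 : R) (fun r => psi (x + r *: v)) l.
Proof.
have E : (fun h : R => h^-1 *: (psi (h *: v + (x + r *: v)) - psi (x + r *: v)))
   = (fun h : R => h^-1 *: (psi (x + (h *: 1 + r) *: v) - psi (x + r *: v))).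
  apply/funext => h; congr (_ *: (psi _ - _)).
  by rewrite -[h *: 1]/(h * 1) mulr1 scalerDl addrCA addrA.
move=> [d1 d2]; split; first by move: d1; rewrite /derivable /= E.
by move: d2; rewrite /derive /= E.
Qed.

Lemma is_derive_axis psi i x (r : R) : smooth psi ->
  is_derive r (1 : R) (fun r => psi (x + r *: basis_vector i))
    (partial i psi (x + r *: basis_vector i)).
Proof. by move=> H; apply: is_derive_line; exact: smooth_is_derive. Qed.

Lemma continuous_coord psi (x : 'rV[R]_d) : continuous psi -> forall e : R, 0 < e ->
  exists2 del : R, 0 < del & forall z : 'rV[R]_d, (forall i, `|z 0 i| < del) ->
    `|psi (x + z) - psi x| <= e.
Proof.
move=> /(_ x) /cvgrPdist_le H e e0; have := H e e0.
move=> /nbhs_ballP [del del0 Hd]; exists del => // z Hz.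
rewrite distrC; apply: Hd; split => // k i.
by rewrite mxE (ord1 k) /ball /= opprD addNKr normrN.
Qed.

Lemma basis_vectorE i j : (@basis_vector R d i) 0 j = (i == j)%:R.
Proof. by rewrite mxE eqxx eq_sym. Qed.

(* The chain rule along a line: the increment in [psi] is telescoped over the
   coordinates. *)
Lemma is_derive_direction psi (x v : 'rV[R]_d) (r : R) : smooth psi ->
  is_derive r (1 : R) (fun r => psi (x + r *: v))
    (\sum_i v 0 i * partial i psi (x + r *: v)).
Proof.
move=> Hs; apply/is_derive_epsP => e e0.
pose y := x + r *: v.
(* The summand 1 keeps [A] positive when [v = 0]. *)
pose A := \sum_i `|v 0 i| + 1.
have A0 : 0 < A by rewrite ltr_wpDl // sumr_ge0.
have vA i : `|v 0 i| <= A.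
  rewrite /A (bigD1 i) //= -addrA lerDl addr_ge0 // sumr_ge0 //.
have [del del0 Hd] : exists2 del : R, 0 < del & forall i (z : 'rV[R]_d), (forall j, `|z 0 j| < del) ->
    `|partial i psi (y + z) - partial i psi y| <= e / A.
  have eA : 0 < e / A by rewrite divr_gt0.
  have /choice [D HD] : forall i, exists D : R, 0 < D /\
      forall z : 'rV[R]_d, (forall j, `|z 0 j| < D) ->
      `|partial i psi (y + z) - partial i psi y| <= e / A.
    move=> i.
    have [D D0 H] := continuous_coord y (smooth_continuous (smooth_partial i Hs)) eA.
    by exists D.
  exists (\big[Num.min/1]_i D i).
    by apply: lt_bigmin => // i _; case: (HD i).
  move=> i z Hz; apply: (HD i).2 => j; apply: lt_le_trans (Hz j) _.
  exact: bigmin_le_cond.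
exists (del / A) => [|h hd]; first by rewrite divr_gt0.
pose w (k : nat) : 'rV[R]_d := \row_j (if (j < k)%N then h * v 0 j else 0).
have w0 : w 0%N = 0 by apply/rowP => j; rewrite !mxE ltn0.
have wd : w d = h *: v by apply/rowP => j; rewrite !mxE ltn_ord.
have wS (k : 'I_d) : w k.+1 = w k + (h * v 0 k) *: basis_vector k.
  apply/rowP => j; rewrite !mxE eqxx /= ltnS leq_eqVlt.
  have [->|jk] := eqVneq j k; first by rewrite ltnn eqxx /= mulr1 add0r.
  by rewrite -val_eqE /= in jk; rewrite (negbTE jk) /= mulr0 addr0.
have hv j : `|h * v 0 j| < del.
  rewrite normrM; apply: le_lt_trans (ler_wpM2l (normr_ge0 _) (vA j)) _.
  by rewrite -ltr_pdivlMr.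
have -> : x + (r + h) *: v = y + w d by rewrite wd scalerDl addrA.
rewrite -/y.
have -> : psi (y + w d) - psi y = \sum_(k < d) (psi (y + w k.+1) - psi (y + w k)).
  rewrite -(big_mkord xpredT (fun k => psi (y + w k.+1) - psi (y + w k))).
  by rewrite telescope_sumr // w0 addr0.
have step (k : 'I_d) : `|psi (y + w k.+1) - psi (y + w k) - h * (v 0 k * partial k psi y)|
    <= `|h * v 0 k| * (e / A).
  have [c ch] := @mean_value R (fun r => psi (y + w k + r *: basis_vector k))
     (fun r => partial k psi (y + w k + r *: basis_vector k)) 0 (h * v 0 k)
     (fun c _ => is_derive_axis k (y + w k) c Hs).
  rewrite add0r scale0r addr0 -addrA -wS => ->.
  rewrite mulrA -mulrBr normrM ler_wpM2l // -addrA; apply: Hd => j.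
  rewrite !mxE eqxx /=; rewrite subr0 in ch.
  have [->|jk] := eqVneq j k.
    by rewrite ltnn add0r mulr1; exact: le_lt_trans ch (hv k).
  by rewrite mulr0 addr0; case: ifP => _; rewrite ?normr0.
have -> : \sum_(k < d) (psi (y + w k.+1) - psi (y + w k)) - h * (\sum_i v 0 i * partial i psi y)
   = \sum_(k < d) (psi (y + w k.+1) - psi (y + w k) - h * (v 0 k * partial k psi y)).
  by rewrite mulr_sumr -sumrB.
apply: le_trans (ler_norm_sum _ _ _) _.
apply: le_trans (ler_sum _ (fun k _ => step k)) _.
have -> : \sum_(k < d) `|h * v 0 k| * (e / A) = e * `|h| * ((\sum_i `|v 0 i|) / A).
  by under eq_bigr do rewrite normrM; rewrite -mulr_suml -mulr_sumr; ring.
by rewrite ler_piMr ?mulr_ge0 ?(ltW e0) // ler_pdivrMr // mul1r lerDl.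
Qed.

Lemma partialC psi i j : smooth psi ->
  partial i (partial j psi) = partial j (partial i psi).
Proof.
move=> Hs; apply: partial_eq => x.
pose P (a b : R) := x + a *: basis_vector i + b *: basis_vector j.
have H : is_derive (0 : R) (1 : R) (fun a : R => partial j psi (P a 0))
    (partial j (partial i psi) (P 0 0)).
  refine (@schwarz R (fun a b => psi (P a b)) (fun a b => partial i psi (P a b))
    (fun a b => partial j (partial i psi) (P a b)) (fun a => partial j psi (P a 0))
    0 0 1 ltr01 _ _ _ _).
  - move=> a b _ _; rewrite /P.
    under eq_fun do rewrite addrAC.
    rewrite addrAC; exact: is_derive_axis.
  - by move=> a b _ _; apply: is_derive_axis; exact: smooth_partial.
  - by move=> a _; exact: is_derive_axis.
  - move=> e e0; have Hc := smooth_continuous (smooth_partial j (smooth_partial i Hs)).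
    have [del del0 Hd] := continuous_coord x Hc e0.
    exists (del / 2) => [|a b]; first by rewrite divr_gt0.
    rewrite !subr0 => Ha Hb.
    have -> : P 0 0 = x by rewrite /P !scale0r !addr0.
    rewrite /P -addrA; apply: Hd => k; rewrite !mxE eqxx /=.
    apply: le_lt_trans (ler_normD _ _) _; rewrite (splitr del).
    by apply: ltrD; [move: Ha|move: Hb]; apply: le_lt_trans;
      rewrite normrM ler_piMr // ger0_norm // lern1; case: (_ == _).
have := H; rewrite /P !scale0r !addr0.
under eq_fun do rewrite addr0.
move=> H'.
have E : (fun h : R => h^-1 *: (partial j psi (h *: basis_vector i + x) - partial j psi x))
   = (fun h : R => h^-1 *: (partial j psi (x + (h *: (1 : R) + 0) *: basis_vector i)
       - partial j psi (x + (0 : R) *: basis_vector i))).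
  apply/funext => h; congr (_ *: (partial j psi _ - partial j psi _)).
    by rewrite addr0 -[h *: 1]/(h * 1) mulr1 addrC.
  by rewrite scale0r addr0.
case: H' => d1 d2; split; first by move: d1; rewrite /derivable /= -E.
by move: d2; rewrite /derive /= -E.
Qed.

Lemma partials_cat s t psi : partials (s ++ t) psi = partials s (partials t psi).
Proof. exact: foldr_cat. Qed.

Lemma partials_perm s t psi : smooth psi -> perm_eq s t ->
  partials s psi = partials t psi.
Proof.
move=> Hs; elim: s t => [|i s IH] t st; first by move: st; rewrite perm_sym => /perm_nilP ->.
have it : i \in t by rewrite -(perm_mem st) mem_head.
move: st; case/splitPr: it => t1 t2; rewrite perm_sym perm_catC /= perm_cons perm_catC.
rewrite perm_sym => /IH /= ->.
elim: t1 {IH} => [//|j t1 IH] /=.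
by rewrite (partialC i j (smooth_partials (t1 ++ t2) Hs)) IH.
Qed.

(** A substitute for [Ck_norm k psi <= M] with real bounds and words instead of multi-indices: a
    derivative can be split off at either end of a word, which allows induction on [k]. *)
Definition bounded_upto k (M : R) psi : Prop :=
  forall s, (size s <= k)%N -> forall x, `|partials s psi x| <= M.

Lemma multi_partialE (j : {ffun 'I_d -> nat}) psi :
  multi_partial j psi = partials (flatten [seq nseq (j i) i | i <- enum 'I_d]) psi.
Proof.
rewrite /multi_partial; elim: (enum 'I_d) => [//|i e IH] /=.
rewrite partials_cat -IH; elim: (j i) => [//|n IHn] /=.
by rewrite IHn.
Qed.

Lemma size_multi_index (j : {ffun 'I_d -> nat}) :
  size (flatten [seq nseq (j i) i | i <- enum 'I_d]) = multi_degree j.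
Proof.
rewrite size_flatten /shape -map_comp /multi_degree -[in RHS]big_enum /=.
rewrite sumnE big_map; apply: eq_bigr => i _ /=; exact: size_nseq.
Qed.

Lemma Ck_norm_le k M psi : bounded_upto k M psi -> (Ck_norm k psi <= M%:E)%E.
Proof.
move=> H; apply: ge_ereal_sup => _ [j [x [jk ->]]].
by rewrite lee_fin multi_partialE; apply: H; rewrite size_multi_index.
Qed.

(** By Schwarz' theorem a word gives the same derivative as the multi-index that counts its
    letters. *)
Lemma bounded_upto_Ck_norm k M psi : smooth psi ->
  (Ck_norm k psi <= M%:E)%E -> bounded_upto k M psi.
Proof.
move=> Hs H s sk x; rewrite -lee_fin; apply: le_trans H.
pose j : {ffun 'I_d -> nat} := [ffun i => count_mem i s].
have ps : perm_eq (flatten [seq nseq (j i) i | i <- enum 'I_d]) s.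
  apply/allP => i _ /=; rewrite count_flatten -map_comp /=.
  rewrite sumnE big_map big_enum /= (bigD1 i) //= count_nseq /= eqxx mul1n ffunE.
  rewrite big1 ?addn0 // => k' k'i; rewrite count_nseq /=.
  by rewrite (negbTE k'i) mul0n.
apply: ereal_sup_ubound; exists j, x; split.
  by rewrite -size_multi_index (perm_size ps).
by rewrite multi_partialE (partials_perm Hs ps).
Qed.

Lemma bounded_uptoS k M psi : bounded_upto k.+1 M psi <->
  (forall x, `|psi x| <= M) /\ forall i, bounded_upto k M (partial i psi).
Proof.
split=> [H|[H0 H] s].
  split; first exact: (H [::]).
  by move=> i s sk; rewrite -partials_rcons; apply: H; rewrite size_rcons.
case/lastP: s => [|s i]; first by move=> _; exact: H0.
by rewrite size_rcons partials_rcons ltnS; exact: H.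
Qed.

Lemma bounded_upto0 M psi : bounded_upto 0 M psi <-> forall x, `|psi x| <= M.
Proof.
split=> [H x|H s]; first exact: (H [::]).
by rewrite leqn0 size_eq0 => /eqP ->.
Qed.

Lemma bounded_uptoW k l M N psi : (k <= l)%N -> M <= N ->
  bounded_upto l M psi -> bounded_upto k N psi.
Proof.
by move=> kl MN H s sk x; apply: le_trans MN; apply: H; exact: leq_trans kl.
Qed.

Lemma bounded_upto_ge0 k M psi : bounded_upto k M psi -> 0 <= M.
Proof. by move=> /(_ [::] (leq0n _) 0); exact: le_trans (normr_ge0 _). Qed.

Lemma bounded_upto_sup k M psi x : bounded_upto k M psi -> `|psi x| <= M.
Proof. by move=> /(_ [::] (leq0n _)). Qed.

Lemma bounded_upto_cst k (c : R) : bounded_upto k `|c| (fun=> c).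
Proof.
elim: k c => [|k IH] c; first by apply/bounded_upto0.
apply/bounded_uptoS; split => // i; rewrite partial_cst.
by apply: (bounded_uptoW (leqnn k) (normr_ge0 c)); have := IH 0; rewrite normr0.
Qed.

Lemma bounded_uptoD k M N psi phi : smooth psi -> smooth phi ->
  bounded_upto k M psi -> bounded_upto k N phi ->
  bounded_upto k (M + N) (fun x => psi x + phi x).
Proof.
elim: k psi phi => [|k IH] psi phi S1 S2.
  move=> /bounded_upto0 H1 /bounded_upto0 H2; apply/bounded_upto0 => x.
  by apply: le_trans (ler_normD _ _) _; exact: lerD.
move=> /bounded_uptoS [H1 D1] /bounded_uptoS [H2 D2]; apply/bounded_uptoS; split.
  by move=> x; apply: le_trans (ler_normD _ _) _; exact: lerD.
move=> i; rewrite (partialD i S1 S2).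
exact: (IH _ _ (smooth_partial i S1) (smooth_partial i S2) (D1 i) (D2 i)).
Qed.

(** Each application of the Leibniz rule doubles the number of terms, whence [2 ^+ k]. *)
Lemma bounded_uptoM k M N psi phi : smooth psi -> smooth phi ->
  bounded_upto k M psi -> bounded_upto k N phi ->
  bounded_upto k (2 ^+ k * M * N) (fun x => psi x * phi x).
Proof.
elim: k psi phi => [|k IH] psi phi S1 S2 B1 B2.
  apply/bounded_upto0 => x; rewrite expr0 mul1r normrM.
  exact: (ler_pM (normr_ge0 _) (normr_ge0 _) (bounded_upto_sup x B1) (bounded_upto_sup x B2)).
have W1 := bounded_uptoW (leqnSn k) (lexx M) B1.
have W2 := bounded_uptoW (leqnSn k) (lexx N) B2.
have M0 := bounded_upto_ge0 B1; have N0 := bounded_upto_ge0 B2.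
move: B1 B2 => /bounded_uptoS [H1 D1] /bounded_uptoS [H2 D2]; apply/bounded_uptoS; split.
  move=> x; rewrite normrM -mulrA.
  apply: (le_trans (ler_pM (normr_ge0 _) (normr_ge0 _) (H1 x) (H2 x))).
  rewrite ler_peMl ?(mulr_ge0 M0 N0) //. by rewrite exprn_ege1 // ler1n.
move=> i; rewrite (partialM i S1 S2).
have -> : 2 ^+ k.+1 * M * N = 2 ^+ k * M * N + 2 ^+ k * M * N by rewrite exprS; ring.
have [T1 T2] := (smooth_partial i S1, smooth_partial i S2).
exact: (bounded_uptoD (smoothM T1 S2) (smoothM S1 T2)
  (IH _ _ T1 S2 (D1 i) W2) (IH _ _ S1 T2 W1 (D2 i))).
Qed.

End SmoothFunctions.

(** * Periodic functions and Taylor's formula along a direction *)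

Section TorusFunctions.
Context {R : realType} {d : nat}.
Implicit Types (psi phi : 'rV[R]_d -> R) (x y v z : 'rV[R]_d) (i j : 'I_d).

Lemma periodic_partial psi i : Defs.periodic psi -> Defs.periodic (partial i psi).
Proof.
move=> H x j; rewrite /partial /derive.
have -> : (fun h : R => h^-1 *: ((psi \o shift (x + basis_vector j)) (h *: basis_vector i)
      - psi (x + basis_vector j)))
   = (fun h => h^-1 *: ((psi \o shift x) (h *: basis_vector i) - psi x)).
  by apply/funext => h /=; rewrite addrA !H.
by [].
Qed.

Lemma smooth_torus_cst (c : R) : smooth_torus (fun _ : 'rV[R]_d => c).
Proof. by split => //; exact: smooth_cst. Qed.

Lemma smooth_torusD psi phi : smooth_torus psi -> smooth_torus phi ->
  smooth_torus (fun x => psi x + phi x).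
Proof.
move=> [p1 s1] [p2 s2]; split; last exact: smoothD.
by move=> x i; rewrite p1 p2.
Qed.

Lemma smooth_torusM psi phi : smooth_torus psi -> smooth_torus phi ->
  smooth_torus (fun x => psi x * phi x).
Proof.
move=> [p1 s1] [p2 s2]; split; last exact: smoothM.
by move=> x i; rewrite p1 p2.
Qed.

Lemma smooth_torusZ (c : R) psi : smooth_torus psi -> smooth_torus (fun x => c * psi x).
Proof. by move=> H; exact: smooth_torusM (smooth_torus_cst c) H. Qed.

Lemma smooth_torusN psi : smooth_torus psi -> smooth_torus (fun x => - psi x).
Proof.
move=> /(smooth_torusZ (-1)); congr smooth_torus.
by apply/funext => x; rewrite mulN1r.
Qed.

Lemma smooth_torusB psi phi : smooth_torus psi -> smooth_torus phi ->
  smooth_torus (fun x => psi x - phi x).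
Proof. by move=> H1 H2; exact: smooth_torusD H1 (smooth_torusN H2). Qed.

Lemma smooth_torus_sum (I : Type) (r : seq I) (P : pred I) (F : I -> 'rV[R]_d -> R) :
  (forall k, P k -> smooth_torus (F k)) ->
  smooth_torus (fun x => \sum_(k <- r | P k) F k x).
Proof.
move=> H; elim: r => [|k r IH].
  by under eq_fun do rewrite big_nil; exact: smooth_torus_cst.
under eq_fun do rewrite big_cons.
by case Pk : (P k); [exact: smooth_torusD (H k Pk) IH|exact: IH].
Qed.

Lemma smooth_torus_partial psi i : smooth_torus psi -> smooth_torus (partial i psi).
Proof. by move=> [p s]; split; [exact: periodic_partial|exact: smooth_partial]. Qed.

Lemma partialZ (c : R) psi i : smooth psi ->
  partial i (fun x => c * psi x) = fun x => c * partial i psi x.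
Proof. by move=> s; apply: partial_eq => x; apply: is_derZ; exact: smooth_is_derive. Qed.

Lemma partial_sum (I : Type) (r : seq I) (P : pred I) (F : I -> 'rV[R]_d -> R) i :
  (forall k, P k -> smooth (F k)) ->
  partial i (fun x => \sum_(k <- r | P k) F k x)
  = fun x => \sum_(k <- r | P k) partial i (F k) x.
Proof.
move=> H; apply: partial_eq => x; apply: is_der_sum => k Pk.
by apply: smooth_is_derive; exact: H.
Qed.

Lemma periodic_int psi x i (n : int) : Defs.periodic psi ->
  psi (x + n%:~R *: basis_vector i) = psi x.
Proof.
move=> H; have Hn (m : nat) y : psi (y + m%:R *: basis_vector i) = psi y.
  elim: m y => [|m IH] y; first by rewrite scale0r addr0.
  by rewrite -natr1 scalerDl scale1r addrA H IH.
case: n => m; first exact: Hn.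
by rewrite NegzE mulrNz scaleNr -(Hn m.+1 (x - _)) subrK.
Qed.

Lemma periodic_reduce psi x : Defs.periodic psi ->
  exists2 y : 'rV[R]_d, (forall i, 0 <= y 0 i <= 1) & psi x = psi y.
Proof.
move=> H; exists (x + \sum_i (- Num.floor (x 0 i))%:~R *: basis_vector i).
  move=> i; rewrite mxE summxE (bigD1 i) //= big1 ?addr0.
    rewrite !mxE !eqxx mulr1 mulrNz.
    have /andP[h1 h2] := floor_itv (x 0 i); rewrite intrD in h2.
    by rewrite subr_ge0 h1 lerBlDr addrC ltW.
  by move=> j ji; rewrite !mxE eqxx eq_sym (negbTE ji) mulr0.
suff E r : psi (x + \sum_(i <- r) (- Num.floor (x 0 i))%:~R *: basis_vector i) = psi x.
  by rewrite E.
elim: r => [|i r IH]; first by rewrite big_nil addr0.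
by rewrite big_cons addrCA addrC periodic_int.
Qed.

Lemma periodic_bounded psi : continuous psi -> Defs.periodic psi ->
  exists M, forall x, `|psi x| <= M.
Proof.
move=> c p.
pose A := [set v : 'rV[R]_d | forall i, `[(0 : R), 1]%classic (v ord0 i)].
have cA : compact A.
  apply: (@rV_compact _ _ (fun=> `[(0 : R), 1]%classic)) => i; exact: segment_compact.
have A0 : A !=set0.
  by exists 0 => i; rewrite /= in_itv /= mxE lexx ler01.
have cn : continuous (fun x => `|psi x|).
  by move=> x; exact: (continuous_comp (c x) (@norm_continuous _ _ _)).
have [x _ Hx] := EVT_max_rV A0 cA (continuous_subspaceT cn).
exists `|psi x| => y; have [z z01 ->] := periodic_reduce y p.
apply: Hx; rewrite inE => i /=; rewrite in_itv /=; exact: z01.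
Qed.

Lemma smooth_torus_bounded k psi : smooth_torus psi ->
  exists M, bounded_upto k M psi.
Proof.
elim: k psi => [|k IH] psi [p s].
  have [M HM] := periodic_bounded (smooth_continuous s) p.
  by exists M; apply/bounded_upto0.
have [M0 HM0] := periodic_bounded (smooth_continuous s) p.
have /choice [M HM] : forall i, exists M, bounded_upto k M (partial i psi).
  by move=> i; apply: IH; exact: smooth_torus_partial.
exists (`|M0| + \sum_i `|M i|); apply/bounded_uptoS; split.
  move=> x; apply: (le_trans (HM0 x)).
  by apply: (le_trans (ler_norm _)); rewrite lerDl sumr_ge0.
move=> i; apply: (bounded_uptoW (leqnn k) _ (HM i)).
apply: (le_trans (ler_norm _)); rewrite (bigD1 i) //= addrCA lerDl.
by rewrite addr_ge0 // sumr_ge0.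
Qed.

Definition direction v psi : 'rV[R]_d -> R := fun x => \sum_i v 0 i * partial i psi x.

Lemma smooth_direction v psi : smooth psi -> smooth (direction v psi).
Proof.
move=> s; rewrite /direction.
elim: (index_enum _) => [|i r IH].
  by under eq_fun do rewrite big_nil; exact: smooth_cst.
under eq_fun do rewrite big_cons.
exact: (smoothD (smoothM (smooth_cst _) (smooth_partial i s)) IH).
Qed.

(** Taylor's formula in one variable on the segment from [x] to [x + v], along which the derivatives
    are the iterates of [direction v]. *)
Lemma taylor_direction k M x v psi : smooth psi ->
  (forall y, `|iter k.+1 (direction v) psi y| <= M) ->
  `|psi (x + v) - \sum_(j < k.+1) j`!%:R^-1 * iter j (direction v) psi x|
    <= M / k.+1`!%:R.
Proof.
move=> s HM.
have si (j : nat) : smooth (iter j (direction v) psi).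
  elim: j => [|j IH]; [exact: s|rewrite iterS; exact: (smooth_direction v IH)].
pose h (j : nat) (r : R) := iter j (direction v) psi (x + r *: v).
have dh (j : nat) r : is_derive r (1 : R) (h j) (h j.+1 r).
  by rewrite /h iterS; exact: (is_derive_direction x v r (si j)).
have := @taylor_chain R h 1 M k ltr01 _ (fun (j : nat) t _ _ => dh j t) (fun t _ _ => HM _).
have -> : \sum_(j < k.+1) 1 ^+ j / j`!%:R * h j 0
    = \sum_(j < k.+1) j`!%:R^-1 * iter j (direction v) psi x.
  by apply: eq_bigr => j _; rewrite expr1n mul1r /h scale0r addr0.
rewrite /h /= scale1r expr1n mul1r; apply.
by move=> j; apply: continuous_in_subspaceT => r _; exact: is_derive_continuous (dh j r).
Qed.

Lemma bounded_upto_direction k M v psi : smooth psi -> bounded_upto k.+1 M psi ->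
  bounded_upto k (\sum_i `|v 0 i| * M) (direction v psi).
Proof.
move=> s /bounded_uptoS [_ H] t tk x.
have E (r : seq 'I_d) : smooth (fun x => \sum_(i <- r) v 0 i * partial i psi x) /\
   partials t (fun x => \sum_(i <- r) v 0 i * partial i psi x)
   = fun x => \sum_(i <- r) v 0 i * partials t (partial i psi) x.
  have sm t' i : smooth (fun x => v 0 i * partials t' (partial i psi) x).
    exact: (smoothM (smooth_cst _) (smooth_partials t' (smooth_partial i s))).
  have sms t' : smooth (fun x => \sum_(i <- r) v 0 i * partials t' (partial i psi) x).
    elim: r => [|i r IH].
      by under eq_fun do rewrite big_nil; exact: smooth_cst.
    under eq_fun do rewrite big_cons; exact: (smoothD (sm t' i) IH).
  split; first exact: (sms [::]).
  elim: t {tk} => [//|j t IH] /=; rewrite IH partial_sum; last by move=> i _; exact: sm.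
  apply/funext => y; apply: eq_bigr => i _; rewrite partialZ.
    by [].
  exact: (smooth_partials t (smooth_partial i s)).
rewrite /direction (E _).2; apply: (le_trans (ler_norm_sum _ _ _)).
by apply: ler_sum => i _; rewrite normrM ler_wpM2l //; exact: H.
Qed.

(** Each application of [direction v] multiplies the bound by the l^1 norm of [v]; the factor 1/6 of
    the remainder is dropped. *)
Lemma taylor3 M x v psi : smooth psi -> bounded_upto 3 M psi ->
  `|psi (x + v) - psi x - \sum_i v 0 i * partial i psi x
    - 2^-1 * \sum_i \sum_j v 0 i * v 0 j * partial i (partial j psi) x|
    <= M * (\sum_i `|v 0 i|) ^+ 3.
Proof.
move=> s B; set A := \sum_i `|v 0 i|.
have A0 : 0 <= A by exact: sumr_ge0.
have M0 := bounded_upto_ge0 B.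
have s1 := smooth_direction v s; have s2 := smooth_direction v s1.
have B1 := bounded_upto_direction v s B.
have B2 := bounded_upto_direction v s1 B1.
have B3 := bounded_upto_direction v s2 B2.
rewrite -!mulr_suml -/A in B3.
have HM y : `|iter 3 (direction v) psi y| <= A * (A * (A * M)).
  exact: (bounded_upto_sup y B3).
have := taylor_direction x s HM.
rewrite !big_ord_recl big_ord0 /= addr0 !fact0 invr1 mul1r /bump /= => H.
have -> : \sum_i \sum_j v 0 i * v 0 j * partial i (partial j psi) x
    = direction v (direction v psi) x.
  rewrite /direction; apply: eq_bigr => i _; rewrite partial_sum.
    rewrite mulr_sumr; apply: eq_bigr => j _; rewrite (partialZ _ _ (smooth_partial j s)).
    by rewrite mulrA.
  by move=> j _; exact: (smoothM (smooth_cst _) (smooth_partial j s)).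
move: H; rewrite /= mul1r -/(direction v psi x) !opprD !addrA => /le_trans; apply.
rewrite (_ : A * (A * (A * M)) = M * A ^+ 3); last by ring.
by rewrite ler_piMr ?mulr_ge0 ?exprn_ge0 // invf_le1 ?ler1n ?ltr0n.
Qed.

End TorusFunctions.

(** [A] is asked to be affine along [v] only, which covers both the slices of a function and the
    shifts in time. *)
Lemma is_derive_comp_affine {R : realType} {V W : normedModType R} (g : W -> R)
    (A : V -> W) x v w l : (forall h : R, A (h *: v + x) = h *: w + A x) ->
  is_derive (A x) w g l -> is_derive x v (fun y => g (A y)) l.
Proof.
move=> HA.
have E : (fun h : R => h^-1 *: (g (h *: w + A x) - g (A x)))
   = (fun h : R => h^-1 *: (g (A (h *: v + x)) - g (A x))).
  by apply/funext => h; rewrite HA.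
move=> [d1 d2]; split; first by move: d1; rewrite /derivable /= E.
by move: d2; rewrite /derive /= E.
Qed.

(** * Splitting off the first coordinate *)

Section Slices.
Context {R : realType} {n : nat}.
Implicit Types (g h : 'rV[R]_n.+1 -> R) (t : R) (y z : 'rV[R]_n).

Definition cons_row t y : 'rV[R]_n.+1 := row_mx (const_mx t : 'rV[R]_1) y.

Definition slice g t : 'rV[R]_n -> R := fun y => g (cons_row t y).

Lemma cons_rowD t s y z : cons_row (t + s) (y + z) = cons_row t y + cons_row s z.
Proof.
have E := add_row_mx (const_mx t : 'rV[R]_1) y (const_mx s) z.
rewrite /cons_row [RHS]E.
have -> // : const_mx (t + s) = const_mx t + const_mx s :> 'rV[R]_1.
by apply/matrixP => i j; rewrite !mxE.
Qed.

Lemma cons_row0E t y : cons_row t y 0 ord0 = t.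
Proof.
have -> : ord0 = lshift n (ord0 : 'I_1) by apply: val_inj.
by apply: (etrans (row_mxEl _ _ _ _)); rewrite mxE.
Qed.

Lemma cons_rowSE t y i : cons_row t y 0 (lift ord0 i) = y 0 i.
Proof.
have -> : lift ord0 i = rshift 1 i by apply: val_inj.
exact: row_mxEr.
Qed.

Lemma cons_row_basis0 (h : R) : cons_row h 0 = h *: basis_vector ord0.
Proof.
apply/rowP => i; rewrite [RHS]mxE basis_vectorE.
have [k ->|->] := unliftP ord0 i; first by rewrite cons_rowSE mxE /= mulr0.
by rewrite cons_row0E eqxx mulr1.
Qed.

Lemma cons_row_basisS (h : R) i :
  cons_row 0 (h *: basis_vector i) = h *: basis_vector (lift ord0 i).
Proof.
apply/rowP => j; rewrite [RHS]mxE basis_vectorE.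
have [k ->|->] := unliftP ord0 j; last by rewrite cons_row0E mulr0.
by rewrite cons_rowSE mxE basis_vectorE (inj_eq lift_inj).
Qed.

Lemma is_derive_slice g t y : smooth g ->
  is_derive t (1 : R) (fun t => slice g t y) (slice (partial ord0 g) t y).
Proof.
move=> sg; apply: (@is_derive_comp_affine R R _ g (fun t => cons_row t y) t 1
  (basis_vector ord0)); last exact: smooth_is_derive.
move=> h; rewrite -cons_row_basis0 -{1}(add0r y) cons_rowD.
by rewrite -[h *: 1]/(h * 1) mulr1.
Qed.

Lemma partial_slice g t i : smooth g ->
  partial i (slice g t) = slice (partial (lift ord0 i) g) t.
Proof.
move=> sg; apply: partial_eq => y.
apply: (@is_derive_comp_affine R _ _ g (cons_row t) y (basis_vector i)
  (basis_vector (lift ord0 i))); last exact: smooth_is_derive.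
by move=> h; rewrite -cons_row_basisS -cons_rowD add0r.
Qed.

Lemma continuous_slice g t : continuous g -> continuous (slice g t).
Proof.
move=> cg y.
apply/(@cvgrPdist_le R R _ _ (nbhs_filter y)) => e e0.
have [del del0 Hd] := continuous_coord (cons_row t y) cg e0.
apply/nbhs_ballP; exists del => // z [_ Hz].
have -> : z = y + (z - y) by rewrite addrC subrK.
rewrite distrC /slice -{1}(addr0 t) cons_rowD; apply: Hd => i.
have [k ->|->] := unliftP ord0 i; last by rewrite cons_row0E normr0.
by rewrite cons_rowSE !mxE -normrN opprB; exact: Hz.
Qed.

Lemma smooth_slice g t : smooth g -> smooth (slice g t).
Proof.
move=> sg s.
have E : partials s (slice g t) = slice (partials (map (lift ord0) s) g) t.
  elim: s => [//|i s IH] /=; rewrite IH partial_slice //.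
  exact: (smooth_partials _ sg).
rewrite E; split.
  by apply: continuous_slice; exact: smooth_continuous (smooth_partials _ sg).
move=> i y; case: (sg (rcons (map (lift ord0) s) (lift ord0 i))) => _ _.
have H : is_derive y (basis_vector i) (slice (partials (map (lift ord0) s) g) t)
    (partial (lift ord0 i) (partials (map (lift ord0) s) g) (cons_row t y)).
  apply: (@is_derive_comp_affine R _ _ _ (cons_row t) y (basis_vector i)
    (basis_vector (lift ord0 i))).
    by move=> h; rewrite -cons_row_basisS -cons_rowD add0r.
  exact: (smooth_is_derive _ _ (smooth_partials _ sg)).
by case: H.
Qed.

Lemma smooth_torus_slice g t : smooth_torus g -> smooth_torus (slice g t).
Proof.
move=> [pg sg]; split; last exact: smooth_slice.
move=> y i; rewrite /slice -(pg (cons_row t y) (lift ord0 i)); congr g.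
by rewrite -[basis_vector (lift _ _)]scale1r -cons_row_basisS -cons_rowD addr0 scale1r.
Qed.

Lemma slice_periodic g y : Defs.periodic g -> slice g 1 y = slice g 0 y.
Proof.
move=> pg; rewrite /slice -(pg (cons_row 0 y) ord0); congr g.
by rewrite -[basis_vector ord0]scale1r -cons_row_basis0 -cons_rowD add0r addr0.
Qed.

End Slices.

(** * Integration over the torus *)

Section TorusIntegral.
Context {R : realType}.
Notation mu := (@lebesgue_measure R).

Let I01 : set R := `[(0 : R), 1]%classic.

Let mI01 : measurable (I01 : set (measurableTypeR R)).
Proof. exact: measurable_itv. Qed.

Let muI01 : mu I01 = 1%E.
Proof. by rewrite /I01 lebesgue_measure_itv /= lte_fin ltr01 oppr0 adde0. Qed.

Let integrable01 (f : R -> R) : continuous f -> mu.-integrable I01 (EFin \o f).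
Proof.
move=> cf; apply: continuous_compact_integrable; first exact: segment_compact.
exact: continuous_subspaceT.
Qed.

Lemma torus_intS n (g : 'rV[R]_n.+1 -> R) :
  torus_int g = \int[mu]_(t in I01) torus_int (slice g t).
Proof. by []. Qed.

(** These properties are proved together by induction on the dimension: in dimension [n.+1] they
    require the integral over a slice to be integrable in [t], and its continuity in [t] follows
    from the same properties in dimension [n]. *)
Definition torus_int_spec n := forall (g h : 'rV[R]_n -> R) (c M : R),
  smooth_torus g -> smooth_torus h ->
  [/\ torus_int (fun x => g x + h x) = torus_int g + torus_int h,
      torus_int (fun x => c * g x) = c * torus_int g &
      (forall x, `|g x| <= M) -> `|torus_int g| <= M].

(** Differentiation under the integral sign by uniform estimates. By linearity the error is the
    integral of a first order Taylor remainder; two mean values bound that remainder by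
    [M * |h| * |h|], where [M] bounds the second derivative. *)
Let torus_int_sliceP n (g : 'rV[R]_n.+1 -> R) t : torus_int_spec n ->
  smooth_torus g ->
  is_derive t (1 : R) (fun t => torus_int (slice g t))
    (torus_int (slice (partial ord0 g) t)).
Proof.
move=> spec sg; apply/is_derive_epsP => e e0.
have sg1 := smooth_torus_partial ord0 sg.
have sg2 := smooth_torus_partial ord0 sg1.
have [M HM] := periodic_bounded (smooth_continuous sg2.2) sg2.1.
have M0 : 0 <= M by apply: le_trans (HM 0).
exists (e / (M + 1)) => [|h hd]; first by rewrite divr_gt0 // ltr_wpDl.
have st (g' : 'rV[R]_n.+1 -> R) s := @smooth_torus_slice R n g' s.
have E : torus_int (slice g (t + h)) - torus_int (slice g t)
     - h * torus_int (slice (partial ord0 g) t)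
   = torus_int (fun y => slice g (t + h) y + (-1 * slice g t y
       + (- h) * slice (partial ord0 g) t y)).
  have s1 := smooth_torusZ (-1) (st g t sg).
  have s2 := smooth_torusZ (-h) (st _ t sg1).
  have [-> _ _] := spec _ _ 0 0 (st g (t + h) sg) (smooth_torusD s1 s2).
  have [-> _ _] := spec _ _ 0 0 s1 s2.
  have [_ -> _] := spec _ _ (-1) 0 (st g t sg) s2.
  have [_ -> _] := spec _ _ (-h) 0 (st _ t sg1) s2.
  by ring.
rewrite E; have s3 := smooth_torusD (st g (t + h) sg)
  (smooth_torusD (smooth_torusZ (-1) (st g t sg)) (smooth_torusZ (-h) (st _ t sg1))).
have [_ _ B] := spec _ _ 0 (e * `|h|) s3 s3.
apply: B => y.
have -> : slice g (t + h) y + (-1 * slice g t y + - h * slice (partial ord0 g) t y)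
  = slice g (t + h) y - slice g t y - h * slice (partial ord0 g) t y by ring.
have bnd (g' : R -> R) g'' : (forall s, is_derive s (1 : R) g' (g'' s)) ->
    forall N, (forall s, `|s - t| <= `|h| -> `|g'' s| <= N) ->
    `|g' (t + h) - g' t| <= N * `|h|.
  move=> dg N HN; have [c ch ->] := @mean_value R g' g'' t h (fun s _ => dg s).
  by rewrite normrM mulrC ler_wpM2r // HN.
have := bnd (fun s => slice g s y - (s - t) * slice (partial ord0 g) t y)
  (fun s => slice (partial ord0 g) s y - slice (partial ord0 g) t y) _ (M * `|h|).
rewrite subrr mul0r subr0 (addrAC t) subrr add0r => H.
rewrite addrAC; apply: (le_trans (H _ _)).
- move=> s; apply: is_derB; first exact: (is_derive_slice s y sg.2).
  have D : is_derive s (1 : R) (fun s : R => s - t) (1 - 0).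
    exact: (is_derB (is_derive_id s (1 : R)) (is_derC t s (1 : R))).
  have := is_derM D (is_derC (slice (partial ord0 g) t y) s 1).
  by rewrite subr0 mul1r mulr0 addr0.
- move=> s hs.
  have [c _] := @mean_value R (fun s => slice (partial ord0 g) s y)
    (fun s => slice (partial ord0 (partial ord0 g)) s y) t (s - t)
    (fun c _ => is_derive_slice c y sg1.2).
  rewrite (addrC t) subrK => ->; rewrite normrM mulrC; apply: ler_pM => //; exact: HM.
- rewrite ler_wpM2r //; apply: (le_trans (ler_wpM2l M0 (ltW hd))).
  by rewrite mulrA ler_pdivrMr ?ltr_wpDl // mulrC ler_wpM2l ?(ltW e0) // lerDl.
Qed.

Let torus_int_slice_continuous n (g : 'rV[R]_n.+1 -> R) : torus_int_spec n ->
  smooth_torus g -> continuous (fun t => torus_int (slice g t)).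
Proof.
by move=> spec sg t; exact: (is_derive_continuous (torus_int_sliceP t spec sg)).
Qed.

Lemma torus_intP n : torus_int_spec n.
Proof.
elim: n => [|n IH] g h c M sg sh; first by split => //=; exact.
have cg := torus_int_slice_continuous IH sg.
have ch := torus_int_slice_continuous IH sh.
have ig := integrable01 cg; have ih := integrable01 ch.
have sl t := smooth_torus_slice t sg; have slh t := smooth_torus_slice t sh.
split.
- rewrite !torus_intS -RintegralD //; apply: eq_Rintegral => t _.
  by have [-> _ _] := IH _ _ 0 0 (sl t) (slh t).
- rewrite !torus_intS -RintegralZl //; apply: eq_Rintegral => t _.
  by have [_ -> _] := IH _ _ c 0 (sl t) (slh t).
- move=> HM; rewrite torus_intS; apply: (le_trans (le_normr_Rintegral mI01 ig)).
  have -> : M = \int[mu]_(t in I01) M by rewrite (Rintegral_cst _ mI01) [X in fine X]muI01 mulr1.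
  apply: le_Rintegral => //.
  + apply: (@integrable01 (fun t => `|torus_int (slice g t)|)) => t.
    exact: (continuous_comp (cg t) (@norm_continuous _ _ _)).
  + by apply: (@integrable01 (cst M)); exact: cst_continuous.
  + move=> t _; have [_ _ H] := IH _ _ 0 M (sl t) (sl t); apply: H => y; exact: HM.
Qed.

Section Dimension.
Context {n : nat}.
Implicit Types g h : 'rV[R]_n -> R.

Lemma torus_intD g h : smooth_torus g -> smooth_torus h ->
  torus_int (fun x => g x + h x) = torus_int g + torus_int h.
Proof. by move=> sg sh; have [] := torus_intP 0 0 sg sh. Qed.

Lemma torus_intZ (c : R) g : smooth_torus g ->
  torus_int (fun x => c * g x) = c * torus_int g.
Proof. by move=> sg; have [] := torus_intP c 0 sg sg. Qed.

Lemma torus_int_bound (M : R) g : smooth_torus g -> (forall x, `|g x| <= M) ->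
  `|torus_int g| <= M.
Proof. by move=> sg; have [] := torus_intP 0 M sg sg. Qed.

Lemma torus_int0 : torus_int (fun _ : 'rV[R]_n => 0) = 0.
Proof.
have := torus_intZ 0 (@smooth_torus_cst R n 0).
by rewrite !mul0r.
Qed.

Lemma torus_intB g h : smooth_torus g -> smooth_torus h ->
  torus_int (fun x => g x - h x) = torus_int g - torus_int h.
Proof.
move=> sg sh; rewrite -mulN1r -torus_intZ // -torus_intD //.
  by congr torus_int; apply/funext => x; rewrite mulN1r.
exact: smooth_torusZ.
Qed.

Lemma torus_int_sum (I : Type) (r : seq I) (P : pred I) (F : I -> 'rV[R]_n -> R) :
  (forall i, P i -> smooth_torus (F i)) ->
  torus_int (fun x => \sum_(i <- r | P i) F i x) = \sum_(i <- r | P i) torus_int (F i).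
Proof.
move=> H; elim: r => [|i r IH].
  by under eq_fun do rewrite big_nil; rewrite big_nil torus_int0.
under eq_fun do rewrite big_cons; rewrite big_cons.
case Pi : (P i); last exact: IH.
by rewrite torus_intD ?IH //; [exact: H|exact: smooth_torus_sum].
Qed.

End Dimension.

(** In the first coordinate this is the fundamental theorem of calculus together with periodicity;
    in another coordinate, the induction hypothesis applies to every slice. *)
Lemma torus_int_partial n (g : 'rV[R]_n -> R) i : smooth_torus g ->
  torus_int (partial i g) = 0.
Proof.
elim: n g i => [|n IH] g i sg; first by case: i.
have [k ->|->] := unliftP ord0 i.
  rewrite torus_intS.
  have -> : (fun t => torus_int (slice (partial (lift ord0 k) g) t)) = cst 0.
    apply/funext => t /=; rewrite -partial_slice; last by case: sg.
    by rewrite IH //; exact: smooth_torus_slice.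
  by rewrite Rintegral_cst // mul0r.
pose G t := torus_int (slice g t).
have dG t : is_derive t (1 : R) G (torus_int (slice (partial ord0 g) t)).
  exact: (torus_int_sliceP t (@torus_intP n) sg).
have cdG := torus_int_slice_continuous (@torus_intP n) (smooth_torus_partial ord0 sg).
have cG t : {for t, continuous G} := is_derive_continuous (dG t).
have H := @continuous_FTC2 R (fun t => torus_int (slice (partial ord0 g) t)) G 0 1 ltr01.
rewrite torus_intS /Rintegral H.
- rewrite /G; have -> : slice g 1 = slice g 0.
    by apply/funext => y; apply: slice_periodic; case: sg.
  by rewrite -EFinB subrr.
- exact: continuous_subspaceT.
- split.
  + by move=> t _; case: (dG t).
  + exact: cvg_at_right_filter (cG 0).
  + exact: cvg_at_left_filter (cG 1).
- by move=> t _; rewrite derive1E; case: (dG t).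
Qed.

Lemma torus_int_by_parts n (g h : 'rV[R]_n -> R) i :
  smooth_torus g -> smooth_torus h ->
  torus_int (fun x => partial i g x * h x)
  = torus_int (fun x => g x * (- partial i h x)).
Proof.
move=> sg sh.
have sg1 := smooth_torus_partial i sg; have sh1 := smooth_torus_partial i sh.
have := torus_int_partial i (smooth_torusM sg sh).
rewrite (partialM i sg.2 sh.2) torus_intD; [|exact: smooth_torusM..].
move=> H; have -> : (fun x => g x * (- partial i h x)) = (fun x => -1 * (g x * partial i h x)).
  by apply/funext => x; ring.
rewrite torus_intZ; last exact: smooth_torusM.
by move: H => /eqP; rewrite addr_eq0 mulN1r => /eqP.
Qed.

End TorusIntegral.

(** * Differential operators and evolution equations *)

Section TimeFamilies.
Context {R : realType} {d : nat}.
Notation V := 'rV[R]_d.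
Implicit Types (v w : R -> V -> R) (i : 'I_d).

Let half : set (R * V) := [set z : R * V | 0 <= z.1].

(* The joint continuity in [parabolic_solution], up to order [n]. *)
Fixpoint jointly_upto n v : Prop :=
  {within half, continuous (fun z : R * V => v z.1 z.2)} /\
  if n is n'.+1 then forall i, jointly_upto n' (fun t => partial i (v t)) else True.

Definition jointly_smooth v : Prop :=
  (forall t, 0 <= t -> smooth_torus (v t)) /\ forall n, jointly_upto n v.

Lemma jointly_smoothP v : (forall t, 0 <= t -> smooth_torus (v t)) ->
  (forall s, {within half, continuous (fun z : R * V => partials s (v z.1) z.2)}) ->
  jointly_smooth v.
Proof.
move=> sv cv; split => // n.
elim: n v {sv} cv => [|n IH] v cv /=; first by split => //; exact: (cv [::]).
split; first exact: (cv [::]).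
move=> i; apply: IH => s; have := cv (rcons s i).
have -> // : (fun z : R * V => partials (rcons s i) (v z.1) z.2)
   = (fun z => partials s (partial i (v z.1)) z.2).
by apply/funext => z; rewrite partials_rcons.
Qed.

Lemma jointly_upto_eq n v w : (forall t, 0 <= t -> v t = w t) ->
  jointly_upto n v -> jointly_upto n w.
Proof.
elim: n v w => [|n IH] v w vw /= [c H].
  split => //; apply: subspace_eq_continuous c => z; rewrite inE => z0.
  by rewrite /from_subspace /= vw.
split; first by apply: subspace_eq_continuous c => z; rewrite inE => z0; rewrite /from_subspace /= vw.
by move=> i; apply: IH (H i) => t t0; rewrite vw.
Qed.

Lemma jointly_uptoW n v : jointly_upto n.+1 v -> jointly_upto n v.
Proof.
elim: n v => [|n IH] v /=; first by case.
by move=> [c H]; split => // i; apply: IH; exact: H.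
Qed.

Lemma jointly_uptoD n v w : (forall t, 0 <= t -> smooth (v t)) ->
  (forall t, 0 <= t -> smooth (w t)) -> jointly_upto n v -> jointly_upto n w ->
  jointly_upto n (fun t x => v t x + w t x).
Proof.
elim: n v w => [|n IH] v w sv sw /= [c1 H1] [c2 H2].
  by split => // z; exact: (cvgD (c1 z) (c2 z)).
split; first by move=> z; exact: (cvgD (c1 z) (c2 z)).
move=> i; apply: (@jointly_upto_eq n (fun t x => partial i (v t) x + partial i (w t) x)).
  by move=> t t0; rewrite (partialD i (sv t t0) (sw t t0)).
apply: IH (H1 i) (H2 i) => t t0; apply: smooth_partial; [exact: sv|exact: sw].
Qed.

Lemma jointly_uptoM n (a : V -> R) v : smooth a -> (forall t, 0 <= t -> smooth (v t)) ->
  jointly_upto n v -> jointly_upto n (fun t x => a x * v t x).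
Proof.
have ca (b : V -> R) : smooth b -> {within half, continuous (fun z : R * V => b z.2)}.
  move=> sa; apply: continuous_subspaceT => z.
  apply: (@continuous_comp _ _ _ snd b); last first.
    exact: (smooth_continuous sa).
  by case: z => z1 z2; exact: cvg_snd.
elim: n a v => [|n IH] a v sa sv.
  by move=> /= [c1 H1]; split => // z; exact: (cvgM (ca _ sa z) (c1 z)).
move=> J; have W := jointly_uptoW J; case: J => c1 H1.
split; first by move=> z; exact: (cvgM (ca _ sa z) (c1 z)).
move=> i; apply: (@jointly_upto_eq n
   (fun t x => partial i a x * v t x + a x * partial i (v t) x)).
  by move=> t t0; rewrite (partialM i sa (sv t t0)).
have sp t : 0 <= t -> smooth (partial i (v t)) by move=> t0; exact: smooth_partial (sv t t0).
apply: jointly_uptoD.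
- by move=> t t0; exact: smoothM (smooth_partial i sa) (sv t t0).
- by move=> t t0; exact: smoothM sa (sp t t0).
- exact: IH (smooth_partial i sa) sv W.
- exact: IH sa sp (H1 i).
Qed.

Lemma jointly_smoothD v w : jointly_smooth v -> jointly_smooth w ->
  jointly_smooth (fun t x => v t x + w t x).
Proof.
move=> [s1 j1] [s2 j2]; split.
  by move=> t t0; exact: smooth_torusD (s1 t t0) (s2 t t0).
by move=> n; apply: jointly_uptoD => // t t0; [case: (s1 t t0)|case: (s2 t t0)].
Qed.

Lemma jointly_smoothM (a : V -> R) v : smooth_torus a -> jointly_smooth v ->
  jointly_smooth (fun t x => a x * v t x).
Proof.
move=> sa [s1 j1]; split.
  by move=> t t0; exact: smooth_torusM sa (s1 t t0).
by move=> n; apply: jointly_uptoM => //; [case: sa|move=> t t0; case: (s1 t t0)].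
Qed.

Lemma jointly_smooth_partial i v : jointly_smooth v ->
  jointly_smooth (fun t => partial i (v t)).
Proof.
move=> [s1 j1]; split.
  by move=> t t0; exact: smooth_torus_partial (s1 t t0).
by move=> n; have [_ ] := j1 n.+1; apply.
Qed.

Lemma jointly_smooth_cst : jointly_smooth (fun _ _ => 0).
Proof.
split; first by move=> t _; exact: smooth_torus_cst.
elim=> [|n IH] /=; first by split => // z; exact: cst_continuous.
split; first by move=> z; exact: cst_continuous.
by move=> i; apply: jointly_upto_eq IH => t _; rewrite partial_cst.
Qed.

Lemma jointly_smooth_within v : jointly_smooth v -> forall t0 (x0 : V) (e : R), 0 <= t0 -> 0 < e ->
  exists2 del, 0 < del & forall t (z : V), 0 <= t -> `|t - t0| < del ->
    (forall i, `|z 0 i| < del) -> `|v t (x0 + z) - v t0 x0| <= e.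
Proof.
move=> [_ /(_ 0%N) /= [/subspace_continuousP c _]] t0 x0 e t00 e0.
have /cvgrPdist_le/(_ e e0) := c (t0, x0) t00.
rewrite near_withinE /= => /nbhs_ballP [del /= del0 H]; exists del => // t z tp td zd.
rewrite distrC; apply: (H (t, x0 + z)) => //; split => /=; first by rewrite /ball /= distrC.
split => // k i; rewrite mxE (ord1 k) /ball /= opprD addNKr normrN; exact: zd.
Qed.

(** The time derivative [v'] is part of the data, so that applying a space operator to both families
    says that it commutes with the time derivative. *)
Definition evolution v v' : Prop := [/\ jointly_smooth v, jointly_smooth v' &
  forall (t : R) (x : V), 0 < t -> is_derive t (1 : R) (fun r => v r x) (v' t x)].

(** This is [schwarz] with time as first variable and the [i]-th coordinate as second; the joint
    continuity of [partial i (v' t)] is its last hypothesis, and the radius [t] keeps the times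
    positive. *)
Lemma evolution_partial i v v' : evolution v v' ->
  evolution (fun t => partial i (v t)) (fun t => partial i (v' t)).
Proof.
move=> [j1 j2 dv]; split; [exact: jointly_smooth_partial|exact: jointly_smooth_partial|].
move=> t x t0.
have ap a : `|a - t| < t -> 0 < a.
  by rewrite ltr_norml => /andP[+ _]; rewrite ltrBrDr addNr.
pose X (b : R) := x + b *: basis_vector i.
have X0 : X 0 = x by rewrite /X scale0r addr0.
have H := @schwarz R (fun a b => v a (X b)) (fun a b => v' a (X b))
  (fun a b => partial i (v' a) (X b)) (fun a => partial i (v a) (X 0)) t 0 t t0.
rewrite X0 in H; apply: H.
- by move=> a b at_ _; apply: dv; exact: ap.
- move=> a b at_ _; apply: is_derive_axis.
  by case: (j2.1 a (ltW (ap a at_))).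
- move=> a at_; have H := @is_derive_axis R d (v a) i x 0 (j1.1 a (ltW (ap a at_))).2.
  by rewrite -/(X 0) X0 in H.
- move=> e e0.
  have [del del0 H] := jointly_smooth_within (jointly_smooth_partial i j2) x (ltW t0) e0.
  exists (Num.min del t) => [|a b]; first by rewrite lt_min del0.
  rewrite lt_min subr0 => /andP[ad at_]; rewrite lt_min => /andP[bd _].
  apply: H => // [|k]; first exact: ltW (ap a at_).
  rewrite mxE basis_vectorE normrM; apply: le_lt_trans bd.
  by rewrite ler_piMr // ger0_norm // lern1; case: (_ == _).
Qed.

Lemma evolutionD v v' w w' : evolution v v' -> evolution w w' ->
  evolution (fun t x => v t x + w t x) (fun t x => v' t x + w' t x).
Proof.
move=> [j1 j2 dv] [k1 k2 dw]; split; [exact: jointly_smoothD|exact: jointly_smoothD|].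
by move=> t x t0; exact: is_derD (dv t x t0) (dw t x t0).
Qed.

Lemma evolutionM (a : V -> R) v v' : smooth_torus a -> evolution v v' ->
  evolution (fun t x => a x * v t x) (fun t x => a x * v' t x).
Proof.
move=> sa [j1 j2 dv]; split; [exact: jointly_smoothM|exact: jointly_smoothM|].
by move=> t x t0; exact: is_derZ (dv t x t0).
Qed.

Lemma evolution_cst : evolution (fun _ _ => 0) (fun _ _ => 0).
Proof.
split; [exact: jointly_smooth_cst|exact: jointly_smooth_cst|].
by move=> t x _; exact: is_derC.
Qed.

End TimeFamilies.

Section DifferentialOperators.
Context {R : realType} {d : nat}.
Notation V := 'rV[R]_d.
Implicit Types (A B : (V -> R) -> V -> R) (psi mu : V -> R).

(* A semantic notion of differential operator of order at most [q] with smooth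
   coefficients: only the properties used below, all of which are stable under
   the operations that build [generator] and its relatives. *)
Record diff_op (q : nat) A : Prop := DiffOp {
  diff_op_smooth : forall psi, smooth_torus psi -> smooth_torus (A psi);
  diff_op_bounded : forall k, exists2 C, 0 <= C & forall psi M, smooth_torus psi ->
    bounded_upto (k + q) M psi -> bounded_upto k (C * M) (A psi);
  diff_op_adjoint : forall mu, smooth_torus mu -> exists2 g, smooth_torus g &
    forall psi, smooth_torus psi ->
    torus_int (fun x => A psi x * mu x) = torus_int (fun x => psi x * g x);
  diff_op_jointly : forall v, jointly_smooth v -> jointly_smooth (fun t => A (v t));
  diff_op_evolution : forall v v', evolution v v' ->
    evolution (fun t => A (v t)) (fun t => A (v' t)) }.

Lemma diff_opW p q A : (p <= q)%N -> diff_op p A -> diff_op q A.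
Proof.
move=> pq [s b a j e]; split => // k.
have [C C0 H] := b k; exists C => // psi M spsi B; apply: H => //.
by apply: bounded_uptoW B => //; rewrite leq_add2l.
Qed.

Lemma diff_op_id : diff_op 0 (fun psi => psi).
Proof.
split => //.
- by move=> k; exists 1 => // psi M _; rewrite addn0 mul1r.
- by move=> mu smu; exists mu.
Qed.

Lemma diff_op_comp p q A B : diff_op p A -> diff_op q B ->
  diff_op (p + q) (fun psi => A (B psi)).
Proof.
move=> [s1 b1 a1 j1 e1] [s2 b2 a2 j2 e2]; split.
- by move=> psi spsi; exact: s1 _ (s2 _ spsi).
- move=> k; have [C C0 H] := b1 k; have [D D0 K] := b2 (k + p)%N.
  exists (C * D) => [|psi M spsi BM]; first exact: mulr_ge0.
  rewrite -mulrA; apply: H; first exact: s2.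
  by apply: K => //; rewrite -addnA.
- move=> mu smu; have [g sg Hg] := a1 mu smu; have [h sh Hh] := a2 g sg.
  by exists h => [//|psi spsi]; rewrite (Hg _ (s2 _ spsi)) (Hh _ spsi).
- by move=> v jv; exact: j1 _ (j2 _ jv).
- by move=> v v' ev; exact: e1 _ _ (e2 _ _ ev).
Qed.

Lemma diff_op_partial i : diff_op 1 (partial i).
Proof.
split.
- by move=> psi; exact: smooth_torus_partial.
- move=> k; exists 1 => // psi M _; rewrite addn1 mul1r.
  by move=> /bounded_uptoS [_]; apply.
- move=> mu smu; exists (fun x => - partial i mu x).
    exact: smooth_torusN (smooth_torus_partial i smu).
  by move=> psi spsi; exact: torus_int_by_parts.
- by move=> v; exact: jointly_smooth_partial.
- by move=> v v'; exact: evolution_partial.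
Qed.

Lemma diff_op_mul q a A : smooth_torus a -> diff_op q A ->
  diff_op q (fun psi x => a x * A psi x).
Proof.
move=> sa [s b aj j e]; split.
- by move=> psi spsi; exact: smooth_torusM sa (s _ spsi).
- move=> k; have [M HM] := smooth_torus_bounded k sa; have [C C0 H] := b k.
  have M0 := bounded_upto_ge0 HM.
  exists (2 ^+ k * M * C) => [|psi N spsi BN]; first by rewrite !mulr_ge0 ?exprn_ge0.
  rewrite -(mulrA (2 ^+ k * M)).
  exact: (bounded_uptoM sa.2 (s _ spsi).2 HM (H _ _ spsi BN)).
- move=> mu smu; have [g sg Hg] := aj _ (smooth_torusM sa smu).
  exists g => [//|psi spsi]; rewrite -(Hg _ spsi); congr torus_int.
  by apply/funext => x; rewrite mulrCA mulrA.
- by move=> v jv; exact: jointly_smoothM sa (j _ jv).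
- by move=> v v' ev; exact: evolutionM sa (e _ _ ev).
Qed.

Lemma diff_op_add q A B : diff_op q A -> diff_op q B ->
  diff_op q (fun psi x => A psi x + B psi x).
Proof.
move=> [s1 b1 a1 j1 e1] [s2 b2 a2 j2 e2]; split.
- by move=> psi spsi; exact: smooth_torusD (s1 _ spsi) (s2 _ spsi).
- move=> k; have [C C0 H] := b1 k; have [D D0 K] := b2 k.
  exists (C + D) => [|psi M spsi BM]; first exact: addr_ge0.
  rewrite mulrDl; exact: (bounded_uptoD (s1 _ spsi).2 (s2 _ spsi).2
    (H _ _ spsi BM) (K _ _ spsi BM)).
- move=> mu smu; have [g sg Hg] := a1 mu smu; have [h sh Hh] := a2 mu smu.
  exists (fun x => g x + h x) => [|psi spsi]; first exact: smooth_torusD.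
  have -> : (fun x => (A psi x + B psi x) * mu x)
      = (fun x => A psi x * mu x + B psi x * mu x).
    by apply/funext => x; rewrite mulrDl.
  have -> : (fun x => psi x * (g x + h x)) = (fun x => psi x * g x + psi x * h x).
    by apply/funext => x; rewrite mulrDr.
  rewrite (torus_intD (smooth_torusM (s1 _ spsi) smu) (smooth_torusM (s2 _ spsi) smu)).
  by rewrite (torus_intD (smooth_torusM spsi sg) (smooth_torusM spsi sh)) (Hg _ spsi) (Hh _ spsi).
- by move=> v jv; exact: jointly_smoothD (j1 _ jv) (j2 _ jv).
- by move=> v v' ev; exact: evolutionD (e1 _ _ ev) (e2 _ _ ev).
Qed.

Lemma diff_op_zero q : diff_op q (fun _ _ => 0).
Proof.
split.
- by move=> psi _; exact: smooth_torus_cst.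
- move=> k; exists 0 => // psi M _ _; rewrite mul0r.
  by have := @bounded_upto_cst R d k 0; rewrite normr0.
- move=> mu smu; exists (fun=> 0); first exact: smooth_torus_cst.
  move=> psi _; congr torus_int; apply/funext => x.
  by rewrite mul0r mulr0.
- by move=> v _; exact: jointly_smooth_cst.
- by move=> v v' _; exact: evolution_cst.
Qed.

Lemma diff_op_sum q (I : Type) (r : seq I) (F : I -> (V -> R) -> V -> R) :
  (forall k, diff_op q (F k)) -> diff_op q (fun psi x => \sum_(k <- r) F k psi x).
Proof.
move=> H; elim: r => [|k r IH].
  have -> : (fun psi x => \sum_(k <- [::]) F k psi x) = (fun _ _ => 0).
    by apply/funext => psi; apply/funext => x; rewrite big_nil.
  exact: diff_op_zero.
have -> : (fun psi x => \sum_(j <- k :: r) F j psi x)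
   = (fun psi x => F k psi x + \sum_(j <- r) F j psi x).
  by apply/funext => psi; apply/funext => x; rewrite big_cons.
exact: diff_op_add.
Qed.

Lemma diff_op_iter q A n : diff_op q A -> diff_op (n * q) (iter n A).
Proof.
move=> dA; elim: n => [|n IH]; first exact: diff_op_id.
by rewrite mulSn; exact: diff_op_comp.
Qed.

End DifferentialOperators.

Section Generator.
Context {R : realType} {d m : nat}.
Variables (f : 'I_d -> 'rV[R]_d -> R) (sigma : 'I_d -> 'I_m -> 'rV[R]_d -> R).
Hypotheses (f_smooth : forall i, smooth_torus (f i))
  (sigma_smooth : forall i l, smooth_torus (sigma i l)).
Implicit Types (psi : 'rV[R]_d -> R).

(* [frozen j psi x] is [L_x^j psi] evaluated at [x], where [L_x] is the generator
   with coefficients frozen at [x]; [frozen j / j!] are the operators in the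
   expansion of one Euler step in powers of the time step. *)
Fixpoint frozen (j : nat) psi : 'rV[R]_d -> R :=
  if j is j'.+1 then fun x =>
    \sum_(i < d) f i x * frozen j' (partial i psi) x
    + \sum_(i < d) \sum_(k < d)
        diffusion sigma i k x * frozen j' (partial i (partial k psi)) x
  else psi.

Lemma frozen1 psi : frozen 1 psi = generator f sigma psi.
Proof. by []. Qed.

Lemma smooth_diffusion i k : smooth_torus (diffusion sigma i k).
Proof.
apply: smooth_torusZ; apply: smooth_torus_sum => l _; exact: smooth_torusM.
Qed.

Lemma diff_op_frozen j : diff_op (j * 2) (frozen j).
Proof.
elim: j => [|j IH]; first exact: diff_op_id.
apply: diff_op_add.
  apply: diff_op_sum => i; apply: diff_op_mul => //.
  apply: (@diff_opW _ _ (j * 2 + 1)); first by rewrite mulSn addnC leq_add2r.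
  exact: diff_op_comp IH (diff_op_partial i).
apply: diff_op_sum => i; apply: diff_op_sum => k; apply: diff_op_mul.
  exact: smooth_diffusion.
rewrite mulSn addnC; apply: diff_op_comp IH _.
exact: diff_op_comp (diff_op_partial i) (diff_op_partial k).
Qed.

Lemma diff_op_generator : diff_op 2 (generator f sigma).
Proof. exact: (diff_op_frozen 1). Qed.

(** Testing with constants yields the solvability condition under which [H2] is applied. *)
Lemma frozen_cst j (c : R) : frozen j.+1 (fun=> c) = fun=> 0.
Proof.
have E j' : frozen j' (fun=> 0) = fun=> 0.
  elim: j' => [//|j' IH]; apply/funext => x /=.
  rewrite big1 ?add0r; last by move=> i _; rewrite partial_cst IH mulr0.
  by rewrite big1 // => i _; rewrite big1 // => k _; rewrite !partial_cst IH mulr0.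
apply/funext => x /=.
rewrite big1 ?add0r; last by move=> i _; rewrite partial_cst E mulr0.
by rewrite big1 // => i _; rewrite big1 // => k _; rewrite !partial_cst E mulr0.
Qed.

End Generator.

(** * Modified densities *)

Section GrowthPolynomials.
Context {R : realType}.
Implicit Types (p q : {poly R}) (s t a : R).

(** With such polynomials a factor taken at an intermediate time can be replaced by its value at the
    final time. *)
Definition nondecreasing_poly p : Prop :=
  forall s t, 0 <= s -> s <= t -> 0 <= p.[s] /\ p.[s] <= p.[t].

Lemma nondecreasing_poly_ge0 p t : nondecreasing_poly p -> 0 <= t -> 0 <= p.[t].
Proof. by move=> H t0; case: (H t t t0 (lexx t)). Qed.

Lemma nondecreasing_poly_le p s t : nondecreasing_poly p -> 0 <= s -> s <= t ->
  p.[s] <= p.[t].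
Proof. by move=> H s0 st; case: (H s t s0 st). Qed.

Lemma nondecreasing_polyC (c : R) : 0 <= c -> nondecreasing_poly c%:P.
Proof. by move=> c0 s t _ _; rewrite !hornerC. Qed.

Lemma nondecreasing_polyX : nondecreasing_poly 'X.
Proof. by move=> s t s0 st; rewrite !hornerX. Qed.

Lemma nondecreasing_polyD p q : nondecreasing_poly p -> nondecreasing_poly q ->
  nondecreasing_poly (p + q).
Proof.
move=> H1 H2 s t s0 st; have [a1 b1] := H1 s t s0 st; have [a2 b2] := H2 s t s0 st.
by rewrite !hornerD; split; [exact: addr_ge0|exact: lerD].
Qed.

Lemma nondecreasing_polyM p q : nondecreasing_poly p -> nondecreasing_poly q ->
  nondecreasing_poly (p * q).
Proof.
move=> H1 H2 s t s0 st; have [a1 b1] := H1 s t s0 st; have [a2 b2] := H2 s t s0 st.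
by rewrite !hornerM; split; [exact: mulr_ge0|exact: ler_pM].
Qed.

Lemma nondecreasing_poly_shift p a : 0 <= a -> nondecreasing_poly p ->
  nondecreasing_poly (p \Po ('X + a%:P)).
Proof.
move=> a0 H s t s0 st; rewrite !horner_comp !hornerD !hornerX !hornerC.
by apply: H; [exact: addr_ge0|rewrite lerD2r].
Qed.

Lemma nondecreasing_majorant p :
  exists2 q, nondecreasing_poly q & forall t, 0 <= t -> p.[t] <= q.[t].
Proof.
elim/poly_ind: p => [|p c [q Hq pq]].
  by exists 0; [exact: nondecreasing_polyC|move=> t _; rewrite !horner0].
exists (q * 'X + `|c|%:P).
  apply: nondecreasing_polyD; last exact: nondecreasing_polyC.
  exact: nondecreasing_polyM Hq nondecreasing_polyX.
move=> t t0; rewrite !hornerD !hornerMX !hornerC.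
by apply: lerD; [apply: ler_wpM2r => //; exact: pq|exact: ler_norm].
Qed.

(** Induction on the degree: each multiplication by [t] is paid for by half of the exponent, through
    [t <= 2 / a * expR (a / 2 * t)]. *)
Lemma poly_le_exp p a : 0 < a ->
  exists2 C, 0 <= C & forall t, 0 <= t -> `|p.[t]| <= C * expR (a * t).
Proof.
elim/poly_ind: p a => [|p c IH] a a0.
  by exists 0 => // t _; rewrite horner0 normr0 mul0r.
have a20 : 0 < a / 2 by rewrite divr_gt0.
have [C C0 HC] := IH _ a20.
exists (C * (2 / a) + `|c|) => [|t t0].
  by rewrite addr_ge0 // mulr_ge0 // ltW // divr_gt0.
rewrite hornerD hornerMX hornerC mulrDl; apply: (le_trans (ler_normD _ _)).
apply: lerD; last first.
  rewrite ler_peMr // -expR0 ler_expR; apply: mulr_ge0 => //; exact: ltW.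
rewrite normrM (ger0_norm t0).
have tE : t <= 2 / a * expR (a / 2 * t).
  rewrite mulrC -ler_pdivrMr ?divr_gt0 // invf_div.
  by apply: le_trans (expR_ge1Dx _); rewrite [X in X <= _]mulrC lerDr ler01.
have -> : C * (2 / a) * expR (a * t)
    = C * expR (a / 2 * t) * (2 / a * expR (a / 2 * t)).
  have -> : a * t = a / 2 * t + a / 2 * t by field.
  by rewrite expRD; ring.
by apply: ler_pM => //; exact: HC.
Qed.

(** The bound is in a form that propagates: by how much it grows from [n] to [n.+1] exceeds the new
    term because [1 + a * t <= expR (a * t)]. *)
Lemma geometric_exp_sum a t n : 0 < a -> 0 < t ->
  \sum_(k < n) t * expR (- a * (k%:R * t)) <= (a^-1 + t) * (1 - expR (- a * (n%:R * t))).
Proof.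
move=> a0 t0; elim: n => [|n IH].
  by rewrite big_ord0 mul0r mulr0 expR0 subrr mulr0.
rewrite big_ord_recr /=; apply: (le_trans (lerD IH (lexx _))).
rewrite -subr_ge0; set E := expR (- a * (n%:R * t)).
have -> : expR (- a * (n.+1%:R * t)) = E * expR (- (a * t)).
  by rewrite /E -expRD; congr expR; rewrite -natr1; ring.
have -> : (a^-1 + t) * (1 - E * expR (- (a * t))) - ((a^-1 + t) * (1 - E) + t * E)
    = E * (a^-1 - (a^-1 + t) * expR (- (a * t))) by ring.
apply: mulr_ge0; first exact: expR_ge0.
rewrite subr_ge0 expRN ler_pdivrMr ?expR_gt0 //.
have -> : a^-1 + t = a^-1 * (1 + a * t) by field; exact: lt0r_neq0.
by rewrite ler_pM2l ?invr_gt0 //; exact: expR_ge1Dx.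
Qed.

(** Half of the exponent absorbs the polynomial and the other half is summed, uniformly in the step
    and in the number of terms. *)
Lemma poly_exp_sum p a tau0 : 0 < a ->
  exists2 S, 0 <= S & forall tau, 0 < tau -> tau <= tau0 -> forall n,
    \sum_(k < n) tau * (p.[k%:R * tau] * expR (- a * (k%:R * tau))) <= S.
Proof.
move=> a0; have a20 : 0 < a / 2 by rewrite divr_gt0.
have [C C0 HC] := poly_le_exp p a20.
exists (C * ((a / 2)^-1 + `|tau0|)) => [|tau tau_gt0 tau_le n].
  by rewrite mulr_ge0 // addr_ge0 // ltW // invr_gt0.
apply: (@le_trans _ _ (C * \sum_(k < n) tau * expR (- (a / 2) * (k%:R * tau)))).
  rewrite mulr_sumr; apply: ler_sum => k _.
  have kt : 0 <= k%:R * tau by rewrite mulr_ge0 // ltW.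
  rewrite [X in _ <= X]mulrCA; apply: (ler_wpM2l (ltW tau_gt0)).
  have -> : - a * (k%:R * tau) = - (a / 2) * (k%:R * tau) + - (a / 2 * (k%:R * tau)).
    by field.
  rewrite expRD expRN mulrCA [X in _ <= X]mulrC ler_wpM2l ?expR_ge0 //.
  rewrite ler_pdivrMr ?expR_gt0 //; apply: le_trans (HC _ kt).
  exact: ler_norm.
apply: ler_wpM2l => //; apply: (le_trans (geometric_exp_sum _ a20 tau_gt0)).
have p0 : 0 <= (a / 2)^-1 + tau by rewrite addr_ge0 // ltW // invr_gt0.
apply: (@le_trans _ _ ((a / 2)^-1 + tau)).
  by rewrite ler_piMr // gerBl expR_ge0.
by rewrite lerD2l; apply: (le_trans tau_le); exact: ler_norm.
Qed.

End GrowthPolynomials.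

(** * Construction and almost invariance of the modified density *)

Section ModifiedDensities.
Context {R : realType} {d m : nat}.
Variables (f : 'I_d -> 'rV[R]_d -> R) (sigma : 'I_d -> 'I_m -> 'rV[R]_d -> R).
Hypotheses (f_smooth : forall i, smooth_torus (f i))
  (sigma_smooth : forall i l, smooth_torus (sigma i l)).
Variable rho : 'rV[R]_d -> R.
Hypotheses (h1 : H1 f sigma rho) (h2 : H2 f sigma rho).
Implicit Types (psi : 'rV[R]_d -> R) (mu : nat -> 'rV[R]_d -> R).

Notation mean g mu := (torus_int (fun x => g x * mu x)).

(* Formally [rho + \sum_l tau^l mu_l] is invariant for [\sum_j tau^j frozen j / j!]:
   this is the coefficient of [tau^(l+1)]. *)
Definition density_coeff mu (l : nat) : Prop := [/\ smooth_torus (mu l),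
  (0 < l)%N -> torus_int (mu l) = 0 &
  forall psi, smooth_torus psi ->
    \sum_(j < l.+1) j.+1`!%:R^-1 * mean (frozen f sigma j.+1 psi) (mu (l - j)%N) = 0].

Lemma density_coeff_exists n :
  exists2 mu, mu 0%N = rho & forall l, (l <= n)%N -> density_coeff mu l.
Proof.
have [srho _ adj int1] := h1.
elim: n => [|n [mu mu0 Hmu]].
  exists (fun=> rho) => // -[|//] _; split => // psi spsi.
  rewrite big_ord1 invr1 mul1r frozen1 adj //.
  by under eq_fun do rewrite mulr0; exact: torus_int0.
have dF j := diff_op_frozen f_smooth sigma_smooth j.
have smu l : (l <= n)%N -> smooth_torus (mu l) by move=> /Hmu [].
(* [g j] represents the adjoint of [frozen j.+2] applied to [mu (n - j)]; it is smooth, as the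
   right-hand side in [H2] has to be. *)
have /choice [g Hg] : forall j : 'I_n.+1, exists g, smooth_torus g /\
    forall psi, smooth_torus psi ->
    mean (frozen f sigma j.+2 psi) (mu (n - j)%N) = mean psi g.
  move=> j; have [g sg Hg] := diff_op_adjoint (dF j.+2) (smu _ (leq_subr j n)).
  by exists g.
pose G x := - \sum_(j < n.+1) j.+2`!%:R^-1 * g j x.
have sG : smooth_torus G.
  apply: smooth_torusN; apply: smooth_torus_sum => j _; apply: smooth_torusZ.
  by case: (Hg j).
have meanG psi : smooth_torus psi -> mean psi G
    = - \sum_(j < n.+1) j.+2`!%:R^-1 * mean (frozen f sigma j.+2 psi) (mu (n - j)%N).
  move=> spsi.
  have sj j : smooth_torus (fun x => psi x * g j x) := smooth_torusM spsi (Hg j).1.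
  have sjZ (j : 'I_n.+1) : smooth_torus (fun x => j.+2`!%:R^-1 * (psi x * g j x)).
    exact: (smooth_torusZ _ (sj j)).
  have -> : (fun x => psi x * G x)
      = (fun x => -1 * \sum_(j < n.+1) j.+2`!%:R^-1 * (psi x * g j x)).
    apply/funext => x; rewrite /G mulrN mulN1r mulr_sumr; congr (- _).
    by apply: eq_bigr => j _; rewrite mulrCA.
  rewrite (torus_intZ _ (smooth_torus_sum _ (fun j _ => sjZ j))).
  rewrite mulN1r; congr (- _).
  rewrite (torus_int_sum _ (fun j _ => sjZ j)).
  by apply: eq_bigr => j _; rewrite (torus_intZ _ (sj j)) ((Hg j).2 _ spsi).
(* The solvability condition of [H2], obtained by testing with the constant 1. *)
have meanG0 : torus_int G = 0.
  have := meanG _ (smooth_torus_cst 1).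
  have -> : (fun x => 1 * G x) = G by apply/funext => x; rewrite mul1r.
  move=> ->; rewrite big1 ?oppr0 // => j _; rewrite frozen_cst.
  have -> : (fun x => 0 * mu (n - j)%N x) = (fun=> 0).
    by apply/funext => x; rewrite mul0r.
  by rewrite torus_int0 mulr0.
have [nu [[snu adjnu _] _]] := h2 sG meanG0.
(* [H2] normalizes [nu] against [rho], whereas mean zero for the Lebesgue measure is needed. As
   [rho] has integral 1 and is in the kernel of the adjoint, the correction restores the mean and
   preserves the equation. *)
pose nu' x := nu x - torus_int nu * rho x.
have srho' := smooth_torusZ (torus_int nu) srho.
have snu' : smooth_torus nu' := smooth_torusB snu srho'.
pose mu' l := if (l == n.+1)%N then nu' else mu l.
have mu'E l : (l <= n)%N -> mu' l = mu l.
  by rewrite /mu'; case: eqP => // ->; rewrite ltnn.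
exists mu'; first by rewrite mu'E.
move=> l; rewrite leq_eqVlt => /orP[/eqP ->|]; last first.
  rewrite ltnS => ln; have [s1 s2 s3] := Hmu l ln; rewrite /density_coeff mu'E //; split => //.
  move=> psi spsi; rewrite -[RHS](s3 psi spsi); apply: eq_bigr => j _.
  by rewrite mu'E // (leq_trans (leq_subr _ _)).
have mu'n : mu' n.+1 = nu' by rewrite /mu' eqxx.
rewrite /density_coeff mu'n; split => //.
  by move=> _; rewrite (torus_intB snu srho') (torus_intZ _ srho) int1 mulr1 subrr.
move=> psi spsi.
have sL : smooth_torus (generator f sigma psi).
  exact: diff_op_smooth (diff_op_generator f_smooth sigma_smooth) _ spsi.
rewrite big_ord_recl subn0 invr1 mul1r frozen1 mu'n.
have -> : mean (generator f sigma psi) nu' = mean psi G.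
  have -> : (fun x => generator f sigma psi x * nu' x)
     = (fun x => generator f sigma psi x * nu x
          - torus_int nu * (generator f sigma psi x * rho x)).
    by apply/funext => x; rewrite /nu'; ring.
  have sLr := smooth_torusM sL srho.
  rewrite (torus_intB (smooth_torusM sL snu) (smooth_torusZ _ sLr)).
  rewrite (torus_intZ _ sLr) (adj _ spsi).
  have -> : (fun x : 'rV[R]_d => psi x * 0) = (fun=> 0).
    by apply/funext => x; rewrite mulr0.
  by rewrite torus_int0 mulr0 subr0 adjnu.
rewrite (meanG _ spsi) addrC; apply/eqP; rewrite subr_eq0; apply/eqP.
by apply: eq_bigr => j _; rewrite lift0 subSS mu'E ?leq_subr.
Qed.

Variable N : nat.
Variable mu : nat -> 'rV[R]_d -> R.
Hypotheses (mu0 : mu 0%N = rho) (muP : forall l, (l <= N)%N -> density_coeff mu l).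

Definition modified_density (tau : R) : 'rV[R]_d -> R :=
  fun x => \sum_(i < N.+1) tau ^+ i * mu i x.

Let smu (i : 'I_N.+1) : smooth_torus (mu i).
Proof. by have [] := muP (ltnSE (ltn_ord i)). Qed.

Lemma smooth_modified_density tau : smooth_torus (modified_density tau).
Proof.
by apply: smooth_torus_sum => i _; exact: smooth_torusZ (smu i).
Qed.

Lemma modified_densityE tau x :
  modified_density tau x = rho x + \sum_(1 <= n < N.+1) tau ^+ n * mu n x.
Proof.
by rewrite /modified_density -(big_mkord xpredT (fun i => tau ^+ i * mu i x))
  big_nat_recl // expr0 mul1r mu0 big_add1.
Qed.

Lemma torus_int_modified_density tau : torus_int (modified_density tau) = 1.
Proof.
rewrite (torus_int_sum _ (fun (i : 'I_N.+1) _ => smooth_torusZ (tau ^+ i) (smu i))).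
rewrite big_ord_recl /= (torus_intZ _ (smu ord0)) expr0 mul1r mu0.
have [_ _ _ ->] := h1; rewrite big1 ?addr0 // => i _.
rewrite (torus_intZ _ (smu (lift ord0 i))).
by have [_ -> // _] := muP (ltnSE (ltn_ord (lift ord0 i))); rewrite mulr0.
Qed.

Lemma mean_modified_density tau psi : smooth_torus psi ->
  mean psi (modified_density tau) = \sum_(i < N.+1) tau ^+ i * mean psi (mu i).
Proof.
move=> spsi; have s (i : 'I_N.+1) : smooth_torus (fun x => tau ^+ i * (psi x * mu i x)) by
  exact: (smooth_torusZ _ (smooth_torusM spsi (smu i))).
have -> : (fun x => psi x * modified_density tau x)
    = (fun x => \sum_(i < N.+1) tau ^+ i * (psi x * mu i x)).
  apply/funext => x; rewrite mulr_sumr; apply: eq_bigr => i _.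
  by rewrite mulrCA.
rewrite (torus_int_sum _ (fun (i : 'I_N.+1) _ => s i)); apply: eq_bigr => i _.
exact: (torus_intZ _ (smooth_torusM spsi (smu i))).
Qed.

Variable tau0 : R.
Hypothesis tau0_gt0 : 0 < tau0.

Lemma mean_bounded (i : 'I_N.+1) : exists2 C, 0 <= C & forall psi M,
  smooth_torus psi -> (forall x, `|psi x| <= M) -> `|mean psi (mu i)| <= C * M.
Proof.
have [C HC] := periodic_bounded (smooth_continuous (smu i).2) (smu i).1.
exists C => [|psi M spsi HM]; first by apply: le_trans (HC 0).
apply: (torus_int_bound (smooth_torusM spsi (smu i))) => x.
by rewrite normrM mulrC; apply: ler_pM.
Qed.

(** The base [1 + tau0] is at least 1, so a single power bounds all the lower ones, whether [tau0]
    is small or large. *)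
Lemma expr_tau_le tau i n : 0 < tau -> tau <= tau0 -> (i <= n)%N ->
  tau ^+ i <= (1 + tau0) ^+ n.
Proof.
move=> t0 tt iN; have h : 1 <= 1 + tau0 by rewrite lerDl ltW.
apply: (@le_trans _ _ ((1 + tau0) ^+ i)).
  apply: lerXn2r; rewrite ?nnegrE; [exact: ltW|exact: le_trans h|].
  by apply: (le_trans tt); rewrite lerDr.
exact: ler_weXn2l.
Qed.

Lemma mean_modified_density_bounded : exists2 C, 0 <= C &
  forall tau psi M, 0 < tau -> tau <= tau0 -> smooth_torus psi ->
  (forall x, `|psi x| <= M) -> `|mean psi (modified_density tau)| <= C * M.
Proof.
have /choice [C HC] : forall i : 'I_N.+1, exists C, 0 <= C /\ forall psi M,
    smooth_torus psi -> (forall x, `|psi x| <= M) -> `|mean psi (mu i)| <= C * M.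
  by move=> i; have [C C0 H] := mean_bounded i; exists C.
exists (\sum_i (1 + tau0) ^+ N * C i).
  by apply: sumr_ge0 => i _; rewrite mulr_ge0 ?exprn_ge0 ?addr_ge0 ?(ltW tau0_gt0) ?(HC i).1.
move=> tau psi M t0 tt spsi HM; rewrite (mean_modified_density _ spsi) mulr_suml.
apply: (le_trans (ler_norm_sum _ _ _)); apply: ler_sum => i _.
rewrite normrM -mulrA ger0_norm ?exprn_ge0 ?(ltW t0) //.
apply: ler_pM; rewrite ?exprn_ge0 ?(ltW t0) //; last exact: (HC i).2.
exact: (expr_tau_le t0 tt (ltnSE (ltn_ord i))).
Qed.

(** Collects the terms by total degree [l = i + j]; thanks to [n <= N] the range of [i] cuts off
    none of them. *)
Lemma sum_antidiagonal (F : nat -> nat -> R) n : (n <= N)%N ->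
  \sum_(j < n) \sum_(i < N.+1) (if (i + j < n)%N then F i j else 0)
  = \sum_(l < n) \sum_(j < l.+1) F (l - j)%N j.
Proof.
move=> nN; transitivity (\sum_(j < n) \sum_(l < n | (j <= l)%N) F (l - j)%N j).
  apply: eq_bigr => j _.
  rewrite -(big_mkord xpredT (fun i => if (i + j < n)%N then F i j else 0)).
  rewrite -(big_mkord (fun l => (j <= l)%N) (fun l => F (l - j)%N j)).
  rewrite -(@big_nat_widenl _ _ _ j 0 n xpredT (fun l => F (l - j)%N j)) //.
  have -> : \sum_(j <= l < n) F (l - j)%N j = \sum_(0 <= i < n - j) F i j.
    have := big_addn 0 n j xpredT (fun l => F (l - j)%N j); rewrite add0n => ->.
    by apply: eq_bigr => i _; rewrite addnK.
  rewrite -big_mkcond /= [RHS](@big_nat_widen _ _ _ 0 (n - j) N.+1); last first.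
    by rewrite leq_subLR (leq_trans nN) // (leq_trans (leqnSn N)) // leq_addl.
  by apply: eq_bigl => i; rewrite ltn_subRL addnC.
transitivity (\sum_(l < n) \sum_(j < n | (j <= l)%N) F (l - j)%N j).
  by rewrite (exchange_big_dep xpredT).
by apply: eq_bigr => l _; rewrite (big_ord_widen n (fun j => F (l - j)%N j)).
Qed.

(** In the double expansion in powers of [tau], the coefficients with [i + j < n] cancel by
    [density_coeff] once grouped by degree. All other terms contain [tau ^+ n.+1], and their excess
    powers of [tau] are bounded by [K]. *)
Lemma modified_density_almost_invariant n : (n <= N)%N ->
  exists2 C, 0 <= C & forall tau psi M, 0 < tau -> tau <= tau0 ->
    smooth_torus psi -> bounded_upto (2 * n) M psi ->
    `|\sum_(j < n) tau ^+ j.+1 / j.+1`!%:R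
        * mean (frozen f sigma j.+1 psi) (modified_density tau)|
      <= C * tau ^+ n.+1 * M.
Proof.
move=> nN; have dF j := diff_op_frozen f_smooth sigma_smooth j.
have /choice [D HD] : forall j, exists D, 0 <= D /\ forall psi M, smooth_torus psi ->
    bounded_upto (j * 2) M psi -> forall x, `|frozen f sigma j psi x| <= D * M.
  move=> j; have [D D0 H] := diff_op_bounded (dF j) 0.
  by exists D; split => // psi M spsi B x; exact: bounded_upto_sup (H _ _ spsi B).
have /choice [C HC] : forall i : 'I_N.+1, exists C, 0 <= C /\ forall psi M,
    smooth_torus psi -> (forall x, `|psi x| <= M) -> `|mean psi (mu i)| <= C * M.
  by move=> i; have [C C0 H] := mean_bounded i; exists C.
pose K := (1 + tau0) ^+ (n + N).
have K0 : 0 <= K by rewrite exprn_ge0 // addr_ge0 // ltW.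
exists (\sum_(j < n) \sum_(i < N.+1) K * (C i * D j.+1)).
  by do 2![apply: sumr_ge0 => ? _]; rewrite !mulr_ge0 ?(HC _).1 ?(HD _).1.
move=> tau psi M t0 tt spsi BM.
have M0 := bounded_upto_ge0 BM.
have sF j : smooth_torus (frozen f sigma j psi) := diff_op_smooth (dF j) spsi.
pose b (i j : nat) := j.+1`!%:R^-1 * mean (frozen f sigma j.+1 psi) (mu i).
have -> : \sum_(j < n) tau ^+ j.+1 / j.+1`!%:R
        * mean (frozen f sigma j.+1 psi) (modified_density tau)
   = \sum_(j < n) \sum_(i < N.+1) tau ^+ (i + j).+1 * b i j.
  apply: eq_bigr => j _; rewrite (mean_modified_density _ (sF _)) mulr_sumr.
  by apply: eq_bigr => i _; rewrite /b -addnS exprD; ring.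
have -> : \sum_(j < n) \sum_(i < N.+1) tau ^+ (i + j).+1 * b i j
   = \sum_(j < n) \sum_(i < N.+1) (if (i + j < n)%N then tau ^+ (i + j).+1 * b i j else 0)
   + \sum_(j < n) \sum_(i < N.+1) (if (i + j < n)%N then 0 else tau ^+ (i + j).+1 * b i j).
  rewrite -big_split; apply: eq_bigr => j _; rewrite -big_split; apply: eq_bigr => i _ /=.
  by case: ifP; rewrite ?addr0 ?add0r.
rewrite (@sum_antidiagonal (fun i j => tau ^+ (i + j).+1 * b i j) _ nN).
rewrite big1 ?add0r => [|l _]; last first.
  have lN : (l <= N)%N by rewrite (leq_trans _ nN) // ltnW.
  have [_ _ H] := muP lN.
  transitivity (tau ^+ l.+1 * \sum_(j < l.+1) b (l - j)%N j).
    rewrite mulr_sumr; apply: eq_bigr => j _.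
    by rewrite subnK // -ltnS.
  by rewrite H // mulr0.
rewrite !mulr_suml; apply: (le_trans (ler_norm_sum _ _ _)); apply: ler_sum => j _.
rewrite !mulr_suml; apply: (le_trans (ler_norm_sum _ _ _)); apply: ler_sum => i _.
have tn : 0 <= tau ^+ n.+1 by rewrite exprn_ge0 // ltW.
case: ltnP => ijn; first by rewrite normr0 !mulr_ge0 ?(HC _).1 ?(HD _).1.
have -> : tau ^+ (i + j).+1 = tau ^+ n.+1 * tau ^+ (i + j - n).
  by rewrite -exprD addSn subnKC.
rewrite normrM normrM (ger0_norm tn).
rewrite (ger0_norm (exprn_ge0 _ (ltW t0))).
have -> : K * (C i * D j.+1) * tau ^+ n.+1 * M
   = tau ^+ n.+1 * K * (C i * (D j.+1 * M)) by ring.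
apply: ler_pM => //; first by rewrite mulr_ge0 ?exprn_ge0 ?(ltW t0).
  apply: ler_wpM2l => //; apply: (expr_tau_le t0 tt).
  apply: (leq_trans (leq_subr _ _)); rewrite addnC.
  exact: (leq_add (ltnW (ltn_ord j)) (ltnSE (ltn_ord i))).
rewrite /b normrM; apply: (@le_trans _ _ (1 * `|mean (frozen f sigma j.+1 psi) (mu i)|)).
  apply: ler_wpM2r => //; rewrite ger0_norm ?invr_ge0 //.
  by rewrite invf_le1 ?ltr0n ?fact_gt0 // ler1n fact_gt0.
rewrite mul1r; apply: ((HC i).2 _ _ (sF _)); apply: ((HD j.+1).2 _ _ spsi).
by apply: bounded_uptoW BM => //; rewrite mulnC leq_mul2l ltn_ord.
Qed.

End ModifiedDensities.

(** * Weak error *)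

Section EvolutionTaylor.
Context {R : realType} {d : nat}.
Notation V := 'rV[R]_d.

Lemma diff_op_sub q (A B : (V -> R) -> V -> R) : diff_op q A -> diff_op q B ->
  diff_op q (fun psi x => A psi x - B psi x).
Proof.
move=> dA dB; have := diff_op_add dA (diff_op_mul (smooth_torus_cst (-1)) dB).
have -> // : (fun psi x => A psi x + -1 * B psi x) = (fun psi x => A psi x - B psi x).
by apply/funext => psi; apply/funext => x; rewrite mulN1r.
Qed.

Lemma jointly_smooth_time (v : R -> V -> R) (t tau : R) x : jointly_smooth v -> 0 <= t ->
  {within `[0, tau], continuous (fun s => v (t + s) x)}.
Proof.
move=> jv t0; apply/subspace_continuousP => s /=; rewrite in_itv /= => /andP[s0 _].
apply/cvgrPdist_le => e e0; rewrite near_withinE.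
have [del del0 H] := jointly_smooth_within jv x (addr_ge0 t0 s0) e0.
apply/nbhs_ballP; exists del => // r; rewrite /ball /= => rs.
rewrite in_itv /= => /andP[r0 _].
rewrite distrC; have := H (t + r) 0 (addr_ge0 t0 r0); rewrite addr0; apply.
  have -> : t + r - (t + s) = - (s - r) by ring.
  by rewrite normrN.
by move=> i; rewrite mxE normr0.
Qed.

Variable L : (V -> R) -> V -> R.
Hypothesis dL : diff_op 2 L.

Lemma evolution_iter v j : evolution v (fun t => L (v t)) ->
  evolution (fun t => iter j L (v t)) (fun t => iter j.+1 L (v t)).
Proof.
move=> ev; have := diff_op_evolution (diff_op_iter j dL) ev.
have -> // : (fun t => iter j L (L (v t))) = (fun t => iter j.+1 L (v t)).
by apply/funext => t; rewrite iterSr.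
Qed.

(** The families [iter j L (v t)] form a chain of time derivatives, so [taylor_chain] applies on
    [[t, t + tau]], including the case [t = 0]. *)
Lemma evolution_taylor n : exists2 D, 0 <= D & forall v, evolution v (fun t => L (v t)) ->
  forall t tau B, 0 <= t -> 0 < tau ->
  (forall s, t <= s -> s <= t + tau -> bounded_upto (n.+1 * 2) B (v s)) ->
  forall x, `|v (t + tau) x - \sum_(j < n.+1) tau ^+ j / j`!%:R * iter j L (v t) x|
    <= D * B * tau ^+ n.+1.
Proof.
have [D D0 HD] := diff_op_bounded (diff_op_iter n.+1 dL) 0.
exists D => // v ev t tau B t0 tau0 HB x.
have evj j := evolution_iter j ev.
pose h j s := iter j L (v (t + s)) x.
have ch j : {within `[0, tau], continuous (h j)}.
  by have [jv _ _] := evj j; exact: (@jointly_smooth_time _ t tau x jv t0).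
have dh j s : 0 < s -> s < tau -> is_derive s (1 : R) (h j) (h j.+1 s).
  move=> s0 _; have [_ _ dv] := evj j.
  have ts : 0 < t + s by rewrite ltr_wpDl.
  apply: (@is_derive_comp_affine R R R (fun r => iter j L (v r) x) (fun s => t + s) s 1 1).
    by move=> r; rewrite addrCA.
  exact: dv.
have bh s : 0 < s -> s < tau -> `|h n.+1 s| <= D * B.
  move=> s0 st; have [[sv _] _ _] := ev.
  have ts : 0 <= t + s by rewrite addr_ge0 // ltW.
  apply: (bounded_upto_sup x (HD _ _ (sv _ ts) _)).
  by apply: HB; rewrite ?lerDl ?lerD2l ltW.
have := taylor_chain tau0 ch dh bh; rewrite /h addr0 => /le_trans; apply.
have DB : 0 <= D * B.
  apply: mulr_ge0 => //; apply: (bounded_upto_ge0 (HB t _ _)) => //.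
  by rewrite lerDl ltW.
rewrite ler_wpM2l // ler_piMr ?exprn_ge0 ?(ltW tau0) //.
by rewrite invf_le1 ?ltr0n ?fact_gt0 // ler1n fact_gt0.
Qed.

End EvolutionTaylor.

Section Functionals.
Context {R : realType} {d : nat}.
Notation V := 'rV[R]_d.

(** What the weak error estimate uses of the expectation along the scheme and of the integral
    against the modified density. The latter need not be positive, whence a general constant [K]. *)
Record bounded_functional (K : R) (e : (V -> R) -> R) : Prop := BoundedFunctional {
  functionalD : forall psi phi, smooth_torus psi -> smooth_torus phi ->
    e (fun x => psi x + phi x) = e psi + e phi;
  functionalZ : forall c psi, smooth_torus psi -> e (fun x => c * psi x) = c * e psi;
  functional_bound : forall psi M, smooth_torus psi -> (forall x, `|psi x| <= M) ->
    `|e psi| <= K * M;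
  functional1 : e (fun=> 1) = 1 }.

Variables (K : R) (e : (V -> R) -> R).
Hypothesis he : bounded_functional K e.

Lemma functionalB psi phi : smooth_torus psi -> smooth_torus phi ->
  e (fun x => psi x - phi x) = e psi - e phi.
Proof.
move=> sp sf; rewrite -mulN1r -(functionalZ he _ sf) -(functionalD he sp (smooth_torusZ _ sf)).
by congr e; apply/funext => x; rewrite mulN1r.
Qed.

Lemma functionalC c : e (fun=> c) = c.
Proof.
rewrite -[RHS]mulr1 -[X in c * X](functional1 he) -(functionalZ he c (smooth_torus_cst 1)).
by congr e; apply/funext => x; rewrite mulr1.
Qed.

Lemma functional_sum (I : Type) (r : seq I) (c : I -> R) (F : I -> V -> R) :
  (forall i, smooth_torus (F i)) ->
  e (fun x => \sum_(i <- r) c i * F i x) = \sum_(i <- r) c i * e (F i).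
Proof.
move=> sF; have sZ i := smooth_torusZ (c i) (sF i).
elim: r => [|i r IH].
  by rewrite big_nil; under eq_fun do rewrite big_nil; exact: functionalC.
rewrite big_cons; under eq_fun do rewrite big_cons.
rewrite (functionalD he (sZ i) (smooth_torus_sum _ (fun i _ => sZ i))).
by rewrite (functionalZ he _ (sF i)) IH.
Qed.

End Functionals.

Section WeakError.
Context {R : realType} {d m : nat}.
Notation V := 'rV[R]_d.
Variables (f : 'I_d -> V -> R) (sigma : 'I_d -> 'I_m -> V -> R).
Hypotheses (f_smooth : forall i, smooth_torus (f i))
  (sigma_smooth : forall i l, smooth_torus (sigma i l)).
Variables (u : (V -> R) -> R -> V -> R) (u_sol : solution_operator f sigma u).
Variables (rho : V -> R) (lambda : R).
Hypotheses (h1 : H1 f sigma rho) (h3 : H3 u rho lambda).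

Let L := generator f sigma.
Let dL : diff_op 2 L := diff_op_generator f_smooth sigma_smooth.

Lemma evolution_solution phi : smooth_torus phi -> evolution (u phi) (fun t => L (u phi t)).
Proof.
move=> sphi; have [[_ su cu du] _] := u_sol sphi.
have ju := jointly_smoothP su cu.
by split; [exact: ju|exact: (diff_op_jointly dL ju)|exact: du].
Qed.

(** [H3] restated with [bounded_upto] and with a polynomial that may be evaluated at a later
    time. *)
Lemma solution_decay k : exists2 Q, nondecreasing_poly Q &
  forall phi M, smooth_torus phi -> torus_int (fun x => phi x * rho x) = 0 ->
    bounded_upto k M phi -> forall t, 0 <= t ->
    bounded_upto k (Q.[t] * expR (- lambda * t) * M) (u phi t).
Proof.
have [_ /(_ k) [p Hp]] := h3; have [Q HQ pQ] := nondecreasing_majorant p.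
exists Q => // phi M sphi phi0 BM t t0.
have M0 := bounded_upto_ge0 BM.
have [[_ su _ _] _] := u_sol sphi.
apply: (bounded_upto_Ck_norm (su t t0).2).
apply: (le_trans (Hp _ sphi phi0 t t0)).
have N0 : (0 <= Ck_norm k phi)%E.
  apply: (@le_trans _ _ (`|multi_partial [ffun=> 0%N] phi 0|)%:E); first by rewrite lee_fin.
  apply: ereal_sup_ubound; exists [ffun=> 0%N], 0; split => //.
  by rewrite /multi_degree big1 // => i _; rewrite ffunE.
rewrite EFinM; apply: (@le_trans _ _ ((Q.[t] * expR (- lambda * t))%:E * Ck_norm k phi)%E).
  by apply: (lee_wpmul2r N0); rewrite lee_fin ler_wpM2r ?expR_ge0 // pQ.
have Qe0 : (0 <= (Q.[t] * expR (- lambda * t))%:E)%E.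
  by rewrite lee_fin mulr_ge0 ?expR_ge0 // nondecreasing_poly_ge0.
exact: (lee_pmul Qe0 N0 (lexx _) (Ck_norm_le BM)).
Qed.

Variables (tau0 : R) (tau0_gt0 : 0 < tau0).
Variables (CE : nat -> R).

(* [e q] stands for [phi |-> E phi(X_q)]. *)
Record euler_functionals (tau : R) (e : nat -> (V -> R) -> R) : Prop := EulerFunctionals {
  euler_functional : forall q, bounded_functional 1 (e q);
  euler_step : forall q n psi M, smooth_torus psi -> bounded_upto (2 * n).+2 M psi ->
    `|e q.+1 psi - \sum_(j < n.+1) tau ^+ j / j`!%:R * e q (frozen f sigma j psi)|
      <= CE n * M * tau ^+ n.+1 }.

Variables (N : nat) (mu : R -> (V -> R) -> R) (Cm : R) (Cm_ge0 : 0 <= Cm).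
Hypothesis mu_functional : forall tau, 0 < tau -> tau <= tau0 ->
  bounded_functional Cm (mu tau).
Hypothesis mu_invariant : forall n, (n <= N)%N -> exists2 C, 0 <= C &
  forall tau psi M, 0 < tau -> tau <= tau0 -> smooth_torus psi ->
    bounded_upto (2 * n) M psi ->
    `|\sum_(j < n) tau ^+ j.+1 / j.+1`!%:R * mu tau (frozen f sigma j.+1 psi)|
      <= C * tau ^+ n.+1 * M.

(** At every order [n] the comparison is with the same functional [mu tau], which contains all [N]
    corrections. [C] and [P] are fixed before [tau] and [e], hence are uniform in the step, the
    probability space and the initial point. *)
Definition weak_error_bound n (C : R) (P : {poly R}) : Prop :=
  forall tau e, 0 < tau -> tau <= tau0 -> euler_functionals tau e ->
  forall phi M, smooth_torus phi -> bounded_upto (8 * n + 2) M phi -> forall p,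
    `|e p phi - mu tau phi|
      <= (P.[p%:R * tau] * expR (- lambda * (p%:R * tau)) + C * tau ^+ n) * M.

Let lambda_gt0 : 0 < lambda. Proof. by case: h3. Qed.

Let B j psi x := frozen f sigma j psi x - iter j L psi x.

Let dB j : diff_op (j * 2) (B j).
Proof.
exact: diff_op_sub (diff_op_frozen f_smooth sigma_smooth j) (diff_op_iter j dL).
Qed.

Let dF j : diff_op (j * 2) (frozen f sigma j) := diff_op_frozen f_smooth sigma_smooth j.
Let dLj j : diff_op (j * 2) (iter j L) := diff_op_iter j dL.

Let coeff_norm (tau : R) j : 0 < tau -> `|tau ^+ j / j`!%:R| <= tau ^+ j.
Proof.
move=> t0; rewrite ger0_norm ?divr_ge0 ?exprn_ge0 ?ler0n ?(ltW t0) //.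
by rewrite ler_piMr ?exprn_ge0 ?(ltW t0) // invf_le1 ?ltr0n ?fact_gt0 // ler1n fact_gt0.
Qed.

(* One term of the telescoping sum: up to [O(tau^(n+1))], only the defects [B j]
   with [2 <= j <= n] survive. *)
Let telescoped_term tau (e e' nu : (V -> R) -> R) psi w n (r1 r2 r3 : R) :
  bounded_functional 1 e -> bounded_functional Cm nu -> 0 < tau ->
  smooth_torus psi -> smooth_torus w ->
  `|e' psi - \sum_(j < n.+1) tau ^+ j / j`!%:R * e (frozen f sigma j psi)| <= r1 ->
  (forall x, `|w x - \sum_(j < n.+1) tau ^+ j / j`!%:R * iter j L psi x| <= r2) ->
  `|\sum_(j < n) tau ^+ j.+1 / j.+1`!%:R * nu (frozen f sigma j.+1 psi)| <= r3 ->
  `|e' psi - e w - (nu psi - nu w)|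
    <= r1 + (1 + Cm) * r2 + r3 + \sum_(j < n.+1) tau ^+ j * `|e (B j psi) - nu (B j psi)|.
Proof.
move=> he hnu t0 spsi sw H1 H2 H3.
pose c j : R := tau ^+ j / j`!%:R.
have sL j : smooth_torus (iter j L psi) := diff_op_smooth (dLj j) spsi.
have sF j : smooth_torus (frozen f sigma j psi) := diff_op_smooth (dF j) spsi.
have sT : smooth_torus (fun x => \sum_(j < n.+1) c j * iter j L psi x).
  by apply: smooth_torus_sum => j _; exact: (smooth_torusZ (c j) (sL j)).
pose rem x := w x - \sum_(j < n.+1) c j * iter j L psi x.
have srem : smooth_torus rem := smooth_torusB sw sT.
have expand K (g : (V -> R) -> R) : bounded_functional K g ->
    g rem = g w - \sum_(j < n.+1) c j * g (iter j L psi).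
  move=> hg; rewrite (functionalB hg sw sT); congr (_ - _).
  exact: (functional_sum hg _ (fun j : 'I_n.+1 => c j) (fun j => sL j)).
have eB K (g : (V -> R) -> R) j : bounded_functional K g ->
    g (B j psi) = g (frozen f sigma j psi) - g (iter j L psi).
  by move=> hg; exact: (functionalB hg (sF j) (sL j)).
(* [e w] and [nu w] are expanded through the remainder [rem] and the powers of [L], and the powers
   of [L] are exchanged for [frozen] at the price of the defects [B j]. What is left is the sum in
   [nu] alone that the almost invariance controls. *)
have E : e' psi - e w - (nu psi - nu w)
  = (e' psi - \sum_(j < n.+1) c j * e (frozen f sigma j psi)) + (nu rem - e rem)
    + \sum_(j < n) c j.+1 * nu (frozen f sigma j.+1 psi)
    + \sum_(j < n.+1) c j * (e (B j psi) - nu (B j psi)).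
  rewrite (expand _ _ he) (expand _ _ hnu).
  have -> : \sum_(j < n.+1) c j * (e (B j psi) - nu (B j psi))
     = \sum_(j < n.+1) c j * e (frozen f sigma j psi)
       - \sum_(j < n.+1) c j * e (iter j L psi)
       - (\sum_(j < n.+1) c j * nu (frozen f sigma j psi)
       - \sum_(j < n.+1) c j * nu (iter j L psi)).
    rewrite -!sumrB; apply: eq_bigr => j _.
    by rewrite (eB _ _ _ he) (eB _ _ _ hnu); ring.
  have -> : \sum_(j < n.+1) c j * nu (frozen f sigma j psi)
     = nu psi + \sum_(j < n) c j.+1 * nu (frozen f sigma j.+1 psi).
    by rewrite big_ord_recl /c expr0 fact0 divr1 mul1r.
  by ring.
rewrite E; apply: (le_trans (ler_normD _ _)); apply: lerD.
  apply: (le_trans (ler_normD _ _)); apply: lerD => //.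
  apply: (le_trans (ler_normD _ _)); apply: lerD => //.
  apply: (le_trans (ler_normB _ _)); rewrite mulrDl addrC.
  by apply: lerD; [exact: functional_bound he _ _ srem H2|exact: functional_bound hnu _ _ srem H2].
apply: (le_trans (ler_norm_sum _ _ _)); apply: ler_sum => j _.
by rewrite normrM ler_wpM2r //; exact: coeff_norm.
Qed.

Let defect01 K (g : (V -> R) -> R) psi j : (j < 2)%N -> bounded_functional K g ->
  g (B j psi) = 0.
Proof.
move=> j2 hg; rewrite -(functionalC hg 0); congr g; apply/funext => x.
by case: j j2 => [|[|//]] _; rewrite /B /= ?subrr.
Qed.

Lemma weak_error_step n C' P' : (n <= N)%N -> 0 <= C' -> nondecreasing_poly P' ->
  (forall k, (k < n)%N -> weak_error_bound k C' P') ->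
  exists C P, [/\ 0 <= C, nondecreasing_poly P & weak_error_bound n C P].
Proof.
move=> nN C'0 P'0 IH.
pose K := (8 * n + 2)%N.
have order1 : (n.+1 * 2 <= K)%N by rewrite /K; clear; lia.
have order2 : (2 * n <= K)%N by rewrite /K; clear; lia.
have order3 : ((2 * n).+2 <= K)%N by rewrite /K; clear; lia.
(* The induction hypothesis at order [n + 1 - j], applied to an operator of order [2 j], uses
   [8 n + 10 - 6 j] derivatives; this is at most [8 n + 2] as soon as [j >= 2]. *)
have order4 j : (2 <= j)%N -> (j <= n)%N ->
    (n.+1 - j < n)%N /\ (8 * (n.+1 - j) + 2 + j * 2 <= K)%N.
  by rewrite /K; clear; lia.
have [Q0 HQ0 decay] := solution_decay K.
have [C3 C30 HC3] := mu_invariant nN.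
have [D2 D20 HD2] := evolution_taylor dL n.
have /choice [D HD] : forall j, exists D, 0 <= D /\ forall psi M, smooth_torus psi ->
    bounded_upto (8 * (n.+1 - j) + 2 + j * 2) M psi ->
    bounded_upto (8 * (n.+1 - j) + 2) (D * M) (B j psi).
  move=> j; have [D D0 H] := diff_op_bounded (dB j) (8 * (n.+1 - j) + 2).
  by exists D.
have [srho rho0 _ rho1] := h1.
have [Rr HR] := periodic_bounded (smooth_continuous srho.2) srho.1.
have Rr0 : 0 <= Rr by apply: le_trans (HR 0).
(* The factor [1 + Rr] bounds [phi - c] in terms of [phi]. *)
pose Q := (1 + Rr)%:P * Q0.
have HQ : nondecreasing_poly Q.
  by apply: nondecreasing_polyM => //; apply: nondecreasing_polyC; exact: addr_ge0.
(* Bounds [Q] on the whole interval from [t_k] to [t_k + tau], as the Taylor remainder of the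
   solution requires. *)
pose Q1 := Q \Po ('X + tau0%:P).
have HQ1 : nondecreasing_poly Q1 by apply: nondecreasing_poly_shift => //; exact: ltW.
pose kappa := (1 + tau0) ^+ n.
have kappa1 : 1 <= kappa by rewrite exprn_ege1 // lerDl ltW.
have kappa0 : 0 <= kappa := le_trans ler01 kappa1.
pose SD := \sum_(j < n.+1) D j.
have SD0 : 0 <= SD by apply: sumr_ge0 => j _; case: (HD j).
(* [A] collects the transient parts of the lower order errors. *)
pose A := (SD * kappa * expR (lambda * tau0))%:P * (P' * Q).
have HA : nondecreasing_poly A.
  apply: nondecreasing_polyM; last exact: nondecreasing_polyM.
  by apply: nondecreasing_polyC; rewrite !mulr_ge0 // expR_ge0.
(* [G] collects the contributions of size [tau ^+ n.+1] times the decay at time [t_k]: the Euler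
   step, the almost invariance, the stationary parts of the lower order errors, and the Taylor
   remainder. *)
pose G := (CE n + C3 + SD * C')%:P * Q + ((1 + Cm) * D2)%:P * Q1.
have [S S0 HS] := poly_exp_sum G tau0 lambda_gt0.
(* The sum over [k] of [tau * G] times the decay is at most [S]; the term [a p] gives
   [(1 + Cm) * Q]; the [p] equal terms [tau * A] add up to [t_p * A]. *)
exists S, ((1 + Cm)%:P * Q + 'X * A); split => //.
  apply: nondecreasing_polyD; apply: nondecreasing_polyM => //; last exact: nondecreasing_polyX.
  by apply: nondecreasing_polyC; exact: addr_ge0.
move=> tau e t0 tt he phi M sphi BM p.
have hnu := mu_functional t0 tt; set nu := mu tau in hnu *.
have M0 := bounded_upto_ge0 BM.
have tn0 k : 0 <= k%:R * tau by rewrite mulr_ge0 // ltW.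
(* [H3] applies to data with mean zero against [rho]. Both functionals fix constants, so subtracting
   [c] does not change their difference. *)
pose c := torus_int (fun x => phi x * rho x).
have sc : smooth_torus (fun _ : V => c) := smooth_torus_cst c.
pose phi' x := phi x - c.
have sphi' : smooth_torus phi' := smooth_torusB sphi sc.
have c_le : `|c| <= Rr * M.
  apply: (torus_int_bound (smooth_torusM sphi srho)) => x.
  by rewrite normrM mulrC ler_pM // (bounded_upto_sup x BM).
have Bphi' : bounded_upto K ((1 + Rr) * M) phi'.
  have Bc := @bounded_upto_cst R d K (- c).
  have := bounded_uptoD sphi.2 (smooth_torus_cst (- c)).2 BM Bc.
  apply: bounded_uptoW => //; rewrite normrN mulrDl mul1r.
  by rewrite lerD2l.
have phi'0 : torus_int (fun x => phi' x * rho x) = 0.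
  have -> : (fun x => phi' x * rho x) = (fun x => phi x * rho x - c * rho x).
    by apply/funext => x; rewrite /phi' mulrBl.
  rewrite (torus_intB (smooth_torusM sphi srho) (smooth_torusZ c srho)).
  by rewrite (torus_intZ c srho) rho1 mulr1 subrr.
pose v := u phi'.
have ev : evolution v (fun t => L (v t)) := evolution_solution sphi'.
have [[sv _] _ _] := ev.
pose b t := Q.[t] * expR (- lambda * t) * M.
have Bv t : 0 <= t -> bounded_upto K (b t) (v t).
  move=> tp; have := decay _ _ sphi' phi'0 Bphi' t tp.
  apply: bounded_uptoW => //; rewrite /b /Q hornerM hornerC.
  by rewrite le_eqVlt; apply/orP; left; apply/eqP; ring.
have center (g : (V -> R) -> R) K' : bounded_functional K' g -> g phi' = g phi - c.
  by move=> hg; rewrite (functionalB hg sphi sc) (functionalC hg).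
have -> : e p phi - nu phi = e p phi' - nu phi'.
  by rewrite (center _ _ (euler_functional he p)) (center _ _ hnu); ring.
have v0 : v 0 = phi' by have [[]] := u_sol sphi'.
pose tk (k : nat) := k%:R * tau.
(* [a 0] is the error to be estimated; in [a p] the scheme has made no step and only the decay of
   [v] remains. *)
pose a k := e (p - k)%N (v (tk k)) - nu (v (tk k)).
have aE : e p phi' - nu phi' = a p + \sum_(k < p) (a k - a k.+1).
  have -> : e p phi' - nu phi' = a 0%N by rewrite /a subn0 /tk mul0r v0.
  have := telescope_sumr (fun k => - a k) (leq0n p).
  rewrite big_mkord => T.
  have -> : \sum_(k < p) (a k - a k.+1) = \sum_(k < p) (- a k.+1 - - a k).
    by apply: eq_bigr => k _; rewrite opprK addrC.
  by rewrite T; ring.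
set Ep := expR (- lambda * tk p).
have bound_a : `|a p| <= (1 + Cm) * Q.[tk p] * Ep * M.
  have Bp : forall x, `|v (tk p) x| <= b (tk p).
    by move=> x; exact: bounded_upto_sup (Bv _ (tn0 p)).
  have svp := sv _ (tn0 p).
  rewrite /a subnn; apply: (le_trans (ler_normB _ _)).
  have X1 := functional_bound (euler_functional he 0%N) svp Bp.
  have X2 := functional_bound hnu svp Bp.
  apply: (le_trans (lerD X1 X2)).
  by rewrite le_eqVlt; apply/orP; left; apply/eqP; rewrite /b -/Ep; ring.
have bound_step (k : 'I_p) : `|a k - a k.+1|
    <= tau * (A.[tk p] * Ep) * M
       + tau ^+ n.+1 * (G.[tk k] * expR (- lambda * tk k)) * M.
  set Ek := expR (- lambda * tk k).
  have kp : (k < p)%N := ltn_ord k.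
  (* From [a k] to [a k.+1] the last Euler step, from [q] to [q.+1], is traded for the flow of the
     equation over one time step. *)
  pose q := (p - k.+1)%N.
  have pkq : (p - k)%N = q.+1 by rewrite /q subnSK.
  have tkS : tk k.+1 = tk k + tau by rewrite /tk -natr1 mulrDl mul1r.
  have Bk := Bv _ (tn0 k).
  have bk0 : 0 <= b (tk k) := bounded_upto_ge0 Bk.
  have -> : a k - a k.+1 = e q.+1 (v (tk k)) - e q (v (tk k.+1))
       - (nu (v (tk k)) - nu (v (tk k.+1))).
    by rewrite /a pkq; ring.
  have R1 := euler_step he q (n := n) (sv _ (tn0 k))
    (bounded_uptoW order3 (lexx _) Bk).
  have R2 x : `|v (tk k.+1) x - \sum_(j < n.+1) tau ^+ j / j`!%:R * iter j L (v (tk k)) x|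
      <= D2 * (Q1.[tk k] * Ek * M) * tau ^+ n.+1.
    rewrite tkS; apply: (HD2 v ev (tk k) tau _ (tn0 k) t0) => s s1 s2.
    have s0 : 0 <= s := le_trans (tn0 k) s1.
    apply: bounded_uptoW (Bv s s0).
      exact: order1.
    apply: ler_wpM2r => //; apply: ler_pM.
    + exact: nondecreasing_poly_ge0.
    + exact: expR_ge0.
    + rewrite /Q1 horner_comp hornerD hornerX hornerC; apply: nondecreasing_poly_le => //.
      by apply: (le_trans s2); rewrite lerD2l.
    + by rewrite ler_expR !mulNr lerN2 ler_wpM2l // ltW.
  have R3 : `|\sum_(j < n) tau ^+ j.+1 / j.+1`!%:R
        * nu (frozen f sigma j.+1 (v (tk k)))| <= C3 * tau ^+ n.+1 * b (tk k).
    apply: (HC3 tau _ (b (tk k)) t0 tt (sv _ (tn0 k))).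
    exact: (bounded_uptoW order2 (lexx _) Bk).
  have -> : tau * (A.[tk p] * Ep) * M + tau ^+ n.+1 * (G.[tk k] * Ek) * M
    = CE n * b (tk k) * tau ^+ n.+1
      + (1 + Cm) * (D2 * (Q1.[tk k] * Ek * M) * tau ^+ n.+1)
      + C3 * tau ^+ n.+1 * b (tk k)
      + \sum_(j < n.+1) D j * (tau * kappa * expR (lambda * tau0) * (P'.[tk p] * Q.[tk p]) * Ep
           + tau ^+ n.+1 * C' * Q.[tk k] * Ek) * M.
    rewrite -mulr_suml -mulr_suml -/SD /b -/Ek.
    by rewrite /G /A !(hornerD, hornerM, hornerC); ring.
  apply: (le_trans (telescoped_term (euler_functional he q) hnu t0 (sv _ (tn0 k))
    (sv _ (tn0 k.+1)) R1 R2 R3)).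
  apply: lerD => //; apply: ler_sum => j _.
  have Y0 : 0 <= D j * (tau * kappa * expR (lambda * tau0) * (P'.[tk p] * Q.[tk p]) * Ep
           + tau ^+ n.+1 * C' * Q.[tk k] * Ek) * M.
    have P'p0 := nondecreasing_poly_ge0 P'0 (tn0 p).
    have Qp0 := nondecreasing_poly_ge0 HQ (tn0 p).
    have Qk0 := nondecreasing_poly_ge0 HQ (tn0 k).
    have Ep0 : 0 <= Ep := expR_ge0 _.
    have Ek0 : 0 <= Ek := expR_ge0 _.
    have L0 : 0 <= expR (lambda * tau0) := expR_ge0 _.
    have T0 : 0 <= tau ^+ n.+1 := exprn_ge0 _ (ltW t0).
    apply: mulr_ge0 => //; apply: mulr_ge0; first by case: (HD j).
    by apply: addr_ge0; do ?apply: mulr_ge0 => //; exact: ltW.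
  have [j2|j2] := ltnP j 2.
    rewrite (defect01 _ j2 (euler_functional he q)) (defect01 _ j2 hnu).
    by rewrite subrr normr0 mulr0.
  have jn : (j <= n)%N := ltnSE (ltn_ord j).
  have [nj ordj] := order4 _ j2 jn.
  have BB := (HD j).2 _ _ (sv _ (tn0 k)) (bounded_uptoW _ (lexx _) Bk).
  have sB : smooth_torus (B j (v (tk k))) := diff_op_smooth (dB j) (sv _ (tn0 k)).
  have := IH _ nj tau e t0 tt he _ _ sB (BB ordj) q; rewrite -/(tk q) => IHj.
  apply: (le_trans (ler_wpM2l (exprn_ge0 _ (ltW t0)) IHj)).
  have tpE : tk p = tk q + tk k + tau.
    by rewrite /tk -mulrDl -natrD -[X in _ + X]mul1r -mulrDl natr1 /q -addnS subnK.
  (* One factor [tau] is kept: summed over the [p] steps it produces [t_p]. *)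
  have le1 : tau ^+ j <= tau * kappa.
    have -> : tau ^+ j = tau * tau ^+ j.-1 by rewrite -exprS prednK // ltnW.
    apply: ler_wpM2l; first exact: ltW.
    by apply: (expr_tau_le tau0_gt0 t0 tt); rewrite (leq_trans (leq_pred _)).
  (* Since [t_q + t_k = t_p - tau], the two decays combine into the one at [t_p], up to
     [expR (lambda * tau)]. *)
  have le2 : expR (- lambda * tk q) * Ek <= Ep * expR (lambda * tau0).
    rewrite /Ek /Ep -!expRD ler_expR tpE.
    have -> : - lambda * (tk q + tk k + tau) + lambda * tau0
      = - lambda * tk q + - lambda * tk k + (lambda * tau0 - lambda * tau) by ring.
    by rewrite lerDl subr_ge0 ler_pM2l.
  have tnj : tau ^+ j * tau ^+ (n.+1 - j) = tau ^+ n.+1.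
    by rewrite -exprD subnKC // leqW.
  have q_le : tk q <= tk p by rewrite tpE -addrA lerDl (addr_ge0 (tn0 k) (ltW t0)).
  have k_le : tk k <= tk p by rewrite tpE -addrA addrCA lerDl (addr_ge0 (tn0 q) (ltW t0)).
  rewrite /b -/Ek.
  have -> : tau ^+ j * ((P'.[tk q] * expR (- lambda * tk q) + C' * tau ^+ (n.+1 - j))
        * (D j * (Q.[tk k] * Ek * M)))
    = D j * (tau ^+ j * (expR (- lambda * tk q) * Ek) * (P'.[tk q] * Q.[tk k])
        + tau ^+ j * tau ^+ (n.+1 - j) * C' * Q.[tk k] * Ek) * M by ring.
  rewrite tnj; apply: ler_wpM2r => //; apply: ler_wpM2l; first by case: (HD j).
  rewrite lerD2r.
  have -> : tau * kappa * expR (lambda * tau0) * (P'.[tk p] * Q.[tk p]) * Ep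
    = tau * kappa * (Ep * expR (lambda * tau0)) * (P'.[tk p] * Q.[tk p]) by ring.
  have P'q := nondecreasing_poly_ge0 P'0 (tn0 q).
  have Qk := nondecreasing_poly_ge0 HQ (tn0 k).
  apply: ler_pM.
  - exact: (mulr_ge0 (exprn_ge0 _ (ltW t0)) (mulr_ge0 (expR_ge0 _) (expR_ge0 _))).
  - exact: mulr_ge0.
  - exact: (ler_pM (exprn_ge0 _ (ltW t0)) (mulr_ge0 (expR_ge0 _) (expR_ge0 _)) le1 le2).
  - exact: (ler_pM P'q Qk (nondecreasing_poly_le P'0 (tn0 q) q_le)
      (nondecreasing_poly_le HQ (tn0 k) k_le)).
rewrite aE; apply: (le_trans (ler_normD _ _)).
apply: (le_trans (lerD bound_a (le_trans (ler_norm_sum _ _ _) (ler_sum _ (fun k _ => bound_step k))))).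
rewrite big_split /= sumr_const card_ord -!mulr_suml.
rewrite -/(tk p) -/Ep !(hornerD, hornerM, hornerX, hornerC).
have HSp := HS tau t0 tt p.
have -> : \sum_(k < p) tau ^+ n.+1 * (G.[tk k] * expR (- lambda * tk k))
   = tau ^+ n * \sum_(k < p) tau * (G.[k%:R * tau] * expR (- lambda * (k%:R * tau))).
  by rewrite mulr_sumr; apply: eq_bigr => k _; rewrite exprSr mulrA.
pose X := tau ^+ n * (\sum_(k < p) tau * (G.[k%:R * tau] * expR (- lambda * (k%:R * tau)))) * M.
have XS : X <= tau ^+ n * S * M.
  by apply: ler_wpM2r => //; apply: ler_wpM2l => //; rewrite exprn_ge0 // ltW.
rewrite -/X.
rewrite -subr_ge0; rewrite -subr_ge0 in XS.
set lhs := (X in 0 <= X); suff -> : lhs = tau ^+ n * S * M - X by [].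
by rewrite /lhs /X /tk; ring.
Qed.

(** Strong induction; adding the constants and the polynomials of successive orders gives a pair
    valid for all the lower orders, as [weak_error_step] demands. *)
Lemma weak_error n : (n <= N)%N -> exists C P,
  [/\ 0 <= C, nondecreasing_poly P & weak_error_bound n C P].
Proof.
suff H k : (k <= N.+1)%N -> exists C P, [/\ 0 <= C, nondecreasing_poly P &
    forall l, (l < k)%N -> weak_error_bound l C P].
  by move=> nN; have [C [P [C0 P0 Hk]]] := H n.+1 nN; exists C, P; split => //; exact: Hk.
elim: k => [|k IH] kN.
  by exists 0, 0; split => //; exact: nondecreasing_polyC.
have [C [P [C0 P0 Hk]]] := IH (ltnW kN).
have [C1 [P1 [C10 P10 Hk1]]] := weak_error_step kN C0 P0 Hk.
exists (C + C1), (P + P1); split; [exact: addr_ge0|exact: nondecreasing_polyD|].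
have mono l C2 P2 C3 P3 : 0 <= C3 -> nondecreasing_poly P3 ->
    weak_error_bound l C2 P2 -> weak_error_bound l (C2 + C3) (P2 + P3).
  move=> C30 P30 H tau e t0 tt he phi M sphi BM p.
  apply: (le_trans (H tau e t0 tt he phi M sphi BM p)).
  have M0 := bounded_upto_ge0 BM; apply: ler_wpM2r => //.
  rewrite hornerD; apply: lerD; apply: ler_wpM2r; rewrite ?expR_ge0 ?exprn_ge0 ?(ltW t0) //.
    by rewrite lerDl nondecreasing_poly_ge0 // mulr_ge0 // ltW.
  by rewrite lerDl.
move=> l; rewrite ltnS leq_eqVlt => /orP[/eqP ->|lk].
  by rewrite addrC (addrC P); exact: mono.
by apply: mono => //; exact: Hk.
Qed.

End WeakError.

(** * Gaussian moments *)

Section GaussianMoments.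
Context {R : realType}.
Notation mu := (@lebesgue_measure R).
Variable s : R.
Hypothesis s_gt0 : 0 < s.

Notation pdf := (normal_pdf 0 s).
Notation gauss := (normal_prob 0 s : probability _ R).

Let s_neq0 : s != 0. Proof. exact: lt0r_neq0. Qed.

Let measurable_pdf U : measurable U -> measurable_fun U (EFin \o pdf).
Proof.
move=> mU; apply: measurable_funTS; apply/measurable_EFinP; exact: measurable_normal_pdf.
Qed.

Let Radon_Nikodym_normal :
  ae_eq mu setT (Radon_Nikodym (charge_of_finite_measure gauss) mu) (EFin \o pdf).
Proof.
have dom := normal_prob_dominates 0 s.
apply: integral_ae_eq => //.
- exact: Radon_Nikodym_integrable.
- exact: measurable_pdf.
- by move=> E _ mE; rewrite -Radon_Nikodym_integral.
Qed.

(** The change of density, once the Radon-Nikodym derivative has been identified with [pdf] by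
    comparing integrals over measurable sets. *)
Lemma integral_normal_prob f U : measurable U -> gauss.-integrable U f ->
  (\int[gauss]_(x in U) f x = \int[mu]_(x in U) (f x * (pdf x)%:E))%E.
Proof.
move=> mU fi; have mf := measurable_int _ fi.
have dom := normal_prob_dominates 0 s.
rewrite -(Radon_Nikodym_change_of_variables dom mU fi); apply: ae_eq_integral => //.
- apply: emeasurable_funM => //; apply: measurable_funTS; apply: (measurable_int mu).
  exact: Radon_Nikodym_integrable.
- exact: emeasurable_funM mf (measurable_pdf mU).
- by apply: ae_eqe_mul2l; exact: ae_eq_subset (@subsetT _ U) Radon_Nikodym_normal.
Qed.

Lemma is_derive_normal_pdf (x : R) : is_derive x (1 : R) pdf (- x / s ^+ 2 * pdf x).
Proof.
rewrite normal_pdfE // /normal_fun.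
have D : is_derive x (1 : R) (fun y : R => - (y - 0) ^+ 2 / (s ^+ 2 *+ 2)) (- x / s ^+ 2).
  have -> : (fun y : R => - (y - 0) ^+ 2 / (s ^+ 2 *+ 2))
     = (fun y => - (s ^+ 2 *+ 2)^-1 * y ^+ 2).
    by apply/funext => y; rewrite subr0; ring.
  apply: is_derive_eq (is_derZ _ (is_derX 1 x)) _.
  by rewrite expr1 -mulr_natr; field.
have De : is_derive x (1 : R) (fun y : R => expR (- (y - 0) ^+ 2 / (s ^+ 2 *+ 2)))
    (- x / s ^+ 2 * expR (- (x - 0) ^+ 2 / (s ^+ 2 *+ 2))).
  have := @is_derive1_comp R expR _ x _ _ (is_derive_expR _) D.
  by move=> H; apply: is_derive_eq H _; rewrite mulrC.
apply: is_derive_eq (is_derZ (normal_peak s) De) _.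
by ring.
Qed.

Lemma normal_pdfN (x : R) : pdf (- x) = pdf x.
Proof. by rewrite normal_pdfE // /normal_fun !subr0 sqrrN. Qed.

Let I (r : R) : set R := `[(- r)%R, r]%classic.

Let mI r : measurable (I r : set (measurableTypeR R)).
Proof. exact: measurable_itv. Qed.

Let measurable_cont (U : set (measurableTypeR R)) (g : R -> R) : continuous g ->
  measurable_fun U (EFin \o g).
Proof.
move=> cg; apply: measurable_funTS; apply/measurable_EFinP.
exact: continuous_measurable_fun.
Qed.

Lemma integrable_normal_itv (g : R -> R) (r : R) : 0 < r -> continuous g ->
  gauss.-integrable (I r) (EFin \o g).
Proof.
move=> r0 cg; have rr : - r <= r by rewrite ltW // gtrN.
have [M HM] : exists M, forall x, x \in `[(- r)%R, r] -> `|g x| <= M.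
  have cn : continuous (fun x => `|g x|).
    by move=> x; exact: (continuous_comp (cg x) (@norm_continuous _ _ _)).
  have [c _ Hc] := EVT_max rr (continuous_subspaceT cn).
  by exists `|g c|.
apply/integrableP; split; first exact: measurable_cont.
apply: (@le_lt_trans _ _ (\int[gauss]_(x in I r) M%:E)%E).
  apply: ge0_le_integral => //=.
  apply: measurable_funTS; apply/measurable_EFinP.
  by apply: measurableT_comp => //; exact: continuous_measurable_fun.
rewrite integral_cst //.
have := probability_le1 gauss (mI r).
have M0 : 0 <= M by apply: le_trans (HM 0 _) => //; rewrite in_itv /= oppr_le0 !ltW.
move=> p1; apply: (@le_lt_trans _ _ (M%:E * 1)%E); last by rewrite mule1 ltry.
by apply: lee_wpmul2l; rewrite ?lee_fin.
Qed.

(** The moments are obtained from explicit primitives of [g x * pdf x] on [[-r, r]], with [r]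
    tending to infinity afterwards. *)
Lemma integral_normal_itv (g G : R -> R) (r : R) : 0 < r -> continuous g ->
  (forall x, is_derive x (1 : R) G (g x * pdf x)) ->
  \int[gauss]_(x in I r) g x = G r - G (- r).
Proof.
move=> r0 cg dG; have rr : - r < r by rewrite gtrN.
have cgp : continuous (fun x => g x * pdf x).
  by move=> x; exact: (continuousM (cg x) (@continuous_normal_pdf R 0 s s_neq0 x)).
rewrite /Rintegral (integral_normal_prob (mI r) (integrable_normal_itv r0 cg)).
suff -> : (\int[mu]_(x in I r) ((g x)%:E * (pdf x)%:E) = (G r)%:E - (G (- r))%:E)%E by [].
rewrite -(@continuous_FTC2 R (fun x => g x * pdf x) G (- r) r rr).
- by apply: eq_integral => x _; rewrite EFinM.
- exact: continuous_subspaceT.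
- split; first by move=> x _; case: (dG x).
  + exact: (cvg_at_right_filter (is_derive_continuous (dG (- r)))).
  + exact: (cvg_at_left_filter (is_derive_continuous (dG r))).
- by move=> x _; rewrite derive1E; case: (dG x).
Qed.

Let cX n : continuous (fun x : R => x ^+ n).
Proof. exact: exprn_continuous. Qed.

Let F4 (x : R) := - s ^+ 2 * ((x ^+ 3 + 3 * s ^+ 2 * x) * pdf x).

Let dF4 (x : R) : is_derive x (1 : R) F4 ((x ^+ 4 - 3 * s ^+ 4) * pdf x).
Proof.
have D3 := is_derX 2 x.
have D1 := is_derZ (3 * s ^+ 2) (is_derive_id x (1 : R)).
have D := is_derZ (- s ^+ 2) (is_derM (is_derD D3 D1) (is_derive_normal_pdf x)).
by apply: is_derive_eq D _; field.
Qed.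

Let pow4_itv (r : R) : 0 < r -> \int[gauss]_(x in I r) (x ^+ 4)
  = 3 * s ^+ 4 * fine (gauss (I r)) - 2 * s ^+ 2 * (r ^+ 3 + 3 * s ^+ 2 * r) * pdf r.
Proof.
move=> r0.
have cg : continuous (fun x : R => x ^+ 4 - 3 * s ^+ 4).
  move=> x; apply: (@cvgB _ _ _ _ _ (fun x : R => x ^+ 4) (cst (3 * s ^+ 4))).
    exact: cX.
  exact: cvg_cst.
have := integral_normal_itv r0 cg dF4.
rewrite (RintegralB (mI r) (integrable_normal_itv r0 (@cX 4))
  (integrable_normal_itv r0 (@cst_continuous _ _ (3 * s ^+ 4)))).
rewrite (Rintegral_cst _ (mI r)) => /eqP; rewrite subr_eq => /eqP ->.
by rewrite /F4 normal_pdfN; ring.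
Qed.

Let gauss_le1 r : 0 <= fine (gauss (I r)) <= 1.
Proof.
have p1 := probability_le1 gauss (mI r).
have f := fin_num_measure gauss _ (mI r).
by rewrite -!lee_fin fineK // p1 andbT.
Qed.

Let pow4_itv_le (r : R) : 0 < r -> \int[gauss]_(x in I r) (x ^+ 4) <= 3 * s ^+ 4.
Proof.
move=> r0; rewrite pow4_itv //; have /andP[g0 g1] := gauss_le1 r.
have s4 : 0 <= 3 * s ^+ 4 by rewrite mulr_ge0 // exprn_ge0 // ltW.
apply: (@le_trans _ _ (3 * s ^+ 4 * fine (gauss (I r)))); last by rewrite ler_piMr.
rewrite gerBl mulr_ge0 ?normal_pdf_ge0 // !mulr_ge0 ?exprn_ge0 ?addr_ge0 ?mulr_ge0 ?exprn_ge0 //;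
  exact: ltW.
Qed.

(** The truncated fourth moment is nonnegative and equals a bounded term minus a boundary term in
    [pdf r]: the decay of the density follows without estimating an exponential. *)
Let pdf_decay (r : R) : 0 < r -> 2 * s ^+ 2 * (r ^+ 3 * pdf r) <= 3 * s ^+ 4.
Proof.
move=> r0; have := pow4_itv r0.
have H : 0 <= \int[gauss]_(x in I r) (x ^+ 4).
  by apply: Rintegral_ge0 => x _; rewrite exprn_even_ge0.
have /andP[g0 g1] := gauss_le1 r.
have s4 : 0 <= 3 * s ^+ 4 by rewrite mulr_ge0 // exprn_ge0 // ltW.
move=> E; rewrite {}E subr_ge0 in H.
have H1 : 3 * s ^+ 4 * fine (gauss (I r)) <= 3 * s ^+ 4 by rewrite ler_piMr.
apply: le_trans (le_trans H H1).
rewrite mulrDr mulrDl -!mulrA lerDl.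
by rewrite !mulr_ge0 ?exprn_ge0 ?normal_pdf_ge0 // ltW.
Qed.

(** Monotone convergence over the intervals of radius [n + 1]. An upper bound suffices: the fourth
    moment serves for integrability, for the tails and for the third absolute moment. *)
Lemma normal_moment4 : (\int[gauss]_x (x ^+ 4)%:E <= (3 * s ^+ 4)%:E)%E.
Proof.
pose In (n : nat) := I n.+1%:R.
have ndI : nondecreasing_seq In.
  move=> n k nk; apply/subsetPset => x; rewrite /In /I /= !in_itv /= => /andP[x1 x2].
  have nk' : n.+1%:R <= k.+1%:R :> R by rewrite ler_nat ltnS.
  by rewrite (le_trans _ x1) ?lerN2 // (le_trans x2).
have UI : \bigcup_n In n = setT.
  apply/seteqP; split => // x _; exists (Num.truncn `|x|) => //=.
  rewrite /In /I /= in_itv /= -ler_norml ltW //.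
  exact: truncnS_gt.
have m4 (U : set (measurableTypeR R)) : measurable_fun U (fun x : R => (x ^+ 4)%:E).
  exact: (measurable_cont (@cX 4)).
have pos (n : nat) (x : R) : In n x -> (0 <= (x ^+ 4)%:E)%E.
  by move=> _; rewrite lee_fin exprn_even_ge0.
have cvI : (\int[gauss]_(x in In n) (x ^+ 4)%:E @[n --> \oo]
    --> \int[gauss]_(x in \bigcup_n In n) (x ^+ 4)%:E)%E.
  apply: ge0_nondecreasing_set_cvg_integral.
  - exact: ndI.
  - by move=> n; exact: mI.
  - by move=> n; exact: m4.
  - exact: pos.
move: cvI; rewrite UI => /cvg_lim <- //; apply: lime_le.
  apply: ereal_nondecreasing_is_cvgn => n k nk.
  apply: ge0_subset_integral => //; try exact: mI.
    by move=> x _; rewrite lee_fin exprn_even_ge0.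
  by apply/subsetPset; exact: ndI.
apply: nearW => n; have n0 : 0 < n.+1%:R :> R by rewrite ltr0n.
have fI := integrable_fin_num (mI _) (integrable_normal_itv n0 (@cX 4)).
by rewrite -(fineK fI) lee_fin; exact: (pow4_itv_le n0).
Qed.

Let integrable4 : gauss.-integrable setT (EFin \o (fun x : R => x ^+ 4)).
Proof.
apply/integrableP; split; first exact: (measurable_cont (@cX 4)).
apply: le_lt_trans (ltry (3 * s ^+ 4)); apply: le_trans normal_moment4.
rewrite le_eqVlt; apply/orP; left; apply/eqP; apply: eq_integral => x _.
by rewrite /= ger0_norm // exprn_even_ge0.
Qed.

Lemma integrable_normal_pow4 (g : R -> R) (K : R) : measurable_fun setT g ->
  (forall x, `|g x| <= K * (1 + x ^+ 4)) -> gauss.-integrable setT (EFin \o g).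
Proof.
move=> mg HK.
have K0 : 0 <= K.
  by have := HK 0; rewrite expr0n /= addr0 mulr1; apply: le_trans.
apply: (@le_integrable _ _ R gauss setT measurableT _
   (EFin \o (fun x => K * (1 + x ^+ 4)))).
- exact/measurable_EFinP.
- move=> x _; rewrite /= lee_fin [X in _ <= X]ger0_norm //.
  by rewrite mulr_ge0 // addr_ge0 // exprn_even_ge0.
- have i1 : gauss.-integrable setT (EFin \o cst 1) by exact: finite_measure_integrable_cst.
  exact: (integrableZl measurableT K (integrableD measurableT i1 integrable4)).
Qed.

(* The tails are controlled by the fourth moment. *)
Lemma normal_integral0 (g G : R -> R) (K : R) : continuous g ->
  (forall x, is_derive x (1 : R) G (g x * pdf x)) ->
  (forall x, `|g x| <= K * (1 + x ^+ 2)) ->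
  (forall r, 1 <= r -> `|G r - G (- r)| <= K / r) ->
  \int[gauss]_x g x = 0.
Proof.
move=> cg dG bg bG.
have K0 : 0 <= K by have := bg 0; rewrite expr0n /= addr0 mulr1; apply: le_trans.
have ig : gauss.-integrable setT (EFin \o g).
  apply: (@integrable_normal_pow4 _ (2 * K)); first exact: continuous_measurable_fun.
  move=> x; apply: (le_trans (bg x)); rewrite (mulrC 2) -mulrA ler_wpM2l //.
  by have := sqr_ge0 (x ^+ 2 - 1); have := sqr_ge0 (x ^+ 2); lra.
(* Outside [[-r, r]] a quadratic growth is dominated by the fourth power with a gain [1 / r]. *)
have tg r x : 1 <= r -> r <= `|x| -> `|g x| <= 2 * K / r * x ^+ 4.
  move=> r1 rx; apply: (le_trans (bg x)); have r0 := lt_le_trans ltr01 r1.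
  have -> : 2 * K / r * x ^+ 4 = K * (2 * x ^+ 4 / r) by ring.
  apply: ler_wpM2l => //; rewrite ler_pdivlMr //.
  have [-> ->] : x ^+ 2 = `|x| ^+ 2 /\ x ^+ 4 = `|x| ^+ 4.
    by rewrite -!normrX !ger0_norm ?exprn_even_ge0.
  have y1 := le_trans r1 rx; move: `|x| rx y1 => y ry y1.
  apply: (@le_trans _ _ ((1 + y ^+ 2) * y)).
    by rewrite ler_wpM2l // addr_ge0 // sqr_ge0.
  have y2 : 1 <= y ^+ 2 by rewrite exprn_ege1.
  apply: (@le_trans _ _ (2 * y ^+ 2 * y ^+ 2)); last by rewrite -mulrA -exprD.
  apply: ler_pM; rewrite ?addr_ge0 ?sqr_ge0 ?(le_trans ler01) //; first by lra.
  by rewrite expr2 ler_peMr // (le_trans ler01).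
pose C := K + 2 * K * (3 * s ^+ 4).
suff H r : 1 <= r -> `|\int[gauss]_x g x| <= C / r.
  apply/eqP; rewrite -normr_le0; apply/ler_addgt0Pl => e e0.
  rewrite addr0; pose r := Num.max 1 (C / e).
  have r1 : 1 <= r by rewrite le_max lexx.
  apply: (le_trans (H r r1)); rewrite ler_pdivrMr ?(lt_le_trans ltr01) //.
  by rewrite mulrC -ler_pdivrMr // le_max lexx orbT.
move=> r1; have r0 : 0 < r := lt_le_trans ltr01 r1.
have mC : measurable (~` I r : set (measurableTypeR R)) by exact: measurableC.
have sub4 (U : set (measurableTypeR R)) : measurable U ->
    gauss.-integrable U (EFin \o (fun x : R => x ^+ 4)).
  by move=> mU; exact: integrableS measurableT mU (@subsetT _ _) integrable4.
have subg (U : set (measurableTypeR R)) : measurable U -> gauss.-integrable U (EFin \o g).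
  by move=> mU; exact: integrableS measurableT mU (@subsetT _ _) ig.
have split (h : R -> R) : gauss.-integrable setT (EFin \o h) ->
    \int[gauss]_x h x = \int[gauss]_(x in I r) h x + \int[gauss]_(x in ~` I r) h x.
  move=> ih; rewrite -(Rintegral_setU (mI r) mC) ?setUv //.
  by apply/disj_setPS => x [].
rewrite (split g ig) (integral_normal_itv r0 cg dG).
have E4 : \int[gauss]_(x in ~` I r) (x ^+ 4) <= 3 * s ^+ 4.
  have f4 := integrable_fin_num measurableT integrable4.
  have := normal_moment4; rewrite -(fineK f4) lee_fin; apply: le_trans.
  rewrite -/(Rintegral gauss setT (fun x : R => x ^+ 4)) (split _ integrable4) lerDr.
  by apply: Rintegral_ge0 => x _; rewrite exprn_even_ge0.
have tail : `|\int[gauss]_(x in ~` I r) g x| <= 2 * K / r * (3 * s ^+ 4).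
  apply: (le_trans (le_normr_Rintegral mC (subg _ mC))).
  apply: (@le_trans _ _ (\int[gauss]_(x in ~` I r) (2 * K / r * x ^+ 4))).
    apply: le_Rintegral => //.
    - exact: (integrable_norm (subg _ mC)).
    - exact: (integrableZl mC (2 * K / r) (sub4 _ mC)).
    - move=> x xI; apply: tg => //; rewrite leNgt; apply/negP => xr; apply: xI.
      by rewrite /I /= in_itv /= -ler_norml ltW.
  rewrite (RintegralZl _ mC (sub4 _ mC)); apply: ler_wpM2l => //.
  by rewrite divr_ge0 ?mulr_ge0 // ltW.
apply: (le_trans (ler_normD _ _)).
apply: (le_trans (lerD (bG r r1) tail)).
by rewrite le_eqVlt /C; apply/orP; left; apply/eqP; ring.
Qed.

Lemma normal_mean : \int[gauss]_x x = 0.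
Proof.
have s2 : s ^+ 2 != 0 by rewrite expf_neq0.
apply: (@normal_integral0 id (fun x => - s ^+ 2 * pdf x) 1).
- by move=> x; exact: cvg_id.
- move=> x; apply: is_derive_eq (is_derZ _ (is_derive_normal_pdf x)) _.
  by rewrite /=; field.
- move=> x; rewrite mul1r /= -(ger0_norm (sqr_ge0 x)) normrX.
  by have := sqr_ge0 (`|x| - 1); have := normr_ge0 x; have := sqr_ge0 `|x|; lra.
- move=> r r1; rewrite normal_pdfN subrr normr0 mul1r invr_ge0.
  exact: le_trans ler01 r1.
Qed.

Lemma normal_moment2 : \int[gauss]_x (x ^+ 2) = s ^+ 2.
Proof.
have s2 : s ^+ 2 != 0 by rewrite expf_neq0.
have cg : continuous (fun x : R => x ^+ 2 - s ^+ 2).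
  move=> x; apply: (@cvgB _ _ _ _ _ (fun x : R => x ^+ 2) (cst (s ^+ 2))).
    exact: cX.
  exact: cvg_cst.
have pow4E (x : R) : x ^+ 4 = x ^+ 2 * x ^+ 2 by rewrite -exprD.
have H : \int[gauss]_x (x ^+ 2 - s ^+ 2) = 0.
  (* One constant for both hypotheses: [1 + s ^+ 2] is for the growth of the integrand and
     [3 * s ^+ 4], from [pdf_decay], for the boundary terms. *)
  apply: (@normal_integral0 (fun x => x ^+ 2 - s ^+ 2) (fun x => - s ^+ 2 * (x * pdf x))
    (1 + s ^+ 2 + 3 * s ^+ 4)).
  - exact: cg.
  - move=> x; apply: is_derive_eq (is_derZ _ (is_derM (is_derive_id x (1 : R))
      (is_derive_normal_pdf x))) _.
    by field.
  - move=> x; apply: (le_trans (ler_normB _ _)); rewrite !ger0_norm ?sqr_ge0 //.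
    have := mulr_ge0 (sqr_ge0 s) (sqr_ge0 x).
    have := mulr_ge0 (sqr_ge0 (s ^+ 2)) (addr_ge0 ler01 (sqr_ge0 x)).
    by rewrite !mulrDl !mulrDr; lra.
  - move=> r r1; have r0 : 0 < r := lt_le_trans ltr01 r1.
    have -> : - s ^+ 2 * (r * pdf r) - - s ^+ 2 * (- r * pdf (- r))
       = - (2 * s ^+ 2 * (r * pdf r)) by rewrite normal_pdfN; ring.
    rewrite normrN ger0_norm; last first.
      by rewrite !mulr_ge0 ?sqr_ge0 ?normal_pdf_ge0 // ltW.
    rewrite ler_pdivlMr //; apply: (@le_trans _ _ (3 * s ^+ 4)); last first.
      by rewrite lerDr addr_ge0 // sqr_ge0.
    apply: le_trans (pdf_decay r0).
    have -> : 2 * s ^+ 2 * (r * pdf r) * r = 2 * s ^+ 2 * (r ^+ 2 * pdf r) by ring.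
    apply: ler_wpM2l; first by rewrite mulr_ge0 // sqr_ge0.
    apply: ler_wpM2r; first exact: normal_pdf_ge0.
    by rewrite ler_weXn2l.
have i2 : gauss.-integrable setT (EFin \o (fun x : R => x ^+ 2)).
  apply: (@integrable_normal_pow4 _ 1).
    exact: continuous_measurable_fun.
  move=> x; rewrite mul1r ger0_norm ?sqr_ge0 // pow4E.
  have := sqr_ge0 x; move: (x ^+ 2) => y y0; have := sqr_ge0 (y - 1); nra.
have i0 : gauss.-integrable setT (EFin \o cst (s ^+ 2)).
  exact: finite_measure_integrable_cst.
move: H; rewrite (RintegralB measurableT i2 i0) (Rintegral_cst _ measurableT).
by rewrite [X in fine X](@probability_setT _ _ R gauss) mulr1 => /eqP; rewrite subr_eq0 => /eqP.
Qed.

End GaussianMoments.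

(** * Wiener increments *)

Section Independence.
Context {R : realType} {d1 d2 : measure_display}.
Context {Omega : measurableType d1} {T : measurableType d2}.
Variables (P : probability Omega R) (gam : probability (measurableTypeR R) R).
Variables (Y : Omega -> T) (Z : Omega -> measurableTypeR R).
Hypotheses (mY : measurable_fun setT Y) (mZ : measurable_fun setT Z).
Hypothesis indep : forall A B, measurable A -> measurable B ->
  P (Y @^-1` A `&` Z @^-1` B) = (P (Y @^-1` A) * gam B)%E.

(** By [indep] the joint law of [(Y, Z)] agrees with the product of the law of [Y] and [gam] on
    rectangles, hence everywhere, and Fubini's theorem applies. Integrability is asked of the
    product and of [g] only. *)
Lemma independent_integral (h : T -> R) (g : measurableTypeR R -> R) :
  measurable_fun setT h -> measurable_fun setT g ->
  P.-integrable setT (fun w => (h (Y w) * g (Z w))%:E) ->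
  gam.-integrable setT (EFin \o g) ->
  \int[P]_w (h (Y w) * g (Z w)) = \int[P]_w h (Y w) * \int[gam]_z g z.
Proof.
move=> mh mg ihg ig.
pose Ym : {mfun Omega >-> T} := HB.pack Y (isMeasurableFun.Build _ _ _ _ Y mY).
have mYZ : measurable_fun setT (fun w => (Y w, Z w)) by exact: measurable_fun_pair.
pose YZ : {mfun Omega >-> (T * measurableTypeR R)%type} :=
  HB.pack (fun w => (Y w, Z w)) (isMeasurableFun.Build _ _ _ _ _ mYZ).
pose m1 := distribution P Ym.
pose m12 := distribution P YZ.
have E X : measurable X -> (m1 \x gam)%E X = m12 X.
  apply: product_measure_unique => A B mA mB.
  by rewrite /m12 /m1 /distribution /pushforward /= -indep.
pose f (z : T * measurableTypeR R) := (h z.1 * g z.2)%:E.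
have mf : measurable_fun setT f.
  apply/measurable_EFinP; apply: measurable_funM.
    by apply: measurableT_comp => //; exact: measurable_fst.
  by apply: measurableT_comp => //; exact: measurable_snd.
have i12 : m12.-integrable setT f.
  apply: integrable_pushforward => //.
have i1 : (m1 \x gam)%E.-integrable setT f.
  apply/integrableP; split => //; have /integrableP[_ fin] := i12.
  rewrite (@eq_measure_integral _ _ _ setT m12); first exact: fin.
  by move=> A mA _; exact: E.
have -> : \int[P]_w (h (Y w) * g (Z w)) = fine (\int[m1 \x gam]_z f z)%E.
  congr fine; rewrite (@eq_measure_integral _ _ _ setT m12); last first.
    by move=> A mA _; exact: E.
  by rewrite /m12 integral_distribution.
rewrite -integral12_prod_meas1 //.
have ig' := integrable_fin_num measurableT ig.
pose c := \int[gam]_z g z.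
have Fc t : fubini_F gam f t = (h t * c)%:E.
  rewrite /fubini_F /f /=; under eq_integral do rewrite EFinM.
  by rewrite integralZl // EFinM /c /Rintegral fineK.
under eq_integral do rewrite Fc.
(* If the mean [c] of [g] is zero, both sides vanish whether or not [h (Y w)] is integrable.
   Otherwise Fubini's theorem makes [h * c] integrable, and [c] can be divided out. *)
have [c0|c0] := eqVneq c 0.
  rewrite -/c c0 mulr0; under eq_integral do rewrite mulr0.
  by rewrite integral0.
have ih : P.-integrable setT (fun w => (h (Y w))%:E).
  have mhc : measurable_fun setT (fun t => (h t * c)%:E).
    by apply/measurable_EFinP; apply: measurable_funM.
  have ihc : m1.-integrable setT (fun t => (h t * c)%:E).
    have := integrable_fubini_F i1.
    by rewrite (_ : fubini_F gam f = (fun t => (h t * c)%:E)) //; apply/funext.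
  have /integrableP[_ fin] := ihc.
  have ihcP : P.-integrable setT (fun w => (h (Y w) * c)%:E).
    apply/integrableP; split; first exact: measurableT_comp mhc mY.
    move: fin; rewrite /m1 ge0_integral_distribution //.
    exact: measurableT_comp.
  have := integrableZr measurableT c^-1 ihcP.
  by under eq_fun do rewrite -EFinM mulfK //.
rewrite -RintegralZr //; congr fine.
rewrite /m1 integral_distribution //.
  by apply/measurable_EFinP; apply: measurable_funM.
have := integrableZr measurableT c ih.
by under eq_fun do rewrite -EFinM.
Qed.

End Independence.

Section IndependentPair.
Context {R : realType} {d1 d2 : measure_display}.
Context {Omega : measurableType d1} {T : measurableType d2}.
Variables (P : probability Omega R) (gV gU : probability (measurableTypeR R) R).
Variables (Y : Omega -> T) (V U : Omega -> measurableTypeR R).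
Hypotheses (mY : measurable_fun setT Y) (mV : measurable_fun setT V)
  (mU : measurable_fun setT U).
Hypothesis indep : forall A B C, measurable A -> measurable B -> measurable C ->
  P (Y @^-1` A `&` (V @^-1` B `&` U @^-1` C)) = (P (Y @^-1` A) * (gV B * gU C))%E.

(** Both sides are finite measures in [A], the law of [(Y, V)] under [P] restricted to a preimage
    under [U] and a multiple of that law under [P]; they agree on rectangles. This prepares the
    means of products of two distinct increments. *)
Lemma independent_pair A C : measurable A -> measurable C ->
  P ((fun w => (Y w, V w)) @^-1` A `&` U @^-1` C)
  = (P ((fun w => (Y w, V w)) @^-1` A) * gU C)%E.
Proof.
move=> mA mC.
have mYV : measurable_fun setT (fun w => (Y w, V w)) by exact: measurable_fun_pair.
pose YV : {mfun Omega >-> (T * measurableTypeR R)%type} :=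
  HB.pack (fun w => (Y w, V w)) (isMeasurableFun.Build _ _ _ _ _ mYV).
have mUC : measurable (U @^-1` C) by rewrite -[_ @^-1` _]setTI; exact: mU.
have gC0 : 0 <= fine (gU C) by exact: fine_ge0.
pose ma0 : {measure set (T * measurableTypeR R)%type -> \bar R} := pushforward (mrestr P mUC) YV.
pose ma := ma0 mYV.
pose mb : {measure set (T * measurableTypeR R)%type -> \bar R} :=
  mscale (NngNum gC0) (distribution P YV).
have fC : gU C \is a fin_num by exact: fin_num_measure.
have H : ma A = mb A.
  apply: (@measure_unique _ R _ [set B `*` D | B in measurable & D in measurable]
    (fun=> setT)) => //.
  - exact: measurable_prod_measurableType.
  - move=> _ _ [B1 mB1 [D1 mD1 <-]] [B2 mB2 [D2 mD2 <-]].
    by exists (B1 `&` B2); [exact: measurableI|]; exists (D1 `&` D2);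
      [exact: measurableI|rewrite setXI].
  - by move=> _; exists setT => //; exists setT => //; rewrite setXTT.
  - by apply/seteqP; split => // x _; exists 0%N.
  - move=> _ [B mB [D mD <-]].
    rewrite /ma /ma0 /mb /= /mrestr /mscale /distribution /pushforward /= fineK //.
    have E : (fun w => (Y w, V w)) @^-1` (B `*` D) = Y @^-1` B `&` V @^-1` D by [].
    rewrite E -setIA (indep mB mD mC) muleA muleC; congr (_ * _)%E.
    have := indep mB mD measurableT.
    by rewrite preimage_setT setIT probability_setT mule1.
  - by move=> k; rewrite /ma /ma0 /= /pushforward /mrestr /=; apply: le_lt_trans (ltry 1);
      apply: probability_le1; apply: measurableI => //; rewrite preimage_setT.
move: H; rewrite /ma /ma0 /mb /= /mrestr /mscale /distribution /pushforward /= fineK // => ->.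
by rewrite muleC.
Qed.

End IndependentPair.

Section Increments.
Context {R : realType} {disp : measure_display} {Omega : measurableType disp}.
Variables (P : probability Omega R) (F : R -> set_system Omega) (m : nat)
  (W : 'I_m -> R -> Omega -> R).
Hypotheses (filt : filtration F) (wien : wiener P F W).
Implicit Types (s t : R) (G H : Omega -> R) (l k : 'I_m).

(** Measurability for the sigma-algebra [F s], which the generated type turns into a measurable
    space; [F s] being already a sigma-algebra, nothing is added ([adaptedP]). *)
Definition adapted s H : Prop :=
  measurable_fun [set: g_sigma_algebraType (F s)] (H : g_sigma_algebraType (F s) -> R).

Lemma adaptedP s H : 0 <= s ->
  adapted s H <-> forall B, measurable (B : set (measurableTypeR R)) -> F s (H @^-1` B).
Proof.
move=> s0; have [sF _ _] := filt; have E := sigma_algebra_id (sF s s0).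
split=> [mH B mB|mH _ B mB].
  have := mH measurableT B mB; rewrite setTI /measurable /=.
  by rewrite E.
by rewrite setTI /measurable /= E; exact: mH.
Qed.

Lemma adaptedW s t H : 0 <= s -> s <= t -> adapted s H -> adapted t H.
Proof.
move=> s0 st /(adaptedP _ s0) mH; apply/adaptedP; first exact: le_trans st.
by move=> B mB; have [_ _ mono] := filt; exact: (mono _ _ s0 st _ (mH _ mB)).
Qed.

Lemma adapted_measurable s H : 0 <= s -> adapted s H -> measurable_fun setT H.
Proof.
move=> s0 /(adaptedP _ s0) mH _ B mB; rewrite setTI.
by have [_ sub _] := filt; exact: (sub s s0 _ (mH _ mB)).
Qed.

Lemma adapted_wiener l t : 0 <= t -> adapted t (W l t).
Proof.
by move=> t0; apply/adaptedP => // B mB; have [aW _ _ _] := wien; exact: aW.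
Qed.

Variables (s delta : R).
Hypotheses (s_ge0 : 0 <= s) (delta_gt0 : 0 < delta).

Definition increment l (w : Omega) : R := W l (s + delta) w - W l s w.

Let sd : s < s + delta. Proof. by rewrite ltrDl. Qed.

Notation gam := (normal_prob 0 (Num.sqrt delta) : probability (measurableTypeR R) R).

Let sq_gt0 : 0 < Num.sqrt delta. Proof. by rewrite sqrtr_gt0. Qed.

Lemma measurable_increment l : measurable_fun setT (increment l).
Proof.
apply: measurable_funB.
  by apply: (adapted_measurable _ (adapted_wiener l _)); exact: le_trans s_ge0 (ltW sd).
exact: (adapted_measurable s_ge0 (adapted_wiener l s_ge0)).
Qed.

Notation T := (g_sigma_algebraType (F s)).

(** The identity into [Omega] equipped with [F s]: independence of this random variable is
    independence of the past up to time [s]. *)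
Let Y : Omega -> T := fun w => w.

Let FsE A : measurable (A : set T) = F s A.
Proof. by have [sF _ _] := filt; rewrite /measurable /= (sigma_algebra_id (sF s s_ge0)). Qed.

Let mY : measurable_fun setT Y.
Proof.
move=> _ A mA; rewrite setTI; have [_ sub _] := filt.
by apply: (sub s s_ge0); rewrite -FsE.
Qed.

Let rectangle (A : set T) (B : 'I_m -> set (measurableTypeR R)) : measurable A ->
  (forall l, measurable (B l)) ->
  P (Y @^-1` A `&` \bigcap_(l in [set: 'I_m]) (increment l @^-1` B l))
  = (P (Y @^-1` A) * \prod_(l < m) gam (B l))%E.
Proof.
move=> mA mB; have [_ _ _ H] := wien.
have := H s (s + delta) A B s_ge0 sd _ mB; rewrite addrAC subrr add0r; apply.
by rewrite -FsE.
Qed.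

Let independent1 l (A : set T) (B : set (measurableTypeR R)) : measurable A ->
  measurable B ->
  P (Y @^-1` A `&` increment l @^-1` B) = (P (Y @^-1` A) * gam B)%E.
Proof.
move=> mA mB; pose Bs k := if k == l then B else setT.
have BsE : Bs l = B by rewrite /Bs eqxx.
have := @rectangle A Bs mA; rewrite (bigD1 l) //= BsE big1 ?mule1; last first.
  by move=> k kl; rewrite /Bs (negbTE kl) probability_setT.
have -> : \bigcap_(k in [set: 'I_m]) (increment k @^-1` Bs k) = increment l @^-1` B.
  apply/seteqP; split => w.
    by move=> /(_ l Logic.I); rewrite /Bs eqxx.
  by move=> wB k _; rewrite /Bs; case: eqVneq => [->|].
by apply => k; rewrite /Bs; case: ifP.
Qed.

Let independent2 l k (A : set T) (B C : set (measurableTypeR R)) : l != k ->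
  measurable A -> measurable B -> measurable C ->
  P (Y @^-1` A `&` (increment l @^-1` B `&` increment k @^-1` C))
  = (P (Y @^-1` A) * (gam B * gam C))%E.
Proof.
move=> lk mA mB mC; pose Bs j := if j == l then B else if j == k then C else setT.
have := @rectangle A Bs mA; rewrite (bigD1 l) //= (bigD1 k) //=; last by rewrite eq_sym.
rewrite big1 ?mule1; last first.
  by move=> j /andP[jl jk]; rewrite /Bs (negbTE jl) (negbTE jk) probability_setT.
have kl : (k == l) = false by rewrite eq_sym; exact: negbTE.
have -> : Bs l = B by rewrite /Bs eqxx.
have -> : Bs k = C by rewrite /Bs kl eqxx.
have -> : \bigcap_(j in [set: 'I_m]) (increment j @^-1` Bs j)
    = increment l @^-1` B `&` increment k @^-1` C.
  apply/seteqP; split => w.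
    move=> H; split; first by have := H l Logic.I; rewrite /Bs eqxx.
    by have := H k Logic.I; rewrite /Bs eqxx kl.
  move=> [wB wC] j _; rewrite /Bs; case: eqVneq => [->//|_].
  by case: eqVneq => [->|].
by apply => j; rewrite /Bs; case: ifP => // _; case: ifP.
Qed.

Let law l (f : measurableTypeR R -> \bar R) : measurable_fun setT f ->
  (forall x, 0 <= f x)%E -> (\int[P]_w f (increment l w) = \int[gam]_x f x)%E.
Proof.
move=> mf f0.
pose Z0 : Omega -> measurableTypeR R := increment l.
have mZ0 : measurable_fun setT Z0 by exact: measurable_increment.
pose Z : {mfun Omega >-> measurableTypeR R} :=
  HB.pack Z0 (isMeasurableFun.Build _ _ _ _ Z0 mZ0).
rewrite -(@ge0_integral_distribution _ _ _ _ _ P Z f mf f0).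
apply: eq_measure_integral => A mA _.
have := independent1 l (@measurableT _ T) mA.
by rewrite preimage_setT setTI probability_setT mul1e.
Qed.

Let m4 : measurable_fun setT (fun x : measurableTypeR R => (x ^+ 4)%:E).
Proof. by apply/measurable_EFinP; apply: measurable_funX. Qed.

Lemma increment4_integrable l : P.-integrable setT (fun w => (increment l w ^+ 4)%:E).
Proof.
apply/integrableP; split.
  exact: (measurableT_comp m4 (measurable_increment l)).
apply: le_lt_trans (ltry (3 * Num.sqrt delta ^+ 4)).
apply: le_trans (normal_moment4 sq_gt0).
rewrite -(law l m4) => [|x]; last by rewrite lee_fin exprn_even_ge0.
rewrite le_eqVlt; apply/orP; left; apply/eqP; apply: eq_integral => w _.
by rewrite /= ger0_norm // exprn_even_ge0.
Qed.

Lemma increment4_le l : \int[P]_w (increment l w ^+ 4) <= 3 * delta ^+ 2.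
Proof.
have f4 := integrable_fin_num measurableT (increment4_integrable l).
rewrite -lee_fin fineK // (law l m4) => [|x]; last by rewrite lee_fin exprn_even_ge0.
have := normal_moment4 sq_gt0.
by rewrite (_ : Num.sqrt delta ^+ 4 = delta ^+ 2) // (exprM _ 2 2) sqr_sqrtr ?ltW.
Qed.

(** A class closed under linear combinations and integrable by the fourth moments. It contains the
    products of bounded past factors with at most two increments, as well as the absolute cubes of
    increments. *)
Definition dominated G : Prop := measurable_fun setT G /\
  exists K, forall w, `|G w| <= K * (1 + \sum_l increment l w ^+ 4).

Lemma dominated_integrable G : dominated G -> P.-integrable setT (EFin \o G).
Proof.
move=> [mG [K HK]].
apply: (@le_integrable _ _ R P setT measurableT _
   (fun w => (`|K| * (1 + \sum_l increment l w ^+ 4))%:E)).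
- exact/measurable_EFinP.
- move=> w _; rewrite /= lee_fin; apply: (le_trans (HK w)).
  apply: (le_trans (ler_norm _)); rewrite !normrM.
  by rewrite normr_id.
- under eq_fun do rewrite EFinM.
  apply: (integrableZl measurableT `|K|).
  under eq_fun do rewrite EFinD.
  have i1 : P.-integrable setT (EFin \o cst 1) by exact: finite_measure_integrable_cst.
  apply: (integrableD measurableT i1).
  have := integrable_sum measurableT (index_enum 'I_m)
    (P := predT) (fun l _ => increment4_integrable l).
  by under eq_fun do rewrite sumEFin.
Qed.

Lemma bounded_dominated G M : measurable_fun setT G -> (forall w, `|G w| <= M) ->
  dominated G.
Proof.
move=> mG HM; split => //; exists M => w.
have M0 : 0 <= M by apply: le_trans (HM w).
apply: (le_trans (HM w)); rewrite ler_peMr // lerDl.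
by apply: sumr_ge0 => l _; rewrite exprn_even_ge0.
Qed.

Lemma dominatedD G H : dominated G -> dominated H -> dominated (fun w => G w + H w).
Proof.
move=> [mG [K HK]] [mH [L HL]]; split; first exact: measurable_funD.
exists (K + L) => w; rewrite mulrDl.
by apply: (le_trans (ler_normD _ _)); exact: lerD.
Qed.

Lemma dominatedZ (c : R) G : dominated G -> dominated (fun w => c * G w).
Proof.
move=> [mG [K HK]]; split; first by apply: measurable_funM => //; exact: measurable_cst.
by exists (`|c| * K) => w; rewrite normrM -mulrA ler_wpM2l.
Qed.

Lemma dominated_sum (I : Type) (r : seq I) (G : I -> Omega -> R) :
  (forall i, dominated (G i)) -> dominated (fun w => \sum_(i <- r) G i w).
Proof.
move=> dG; elim: r => [|i r IH].
  under eq_fun do rewrite big_nil.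
  by apply: (@bounded_dominated _ 0) => [|w]; rewrite ?normr0 //; exact: measurable_cst.
by under eq_fun do rewrite big_cons; exact: dominatedD.
Qed.

Lemma expectedD G H : dominated G -> dominated H ->
  \int[P]_w (G w + H w) = \int[P]_w G w + \int[P]_w H w.
Proof.
move=> /dominated_integrable iG /dominated_integrable iH.
exact: (RintegralD measurableT iG iH).
Qed.

Lemma expectedZ (c : R) G : dominated G -> \int[P]_w (c * G w) = c * \int[P]_w G w.
Proof. by move=> /dominated_integrable iG; exact: (RintegralZl _ measurableT iG). Qed.

Lemma expected_sum (I : Type) (r : seq I) (G : I -> Omega -> R) :
  (forall i, dominated (G i)) ->
  \int[P]_w (\sum_(i <- r) G i w) = \sum_(i <- r) \int[P]_w G i w.
Proof.
move=> dG; elim: r => [|i r IH].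
  rewrite big_nil; under eq_Rintegral do rewrite big_nil.
  by rewrite (Rintegral_cst _ measurableT) mul0r.
rewrite big_cons; under eq_Rintegral do rewrite big_cons.
by rewrite expectedD ?IH //; exact: dominated_sum.
Qed.

Lemma expected_bound G (M : R) : measurable_fun setT G -> (forall w, `|G w| <= M) ->
  `|\int[P]_w G w| <= M.
Proof.
move=> mG HM; have dG := bounded_dominated mG HM.
apply: (le_trans (le_normr_Rintegral measurableT (dominated_integrable dG))).
have <- : \int[P]_w M = M.
  by rewrite (Rintegral_cst _ measurableT) [X in fine X]probability_setT mulr1.
apply: le_Rintegral => //.
- exact: (integrable_norm (dominated_integrable dG)).
- exact: finite_measure_integrable_cst.
Qed.

Let sum4_ge l w : increment l w ^+ 4 <= \sum_k increment k w ^+ 4.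
Proof.
rewrite (bigD1 l) //= lerDl; apply: sumr_ge0 => k _.
by rewrite exprn_even_ge0.
Qed.

Let abs_le4 (x : R) : `|x| <= 1 + x ^+ 4.
Proof.
have -> : x ^+ 4 = `|x| ^+ 4 by rewrite -normrX ger0_norm // exprn_even_ge0.
have : 0 <= `|x| by []. move: `|x| => y y0.
by have := sqr_ge0 (y ^+ 2 - 1); have := sqr_ge0 (y - 1); nra.
Qed.

Let sqr_le4 (x : R) : x ^+ 2 <= 1 + x ^+ 4.
Proof.
by have := sqr_ge0 (x ^+ 2 - 1); rewrite sqrrB1 -exprM => H; have := sqr_ge0 x; lra.
Qed.

Let mul_le4 (a b S : R) : a ^+ 4 <= S -> b ^+ 4 <= S -> `|a * b| <= 1 + S.
Proof.
have := sqr_le4 a; have := sqr_le4 b.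
have := sqr_ge0 (a - b); have := sqr_ge0 (a + b).
rewrite ler_norml sqrrD sqrrB; move: (a ^+ 4) (b ^+ 4) (a ^+ 2) (b ^+ 2) (a * b).
by move=> a4 b4 a2 b2 ab *; apply/andP; split; lra.
Qed.

Section BoundedFactor.
Variables (H : Omega -> R) (M : R).
Hypotheses (adH : adapted s H) (bH : forall w, `|H w| <= M).

Let mH : measurable_fun setT H := adapted_measurable s_ge0 adH.

Lemma dominated_increment l : dominated (fun w => H w * increment l w).
Proof.
split; first exact: (measurable_funM mH (measurable_increment l)).
exists M => w; rewrite normrM; apply: ler_pM => //.
by apply: (le_trans (abs_le4 _)); rewrite lerD2l.
Qed.

Lemma dominated_increment2 l k : dominated (fun w => H w * increment l w * increment k w).
Proof.
split.
  exact: (measurable_funM (measurable_funM mH (measurable_increment l)) (measurable_increment k)).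
exists M => w; rewrite -mulrA normrM; apply: ler_pM => //.
exact: mul_le4 (sum4_ge l w) (sum4_ge k w).
Qed.

Lemma expected_increment l : \int[P]_w (H w * increment l w) = 0.
Proof.
rewrite (@independent_integral _ _ _ _ T P gam Y (increment l) mY (measurable_increment l)
  (@independent1 l) H id adH _ (dominated_integrable (dominated_increment l))).
- by rewrite (normal_mean sq_gt0) mulr0.
- exact: measurable_id.
- apply: (@integrable_normal_pow4 _ _ sq_gt0 _ 1); first exact: measurable_id.
  by move=> x; rewrite mul1r.
Qed.

Lemma expected_increment_sqr l :
  \int[P]_w (H w * increment l w * increment l w) = delta * \int[P]_w H w.
Proof.
have i2 : P.-integrable setT (fun w => (H (Y w) * (increment l w ^+ 2))%:E).
  have := dominated_integrable (dominated_increment2 l l).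
  by under eq_fun do rewrite /= -mulrA -expr2.
have m2 : measurable_fun setT (fun x : measurableTypeR R => x ^+ 2).
  exact: measurable_funX.
transitivity (\int[P]_w (H (Y w) * increment l w ^+ 2)).
  by apply: eq_Rintegral => w _; rewrite -mulrA -expr2.
rewrite (@independent_integral _ _ _ _ T P gam Y (increment l) mY (measurable_increment l)
  (@independent1 l) H (fun x => x ^+ 2) adH m2 i2).
- by rewrite (normal_moment2 sq_gt0) sqr_sqrtr ?(ltW delta_gt0) // mulrC.
- apply: (@integrable_normal_pow4 _ _ sq_gt0 _ 1) => // x.
  by rewrite mul1r ger0_norm ?sqr_ge0.
Qed.

Lemma expected_increment_cross l k : l != k ->
  \int[P]_w (H w * increment l w * increment k w) = 0.
Proof.
move=> lk; pose h (z : T * measurableTypeR R) := H z.1 * z.2.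
have mh : measurable_fun setT h.
  apply: measurable_funM; last exact: measurable_snd.
  by apply: measurableT_comp => //; exact: measurable_fst.
have mYl : measurable_fun setT (fun w => (Y w, increment l w)).
  by apply: measurable_fun_pair => //; exact: measurable_increment.
have ind A C (mA : measurable A) (mC : measurable C) :=
  @independent_pair _ _ _ _ T P gam gam Y (increment l) (increment k) mY
   (measurable_increment l) (measurable_increment k)
   (fun A B C => @independent2 l k A B C lk) A C mA mC.
rewrite (@independent_integral _ _ _ _ _ P gam (fun w => (Y w, increment l w)) (increment k)
  mYl (measurable_increment k) ind h id mh _ (dominated_integrable (dominated_increment2 l k))).
- by rewrite (normal_mean sq_gt0) mulr0.
- exact: measurable_id.
- apply: (@integrable_normal_pow4 _ _ sq_gt0 _ 1); first exact: measurable_id.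
  by move=> x; rewrite mul1r.
Qed.

End BoundedFactor.

Lemma dominated_increment3 l : dominated (fun w => `|increment l w| ^+ 3).
Proof.
split.
  by apply: measurable_funX; apply: measurableT_comp => //; exact: measurable_increment.
exists 1 => w; rewrite mul1r normrX normr_id.
apply: le_trans (_ : _ <= 1 + increment l w ^+ 4) _.
  have -> : increment l w ^+ 4 = `|increment l w| ^+ 4.
    by rewrite -normrX ger0_norm // exprn_even_ge0.
  move: (normr_ge0 (increment l w)); move: `|_| => y y0.
  have := sqr_ge0 (y - 1); have := sqr_ge0 (y ^+ 2 - y).
  by have := sqr_ge0 (y ^+ 2 - 1); have := sqr_ge0 (y ^+ 2); lra.
by rewrite lerD2l sum4_ge.
Qed.

(** With [q] the square root of [delta], [y^3 <= q/2 * y^2 + y^4 / (2 q)], since the difference is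
    [(y (y - q))^2 / (2 q)]. The second and fourth moments then give [(1/2 + 3/2) q^3]. *)
Lemma expected_increment3 l :
  \int[P]_w (`|increment l w| ^+ 3) <= 2 * (delta * Num.sqrt delta).
Proof.
pose q := Num.sqrt delta; have q0 : 0 < q := sq_gt0.
have qq : q ^+ 2 = delta by rewrite sqr_sqrtr // ltW.
have a1 : adapted s (fun=> 1) by exact: measurable_cst.
have b1 : forall w : Omega, `|(1 : R)| <= 1 by move=> w; rewrite normr1.
have d2 := dominated_increment2 a1 b1 l l.
have d4 : dominated (fun w => increment l w ^+ 4).
  split; first by apply: measurable_funX; exact: measurable_increment.
  exists 1 => w; rewrite mul1r ger0_norm ?exprn_even_ge0 //.
  by apply: (le_trans (sum4_ge l w)); rewrite lerDr.
have := expected_increment_sqr a1 b1 l.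
rewrite (Rintegral_cst _ measurableT) [X in fine X]probability_setT !mulr1 => E2.
have E4 := increment4_le l.
apply: (@le_trans _ _ (\int[P]_w (q / 2 * (1 * increment l w * increment l w)
    + (2 * q)^-1 * increment l w ^+ 4))); last first.
  rewrite expectedD; [|exact: dominatedZ|exact: dominatedZ].
  rewrite (expectedZ _ d2) (expectedZ _ d4) E2.
  apply: le_trans (_ : _ <= q / 2 * delta + (2 * q)^-1 * (3 * delta ^+ 2)) _.
    by rewrite lerD2l ler_wpM2l // invr_ge0 mulr_ge0 // ltW.
  rewrite -/q -qq le_eqVlt; apply/orP; left; apply/eqP; field.
  by rewrite gt_eqF.
apply: le_Rintegral.
- exact: measurableT.
- exact: dominated_integrable (dominated_increment3 l).
- by apply: dominated_integrable; apply: dominatedD; exact: dominatedZ.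
move=> w _ /=; have -> : increment l w ^+ 4 = `|increment l w| ^+ 4.
  by rewrite -normrX ger0_norm // exprn_even_ge0.
have -> : 1 * increment l w * increment l w = `|increment l w| ^+ 2.
  by rewrite mul1r -expr2 real_normK // num_real.
move: (normr_ge0 (increment l w)); move: `|_| => y y0.
rewrite -subr_ge0.
have -> : q / 2 * y ^+ 2 + (2 * q)^-1 * y ^+ 4 - y ^+ 3 = (2 * q)^-1 * (y * (y - q)) ^+ 2.
  by field; rewrite gt_eqF.
by rewrite mulr_ge0 ?sqr_ge0 // invr_ge0 mulr_ge0 // ltW.
Qed.

End Increments.

(** * The Euler scheme *)

Section ContinuousComposition.
Context {R : realType} {disp : measure_display} {T : measurableType disp} {d : nat}.

Lemma floor_scale_dist (a : R) k :
  `|a - (Num.floor (k.+1%:R * a))%:~R / k.+1%:R| <= k.+1%:R^-1.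
Proof.
have k0 : 0 < k.+1%:R :> R by rewrite ltr0n.
have := ge_floor (k.+1%:R * a); have := floorD1_gt (k.+1%:R * a).
rewrite intrD1; set z := (Num.floor _)%:~R => H1 H2.
have -> : a - z / k.+1%:R = (k.+1%:R * a - z) / k.+1%:R by field; rewrite gt_eqF.
rewrite normrM (gtr0_norm (x := k.+1%:R^-1)) ?invr_gt0 // ler_pdivrMr // mulVf ?gt_eqF //.
by rewrite ler_norml; apply/andP; split; lra.
Qed.

(* Borel measurability of a continuous function of a random vector, by the
   approximations [floor (k Y) / k], which take countably many values. *)
Lemma measurable_continuous_comp (Y : T -> 'rV[R]_d) (psi : 'rV[R]_d -> R) :
  (forall i, measurable_fun setT (fun w => Y w 0 i)) -> continuous psi ->
  measurable_fun setT (fun w => psi (Y w)).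
Proof.
move=> mY cpsi.
pose Z k w : 'rV[int]_d := \row_i Num.floor (k.+1%:R * Y w 0 i).
pose pt k (z : 'rV[int]_d) : 'rV[R]_d := \row_i ((z 0 i)%:~R / k.+1%:R).
apply: (@measurable_fun_cvg _ _ _ _ (fun k w => psi (pt k (Z k w)))); last first.
  move=> w _; apply: (@continuous_cvg _ _ _ _ _ _ psi); first exact: cpsi.
  apply/cvg_ballP => e e0; near=> k; split => // i j; rewrite (ord1 i) /pt /Z !mxE.
  rewrite /ball /=; apply: le_lt_trans (floor_scale_dist _ _) _.
  by near: k; exact: (near_infty_natSinv_lt (PosNum e0)).
move=> k _ B mB; rewrite setTI.
have -> : (fun w => psi (pt k (Z k w))) @^-1` B
   = \bigcup_z ([set w | B (psi (pt k z))] `&`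
        \bigcap_(i in [set: 'I_d]) (fun w => k.+1%:R * Y w 0 i) @^-1`
           `[(z 0 i)%:~R, (z 0 i + 1)%:~R[%classic).
  apply/seteqP; split => w /=.
    move=> Bw; exists (Z k w) => //; split => // i _.
    by rewrite /= in_itv /= !mxE ge_floor floorD1_gt.
  move=> [z _ [Bz Hz]]; rewrite /preimage /=.
  suff -> : Z k w = z by [].
  apply/rowP => i; rewrite !mxE; apply: Num.Theory.floor_def.
  by have := Hz i Logic.I; rewrite /= in_itv.
apply: countable_bigcupT_measurable; first exact: countableP.
move=> z; apply: measurableI.
  by have [H|H] := pselect (B (psi (pt k z)));
    [rewrite (_ : [set _ | _] = setT) ?measurableT //; apply/seteqP; split
    |rewrite (_ : [set _ | _] = set0) //; apply/seteqP; split].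
apply: fin_bigcap_measurable => [|i _]; first exact: cardinality.finite_finset.
rewrite -[_ @^-1` _]setTI; apply: measurable_funM => //.
Unshelve. all: by end_near.
Qed.

End ContinuousComposition.

(** * Derivatives recovered from forward increments *)

Section SmallIncrements.
Context {R : realType}.
Implicit Types (h g : R -> R) (t delta : R).

(** Only forward increments are considered, as the independence of Wiener increments gives access to
    these; the constant is uniform in [t]. *)
Definition increment_expansion h g : Prop := exists K, forall t delta,
  0 <= t -> 0 < delta -> delta <= 1 ->
  `|h (t + delta) - h t - delta * g t| <= K * (delta * Num.sqrt delta).

Definition half_holder h : Prop := exists K, forall t delta,
  0 <= t -> 0 < delta -> delta <= 1 ->
  `|h (t + delta) - h t| <= K * Num.sqrt delta.

Lemma increment_expansionD h1 g1 h2 g2 :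
  increment_expansion h1 g1 -> increment_expansion h2 g2 ->
  increment_expansion (fun t => h1 t + h2 t) (fun t => g1 t + g2 t).
Proof.
move=> [K1 H1] [K2 H2]; exists (K1 + K2) => t delta t0 d0 d1.
have -> : h1 (t + delta) + h2 (t + delta) - (h1 t + h2 t) - delta * (g1 t + g2 t)
  = (h1 (t + delta) - h1 t - delta * g1 t) + (h2 (t + delta) - h2 t - delta * g2 t) by ring.
by rewrite mulrDl; apply: (le_trans (ler_normD _ _)); apply: lerD; [exact: H1|exact: H2].
Qed.

Lemma increment_expansion_sum (I : Type) (r : seq I) (h g : I -> R -> R) :
  (forall i, increment_expansion (h i) (g i)) ->
  increment_expansion (fun t => \sum_(i <- r) h i t) (fun t => \sum_(i <- r) g i t).
Proof.
move=> H; elim: r => [|i r IH].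
  by exists 0 => t delta _ _ _; rewrite !big_nil mulr0 !subr0 normr0 mul0r.
have -> : (fun t => \sum_(j <- i :: r) h j t) = (fun t => h i t + \sum_(j <- r) h j t).
  by apply/funext => t; rewrite big_cons.
have -> : (fun t => \sum_(j <- i :: r) g j t) = (fun t => g i t + \sum_(j <- r) g j t).
  by apply/funext => t; rewrite big_cons.
exact: increment_expansionD.
Qed.

Lemma sqrt_small (K e : R) : 0 <= K -> 0 < e ->
  exists2 del, 0 < del & forall t, 0 <= t -> t < del -> t <= 1 /\ K * Num.sqrt t <= e.
Proof.
move=> K0 e0; pose q := e / (K + 1).
have K1 : 0 < K + 1 by rewrite ltr_wpDl.
have q0 : 0 < q by rewrite divr_gt0.
exists (Num.min 1 (q ^+ 2)); first by rewrite lt_min ltr01 exprn_gt0.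
move=> t t0; rewrite lt_min => /andP[t1 tq]; split; first exact: ltW.
have sq : Num.sqrt t <= q.
  by rewrite -(ger0_norm (ltW q0)) -sqrtr_sqr ler_wsqrtr // ltW.
apply: (@le_trans _ _ (K * q)); first exact: ler_wpM2l.
by rewrite /q mulrA ler_pdivrMr // mulrDr mulr1 mulrC lerDl ltW.
Qed.

Lemma increment_expansion_holder h g M : increment_expansion h g ->
  (forall t, 0 <= t -> `|g t| <= M) -> half_holder h.
Proof.
move=> [K HK] HM; exists (`|K| + M) => t delta t0 d0 d1.
have -> : h (t + delta) - h t = (h (t + delta) - h t - delta * g t) + delta * g t by ring.
have s0 : 0 <= Num.sqrt delta by exact: sqrtr_ge0.
have ds : delta <= Num.sqrt delta.
  rewrite -{1}(sqr_sqrtr (ltW d0)) expr2 ler_piMl //.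
  by rewrite -sqrtr1 ler_wsqrtr.
rewrite mulrDl; apply: (le_trans (ler_normD _ _)); apply: lerD.
  apply: le_trans (HK t delta t0 d0 d1) _; apply: (@le_trans _ _ (`|K| * (delta * Num.sqrt delta))).
    by rewrite ler_wpM2r ?ler_norm // mulr_ge0 // ltW.
  by rewrite ler_wpM2l // ler_piMl.
rewrite normrM (gtr0_norm d0) mulrC; apply: ler_pM => //; [exact: ltW|exact: HM].
Qed.

Lemma half_holder_continuous h tau : half_holder h ->
  {within `[0, tau], continuous h}.
Proof.
move=> [K HK]; apply/subspace_continuousP => s /=; rewrite in_itv /= => /andP[s0 _].
apply/cvgrPdist_le => e e0; rewrite near_withinE.
have [del del0 Hd] := sqrt_small (normr_ge0 K) e0.
apply/nbhs_ballP; exists del => // r; rewrite /ball /= => rs.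
rewrite in_itv /= => /andP[r0 _].
have main a b : 0 <= a -> a < b -> b - a < del -> `|h b - h a| <= e.
  move=> a0 ab bad; have ba : 0 < b - a by rewrite subr_gt0.
  have [b1 b2] := Hd _ (ltW ba) bad.
  have := HK a (b - a) a0 ba b1; rewrite (addrC a) subrK => /le_trans; apply.
  by apply: le_trans b2; rewrite ler_wpM2r ?sqrtr_ge0 // ler_norm.
case: (ltgtP s r) => [sr|rs'|->]; last by rewrite subrr normr0 ltW.
- by rewrite distrC; apply: main => //; rewrite -(gtr0_norm (x := r - s)) ?subr_gt0 // distrC.
- by apply: main => //; rewrite -(gtr0_norm (x := s - r)) ?subr_gt0.
Qed.

(** The right derivative is immediate. For [r < 0] the expansion is taken from the base point
    [t + r], and the half-Hoelder bound replaces [g (t + r)] by [g t]. *)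
Lemma increment_expansion_derive h g t : increment_expansion h g -> half_holder g ->
  0 < t -> is_derive t (1 : R) h (g t).
Proof.
move=> [K HK] [L HL] t0; apply/is_derive_epsP => e e0.
have KL : 0 <= `|K| + `|L| by rewrite addr_ge0.
have [del del0 Hd] := sqrt_small KL e0.
exists (Num.min del t); first by rewrite lt_min del0.
move=> r; rewrite lt_min => /andP[rd rt].
have [r1 re] := Hd _ (normr_ge0 r) rd.
have sr := sqrtr_ge0 `|r|.
have re1 : (`|K| + `|L|) * (`|r| * Num.sqrt `|r|) <= e * `|r|.
  by rewrite mulrCA mulrC ler_wpM2r.
apply: le_trans re1.
have rs0 : 0 <= `|r| * Num.sqrt `|r| by rewrite mulr_ge0.
have KLe (x : R) : x * (`|r| * Num.sqrt `|r|) <= `|x| * (`|r| * Num.sqrt `|r|).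
  by rewrite ler_wpM2r // ler_norm.
case: (ltgtP r 0) => [rn|rp|->]; last first.
- by rewrite addr0 mul0r subrr subr0 normr0 mul0r mulr0.
- have := HK t r (ltW t0) rp; rewrite -{1}(gtr0_norm rp) => /(_ r1).
  rewrite -{3 4}(gtr0_norm rp) => /le_trans; apply.
  by apply: (le_trans (KLe K)); rewrite ler_wpM2r // lerDl.
- have nr : `|r| = - r by rewrite ltr0_norm.
  have r0 : 0 < `|r| by rewrite nr oppr_gt0.
  have tr : 0 <= t + r by move: rt; rewrite nr => rt; lra.
  have := HK (t + r) `|r| tr r0 r1; have := HL (t + r) `|r| tr r0 r1.
  have -> : t + r + `|r| = t by rewrite nr; ring.
  move=> H2 H1.
  have -> : h (t + r) - h t - r * g t
    = - (h t - h (t + r) - `|r| * g (t + r)) + `|r| * (g t - g (t + r)).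
    by rewrite nr; ring.
  apply: (le_trans (ler_normD _ _)); rewrite mulrDl normrN; apply: lerD.
    exact: (le_trans H1).
  rewrite normrM normr_id mulrCA ler_wpM2l //; apply: (le_trans H2).
  by rewrite ler_wpM2r // ler_norm.
Qed.

End SmallIncrements.

Section AdaptedBounded.
Context {R : realType} {disp : measure_display} {Omega : measurableType disp}.
Variables (F : R -> set_system Omega).
Implicit Types (s : R) (G H : Omega -> R).

Definition adapted_bounded s M G : Prop := adapted F s G /\ forall w, `|G w| <= M.

Lemma adapted_boundedM s M N G H : adapted_bounded s M G -> adapted_bounded s N H ->
  adapted_bounded s (M * N) (fun w => G w * H w).
Proof.
move=> [aG bG] [aH bH]; split; first exact: measurable_funM aG aH.
by move=> w; rewrite normrM ler_pM.
Qed.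

Lemma adapted_sum s (I : Type) (r : seq I) (G : I -> Omega -> R) :
  (forall i, adapted F s (G i)) -> adapted F s (fun w => \sum_(i <- r) G i w).
Proof. by move=> aG; exact: measurable_sum. Qed.

Lemma adapted_boundedW s t M G : filtration F -> 0 <= s -> s <= t ->
  adapted_bounded s M G -> adapted_bounded t M G.
Proof. by move=> filt s0 st [aG bG]; split => //; exact: adaptedW aG. Qed.

Lemma adapted_continuous_comp d s (Y : Omega -> 'rV[R]_d) (psi : 'rV[R]_d -> R) :
  (forall i, adapted F s (fun w => Y w 0 i)) -> continuous psi ->
  adapted F s (fun w => psi (Y w)).
Proof.
move=> aY cpsi.
exact: (@measurable_continuous_comp R _ (g_sigma_algebraType (F s)) d Y psi aY cpsi).
Qed.

End AdaptedBounded.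

Lemma exprD3_le {R : realFieldType} (a b : R) : 0 <= a -> 0 <= b ->
  (a + b) ^+ 3 <= 4 * (a ^+ 3 + b ^+ 3).
Proof.
move=> a0 b0; rewrite -subr_ge0.
have -> : 4 * (a ^+ 3 + b ^+ 3) - (a + b) ^+ 3 = 3 * ((a + b) * (a - b) ^+ 2) by ring.
by rewrite mulr_ge0 // mulr_ge0 ?addr_ge0 ?sqr_ge0.
Qed.

Lemma expr_sum3_le {R : realFieldType} (I : Type) (r : seq I) (a : I -> R) c :
  0 <= c -> (forall i, 0 <= a i) ->
  (c + \sum_(i <- r) a i) ^+ 3 <= 4 ^+ size r * (c ^+ 3 + \sum_(i <- r) a i ^+ 3).
Proof.
move=> c0 a0; elim: r => [|i r IH]; first by rewrite !big_nil !addr0 expr0 mul1r.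
rewrite !big_cons addrCA.
have s0 : 0 <= c + \sum_(j <- r) a j by rewrite addr_ge0 // sumr_ge0.
apply: (le_trans (exprD3_le (a0 i) s0)); rewrite [size _]/= [4 ^+ _]exprS -[X in _ <= X]mulrA ler_wpM2l //.
rewrite addrCA mulrDr; apply: lerD => //.
by rewrite ler_peMl ?exprn_ge0 // exprn_ege1 // ler1n.
Qed.

(** * Mean of a small Euler increment with adapted coefficients *)

Section OneStep.
Context {R : realType} {disp : measure_display} {Omega : measurableType disp}.
Variables (P : probability Omega R) (F : R -> set_system Omega) (m : nat)
  (W : 'I_m -> R -> Omega -> R).
Hypotheses (filt : filtration F) (wien : wiener P F W).
Variables (s delta : R).
Hypotheses (s_ge0 : 0 <= s) (delta_gt0 : 0 < delta) (delta_le1 : delta <= 1).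
Variables (d : nat) (b : 'I_d -> Omega -> R) (S : 'I_d -> 'I_m -> Omega -> R) (B : R).
Hypotheses (hb : forall i, adapted_bounded F s B (b i))
  (hS : forall i l, adapted_bounded F s B (S i l)).
Implicit Types (G H : Omega -> R) (l k : 'I_m) (i j : 'I_d).

Notation Z := (increment W s delta).
Notation dom := (dominated W s delta).

Let eD G H : dom G -> dom H -> \int[P]_w (G w + H w) = \int[P]_w G w + \int[P]_w H w.
Proof. exact: (expectedD filt wien s_ge0 delta_gt0). Qed.

Let eZ c G : dom G -> \int[P]_w (c * G w) = c * \int[P]_w G w.
Proof. exact: (expectedZ filt wien s_ge0 delta_gt0). Qed.

Let eS (I : Type) (r : seq I) (G : I -> Omega -> R) : (forall q, dom (G q)) ->
  \int[P]_w (\sum_(q <- r) G q w) = \sum_(q <- r) \int[P]_w G q w.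
Proof. exact: (expected_sum filt wien s_ge0 delta_gt0). Qed.

Let domB M G : adapted_bounded F s M G -> dom G.
Proof.
by move=> [aG bG]; apply: (@bounded_dominated _ _ _ _ _ _ _ _ M) => //;
  exact: (adapted_measurable filt s_ge0 aG).
Qed.

Let dom1 M G l : adapted_bounded F s M G -> dom (fun w => G w * Z l w).
Proof. by move=> [aG bG]; exact: (dominated_increment filt wien s_ge0 delta_gt0 aG bG). Qed.

Let dom2 M G l k : adapted_bounded F s M G -> dom (fun w => G w * Z l w * Z k w).
Proof. by move=> [aG bG]; exact: (dominated_increment2 filt wien s_ge0 delta_gt0 aG bG). Qed.

Let e1 M G l : adapted_bounded F s M G -> \int[P]_w (G w * Z l w) = 0.
Proof. by move=> [aG bG]; exact: (expected_increment filt wien s_ge0 delta_gt0 aG bG). Qed.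

Let e2 M G l k : adapted_bounded F s M G ->
  \int[P]_w (G w * Z l w * Z k w) = (l == k)%:R * (delta * \int[P]_w G w).
Proof.
move=> [aG bG]; have [->|lk] := eqVneq l k.
  by rewrite mul1r (expected_increment_sqr filt wien s_ge0 delta_gt0 aG bG).
by rewrite mul0r (expected_increment_cross filt wien s_ge0 delta_gt0 aG bG).
Qed.

Definition euler_increment i (w : Omega) : R := delta * b i w + \sum_l S i l w * Z l w.

Let stepE G i : (fun w => G w * euler_increment i w)
  = (fun w => delta * (G w * b i w) + \sum_l (G w * S i l w) * Z l w).
Proof.
apply/funext => w; rewrite /euler_increment mulrDr mulr_sumr mulrCA; congr (_ + _).
by apply: eq_bigr => l _; rewrite mulrA.
Qed.

Lemma dominated_step M G i : adapted_bounded F s M G -> dom (fun w => G w * euler_increment i w).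
Proof.
move=> hG; rewrite stepE; apply: dominatedD.
  by apply: dominatedZ; exact: domB (adapted_boundedM hG (hb i)).
by apply: dominated_sum => l; exact: dom1 (adapted_boundedM hG (hS i l)).
Qed.

Lemma expected_step M G i : adapted_bounded F s M G ->
  \int[P]_w (G w * euler_increment i w) = delta * \int[P]_w (G w * b i w).
Proof.
move=> hG; rewrite stepE; have hGb := adapted_boundedM hG (hb i).
have dS l := dom1 l (adapted_boundedM hG (hS i l)).
rewrite eD; [|exact: dominatedZ (domB hGb)|exact: (dominated_sum _ dS)].
rewrite (eZ _ (domB hGb)) (eS _ dS) big1 ?addr0 // => l _.
exact: e1 (adapted_boundedM hG (hS i l)).
Qed.

Let step2E G i j : (fun w => G w * (euler_increment i w * euler_increment j w))
  = (fun w => delta * (G w * b i w * euler_increment j w)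
      + (\sum_l delta * (G w * S i l w * b j w * Z l w)
         + \sum_l \sum_k (G w * S i l w * S j k w) * Z l w * Z k w)).
Proof.
apply/funext => w; rewrite {1}/euler_increment mulrDl mulrDr; congr (_ + _); first by ring.
rewrite mulr_suml mulr_sumr -big_split /=; apply: eq_bigr => l _.
rewrite /euler_increment mulrDr mulrDr; congr (_ + _); first by ring.
by rewrite !mulr_sumr; apply: eq_bigr => k _; ring.
Qed.

Let dS1 M G i j l : adapted_bounded F s M G ->
  dom (fun w => delta * (G w * S i l w * b j w * Z l w)).
Proof.
move=> hG; apply: dominatedZ.
exact: dom1 (adapted_boundedM (adapted_boundedM hG (hS i l)) (hb j)).
Qed.

Let dS2 M G i j l k : adapted_bounded F s M G ->
  dom (fun w => (G w * S i l w * S j k w) * Z l w * Z k w).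
Proof. by move=> hG; exact: dom2 (adapted_boundedM (adapted_boundedM hG (hS i l)) (hS j k)). Qed.

Lemma dominated_step2 M G i j : adapted_bounded F s M G ->
  dom (fun w => G w * (euler_increment i w * euler_increment j w)).
Proof.
move=> hG; rewrite step2E; apply: dominatedD.
  by apply: dominatedZ; exact: dominated_step (adapted_boundedM hG (hb i)).
apply: dominatedD; first by apply: dominated_sum => l; exact: dS1 hG.
by apply: dominated_sum => l; apply: dominated_sum => k; exact: dS2 hG.
Qed.

(** The terms with a single increment or with two distinct increments have mean zero; the squares
    contribute a factor [delta]. *)
Lemma expected_step2 M G i j : adapted_bounded F s M G ->
  \int[P]_w (G w * (euler_increment i w * euler_increment j w))
  = delta ^+ 2 * \int[P]_w (G w * b i w * b j w)
    + delta * \sum_l \int[P]_w (G w * S i l w * S j l w).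
Proof.
move=> hG; rewrite step2E.
have hGb := adapted_boundedM hG (hb i).
have d1 l := dS1 i j l hG.
have d2 l := dominated_sum (index_enum 'I_m) (fun k => dS2 i j l k hG).
have ds := dominated_sum (index_enum 'I_m) d1.
have dt := dominated_sum (index_enum 'I_m) d2.
rewrite (eD (dominatedZ delta (dominated_step j hGb)) (dominatedD ds dt)).
rewrite (eZ _ (dominated_step j hGb)) (expected_step j hGb) mulrA -expr2; congr (_ + _).
rewrite (eD ds dt) (eS _ d1) (eS _ d2) big1 ?add0r; last first.
  move=> l _; have h3 := adapted_boundedM (adapted_boundedM hG (hS i l)) (hb j).
  by rewrite (eZ _ (dom1 l h3)) (e1 l h3) mulr0.
rewrite mulr_sumr; apply: eq_bigr => l _.
rewrite (eS _ (fun k => dS2 i j l k hG)) (bigD1 l) //= big1 ?addr0; last first.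
  move=> k kl; rewrite (e2 l k (adapted_boundedM (adapted_boundedM hG (hS i l)) (hS j k))).
  by rewrite eq_sym (negbTE kl) mul0r.
by rewrite (e2 l l (adapted_boundedM (adapted_boundedM hG (hS i l)) (hS j l))) eqxx mul1r.
Qed.

Let cube w := delta ^+ 3 + \sum_l `|Z l w| ^+ 3.

Let d3 l : dom (fun w => `|Z l w| ^+ 3).
Proof. exact: (dominated_increment3 filt wien s_ge0 delta_gt0). Qed.

Let domC c : dom (fun=> c).
Proof. by apply: (@domB `|c|); split => //; exact: measurable_cst. Qed.

Let delta_small : delta <= Num.sqrt delta.
Proof.
rewrite -{1}(sqr_sqrtr (ltW delta_gt0)) expr2 ler_piMl ?sqrtr_ge0 //.
by rewrite -sqrtr1 ler_wsqrtr.
Qed.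

Let cube_le : \int[P]_w cube w <= (1 + m%:R * 2) * (delta * Num.sqrt delta).
Proof.
rewrite (eD (domC (delta ^+ 3)) (dominated_sum _ d3)) (eS _ d3).
rewrite (Rintegral_cst _ measurableT) [X in fine X]probability_setT mulr1.
rewrite mulrDl mul1r; apply: lerD.
  rewrite exprS ler_pM2l // expr2; apply: le_trans delta_small.
  by rewrite ler_piMl // ltW.
rewrite -mulrA -[m in X in _ <= X]card_ord mulr_natl -sumr_const.
by apply: ler_sum => l _; exact: (expected_increment3 filt wien s_ge0 delta_gt0).
Qed.

(** The first summand comes from the cubic Taylor remainder, the second from the products of two
    drift terms, which are of order [delta ^+ 2]. *)
Definition step_const : R := (d%:R * B) ^+ 3 * 4 ^+ m * (1 + m%:R * 2) + d%:R ^+ 2 * B ^+ 2.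

Let B_ge0 i (w : Omega) : 0 <= B.
Proof. by have [_ H] := hb i; exact: le_trans (H w). Qed.

Let step_norm i w : `|euler_increment i w| <= B * (delta + \sum_l `|Z l w|).
Proof.
apply: (le_trans (ler_normD _ _)); rewrite mulrDr; apply: lerD.
  by rewrite normrM (gtr0_norm delta_gt0) mulrC ler_wpM2r ?(ltW delta_gt0) //; case: (hb i).
apply: (le_trans (ler_norm_sum _ _ _)); rewrite mulr_sumr; apply: ler_sum => l _.
by rewrite normrM ler_wpM2r //; case: (hS i l).
Qed.

Let step_cube w : (\sum_i `|euler_increment i w|) ^+ 3 <= (d%:R * B) ^+ 3 * 4 ^+ m * cube w.
Proof.
have s0 : 0 <= delta + \sum_l `|Z l w| by rewrite addr_ge0 ?sumr_ge0 // ltW.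
(* The sign of [B] is known only from a coordinate that it bounds. In dimension 0 both sides
   vanish. *)
have [d0|[i0 _]] : d = 0%N \/ exists i : 'I_d, true.
  by case: (d) => [|d']; [left|right; exists ord0].
- have c0 : 0 <= cube w by rewrite addr_ge0 ?sumr_ge0 ?exprn_ge0 // ltW.
  rewrite big1; last by move=> i; move: (ltn_ord i); rewrite {2}d0.
  by rewrite d0 mul0r !expr0n /= !mul0r.
have B0 := B_ge0 i0 w.
have le1 : \sum_i `|euler_increment i w| <= d%:R * B * (delta + \sum_l `|Z l w|).
  rewrite -mulrA -[d in X in _ <= X]card_ord mulr_natl -sumr_const.
  by apply: ler_sum => i _; exact: step_norm.
apply: (@le_trans _ _ ((d%:R * B * (delta + \sum_l `|Z l w|)) ^+ 3)).
  by rewrite lerXn2r // nnegrE ?sumr_ge0 // !mulr_ge0.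
rewrite exprMn -mulrA ler_wpM2l ?exprn_ge0 ?mulr_ge0 //.
have := expr_sum3_le (index_enum 'I_m) (ltW delta_gt0) (fun l => normr_ge0 (Z l w)).
by rewrite -sum1_size big_const_ord iter_addn_0 mul1n.
Qed.

Variables (Y : Omega -> 'rV[R]_d) (psi : 'rV[R]_d -> R) (c : Omega -> R) (M Mc : R).
Hypotheses (aY : forall i, adapted F s (fun w => Y w 0 i)).
Hypotheses (psi_smooth : smooth psi) (bpsi : bounded_upto 3 M psi).
Hypotheses (hc : adapted_bounded F s Mc c).

Let V w : 'rV[R]_d := \row_i euler_increment i w.

Let measurable_step i : measurable_fun setT (euler_increment i).
Proof.
have h1 : adapted_bounded F s 1 (fun=> 1).
  by split; [exact: measurable_cst|move=> w; rewrite normr1].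
by have [+ _] := dominated_step i h1; under eq_fun do rewrite mul1r.
Qed.

Let tameY N phi : smooth phi -> bounded_upto 0 N phi ->
  adapted_bounded F s N (fun w => phi (Y w)).
Proof.
move=> sp /bounded_upto0 bp; split; last by move=> w; exact: bp.
exact: (adapted_continuous_comp aY (smooth_continuous sp)).
Qed.

Let p1 i : adapted_bounded F s (Mc * M) (fun w => c w * partial i psi (Y w)).
Proof.
apply: adapted_boundedM hc (tameY _ _); first exact: smooth_partial.
by move: bpsi => /bounded_uptoS [_ /(_ i)]; exact: bounded_uptoW.
Qed.

Let p2 i j : adapted_bounded F s (Mc * M) (fun w => c w * partial i (partial j psi) (Y w)).
Proof.
apply: adapted_boundedM hc (tameY _ _); first by do 2 apply: smooth_partial.
move: bpsi => /bounded_uptoS [_ /(_ j)] /bounded_uptoS [_ /(_ i)].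
exact: bounded_uptoW.
Qed.

(** The first order effect of Ito's formula in mean, with error [delta^(3/2)]: Taylor's formula of
    order 3 in space, then the moments of the increments. The weight [c] carries the factors that
    are known at time [s] and stands in for conditioning. *)
Lemma expected_taylor :
  `|\int[P]_w (c w * psi (Y w + V w)) - \int[P]_w (c w * psi (Y w))
    - delta * (\sum_i \int[P]_w (c w * partial i psi (Y w) * b i w)
       + \sum_i \sum_j 2^-1 *
           \sum_l \int[P]_w (c w * partial i (partial j psi) (Y w) * S i l w * S j l w))|
  <= Mc * M * step_const * (delta * Num.sqrt delta).
Proof.
have Mc0 : 0 <= Mc by case: hc => _ /(_ point); exact: le_trans.
have M0 := bounded_upto_ge0 bpsi.
pose K := (d%:R * B) ^+ 3 * 4 ^+ m.
pose G1 i w := c w * partial i psi (Y w).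
pose G2 i j w := c w * partial i (partial j psi) (Y w).
pose A1 i w := G1 i w * euler_increment i w.
pose A2 i j w := G2 i j w * (euler_increment i w * euler_increment j w).
have dA1 i : dom (A1 i) by exact: dominated_step (p1 i).
have dA2 i j : dom (A2 i j) by exact: dominated_step2 (p2 i j).
have d0 : dom (fun w => c w * psi (Y w)).
  by apply: (domB (adapted_boundedM hc (tameY psi_smooth _))); exact: bounded_uptoW bpsi.
have d1 : dom (fun w => c w * psi (Y w + V w)).
  have mY i : measurable_fun setT (fun w => (Y w + V w) 0 i).
    under eq_fun do rewrite !mxE.
    exact: measurable_funD (adapted_measurable filt s_ge0 (aY i)) (measurable_step i).
  apply: (@bounded_dominated _ _ _ _ _ _ _ _ (Mc * M)).
    apply: measurable_funM; first by case: hc => ac _; exact: (adapted_measurable filt s_ge0 ac).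
    exact: measurable_continuous_comp mY (smooth_continuous psi_smooth).
  move=> w; rewrite normrM ler_pM //; first by case: hc.
  exact: bounded_upto_sup bpsi.
have dT1 := dominated_sum (index_enum 'I_d) dA1.
have dT2 := dominated_sum (index_enum 'I_d) (fun i => dominated_sum (index_enum 'I_d) (dA2 i)).
(* The weighted Taylor remainder, written as a linear combination of dominated functions so that its
   mean can be expanded. *)
pose D w := c w * psi (Y w + V w) + ((-1) * (c w * psi (Y w))
  + ((-1) * (\sum_i A1 i w) + (- 2^-1) * (\sum_i \sum_j A2 i j w))).
have dD : dom D.
  apply: dominatedD d1 _; apply: dominatedD (dominatedZ _ d0) _.
  exact: dominatedD (dominatedZ _ dT1) (dominatedZ _ dT2).
have ED : \int[P]_w D w = \int[P]_w (c w * psi (Y w + V w)) - \int[P]_w (c w * psi (Y w))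
    - \sum_i \int[P]_w A1 i w - 2^-1 * \sum_i \sum_j \int[P]_w A2 i j w.
  have dT := dominatedD (dominatedZ (-1) dT1) (dominatedZ (- 2^-1) dT2).
  rewrite (eD d1 (dominatedD (dominatedZ (-1) d0) dT)) (eD (dominatedZ (-1) d0) dT).
  rewrite (eD (dominatedZ (-1) dT1) (dominatedZ (- 2^-1) dT2)).
  rewrite (eZ _ d0) (eZ _ dT1) (eZ _ dT2) (eS _ dA1).
  rewrite (eS _ (fun i => dominated_sum (index_enum 'I_d) (dA2 i))).
  have -> : \sum_i \int[P]_w (\sum_j A2 i j w) = \sum_i \sum_j \int[P]_w A2 i j w.
    by apply: eq_bigr => i _; exact: eS (dA2 i).
  by rewrite !mulN1r mulNr !addrA.
have bD : `|\int[P]_w D w| <= Mc * M * K * ((1 + m%:R * 2) * (delta * Num.sqrt delta)).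
  have iD := dominated_integrable filt wien s_ge0 delta_gt0 dD.
  have dc : dom (fun w => Mc * M * K * cube w).
    exact: (dominatedZ _ (dominatedD (domC (delta ^+ 3)) (dominated_sum _ d3))).
  apply: (le_trans (le_normr_Rintegral measurableT iD)).
  apply: (@le_trans _ _ (\int[P]_w (Mc * M * K * cube w))).
    apply: le_Rintegral.
    - exact: measurableT.
    - exact: integrable_norm iD.
    - exact: (dominated_integrable filt wien s_ge0 delta_gt0 dc).
    move=> w _; have H := taylor3 (Y w) (V w) psi_smooth bpsi.
    have -> : D w = c w * (psi (Y w + V w) - psi (Y w) - \sum_i V w 0 i * partial i psi (Y w)
      - 2^-1 * \sum_i \sum_j V w 0 i * V w 0 j * partial i (partial j psi) (Y w)).
      rewrite /D !mulrBr !addrA mulN1r; congr (_ + _ + _).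
        rewrite mulN1r; congr (- _); rewrite mulr_sumr; apply: eq_bigr => i _.
        by rewrite /A1 /G1 mxE; ring.
      rewrite mulNr; congr (- _); rewrite mulrCA; congr (_ * _).
      rewrite mulr_sumr; apply: eq_bigr => i _.
      rewrite mulr_sumr; apply: eq_bigr => j _.
      by rewrite /A2 /G2 !mxE; ring.
    have -> : Mc * M * K * cube w = Mc * (M * (K * cube w)) by ring.
    rewrite normrM; apply: ler_pM => //; first by case: hc.
    apply: (le_trans H); rewrite ler_wpM2l //.
    have -> : \sum_i `|V w 0 i| = \sum_i `|euler_increment i w|.
      by apply: eq_bigr => i _; rewrite mxE.
    exact: step_cube.
  have dcube := dominatedD (domC (delta ^+ 3)) (dominated_sum (index_enum 'I_m) d3).
  rewrite (eZ _ dcube); apply: ler_wpM2l; last exact: cube_le.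
  have dB0 : 0 <= d%:R * B.
    case: (posnP d) => [d00|d00]; first by rewrite d00 mul0r.
    by rewrite mulr_ge0 //; exact: (B_ge0 (Ordinal d00) point).
  have K0 : 0 <= K by apply: mulr_ge0; apply: exprn_ge0.
  by apply: mulr_ge0 => //; exact: mulr_ge0.
(* The drift part of the second moments is absent from the first order term and joins the error. *)
pose E2 i j := \int[P]_w (G2 i j w * b i w * b j w).
have bE2 i j : `|E2 i j| <= Mc * M * B ^+ 2.
  have [aG bG] := adapted_boundedM (adapted_boundedM (p2 i j) (hb i)) (hb j).
  have mG := adapted_measurable filt s_ge0 aG.
  by have := expected_bound filt wien s_ge0 delta_gt0 mG bG; rewrite expr2 !mulrA.
have -> : \int[P]_w (c w * psi (Y w + V w)) - \int[P]_w (c w * psi (Y w))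
    - delta * (\sum_i \int[P]_w (c w * partial i psi (Y w) * b i w)
       + \sum_i \sum_j 2^-1 *
           \sum_l \int[P]_w (c w * partial i (partial j psi) (Y w) * S i l w * S j l w))
  = \int[P]_w D w + 2^-1 * delta ^+ 2 * \sum_i \sum_j E2 i j.
  rewrite ED.
  have -> : \sum_i \int[P]_w A1 i w
    = delta * \sum_i \int[P]_w (c w * partial i psi (Y w) * b i w).
    by rewrite mulr_sumr; apply: eq_bigr => i _; exact: expected_step (p1 i).
  have -> : \sum_i \sum_j \int[P]_w A2 i j w = delta ^+ 2 * (\sum_i \sum_j E2 i j)
     + delta * \sum_i \sum_j
         \sum_l \int[P]_w (c w * partial i (partial j psi) (Y w) * S i l w * S j l w).
    rewrite !mulr_sumr -big_split /=; apply: eq_bigr => i _.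
    rewrite !mulr_sumr -big_split /=; apply: eq_bigr => j _.
    exact: expected_step2 (p2 i j).
  have -> : \sum_i \sum_j 2^-1 *
      \sum_l \int[P]_w (c w * partial i (partial j psi) (Y w) * S i l w * S j l w)
     = 2^-1 * \sum_i \sum_j
      \sum_l \int[P]_w (c w * partial i (partial j psi) (Y w) * S i l w * S j l w).
    by rewrite mulr_sumr; apply: eq_bigr => i _; rewrite mulr_sumr.
  move: (\int[P]_w (c w * psi (Y w + V w))) (\int[P]_w (c w * psi (Y w))) => x1 x2.
  move: (\sum_i \int[P]_w _) (\sum_i \sum_j E2 i j) (\sum_i \sum_j \sum_l _) => x3 x4 x5.
  by rewrite !mulrDr !opprD !addrA mulrCA; ring.
apply: (le_trans (ler_normD _ _)).
rewrite /step_const -/K mulrDr mulrDl; apply: lerD.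
  by apply: (le_trans bD); rewrite !mulrA.
have bS : `|\sum_i \sum_j E2 i j| <= d%:R ^+ 2 * (Mc * M * B ^+ 2).
  rewrite expr2 -mulrA -[d in X in _ <= X]card_ord mulr_natl -sumr_const.
  apply: (le_trans (ler_norm_sum _ _ _)); apply: ler_sum => i _.
  rewrite mulr_natl -sumr_const.
  by apply: (le_trans (ler_norm_sum _ _ _)); exact: ler_sum.
rewrite normrM; have -> : Mc * M * (d%:R ^+ 2 * B ^+ 2) * (delta * Num.sqrt delta)
   = (delta * Num.sqrt delta) * (d%:R ^+ 2 * (Mc * M * B ^+ 2)) by ring.
apply: ler_pM => //; rewrite normrM normrX (gtr0_norm delta_gt0) gtr0_norm ?invr_gt0 //.
apply: (@le_trans _ _ (delta ^+ 2)).
  by rewrite ler_piMl ?exprn_ge0 ?(ltW delta_gt0) // invf_le1 // ler1n.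
by rewrite expr2 ler_pM2l.
Qed.

End OneStep.

(** * Expansion in time of one step of the scheme *)

Section EulerProcess.
Context {R : realType} {d m : nat}.
Variables (f : 'I_d -> 'rV[R]_d -> R) (sigma : 'I_d -> 'I_m -> 'rV[R]_d -> R).
Hypotheses (f_smooth : forall i, smooth_torus (f i))
  (sigma_smooth : forall i l, smooth_torus (sigma i l)).
Variables (B : R).
Hypotheses (f_bound : forall i x, `|f i x| <= B)
  (sigma_bound : forall i l x, `|sigma i l x| <= B).
Context {disp : measure_display} {Omega : measurableType disp}.
Variables (P : probability Omega R) (F : R -> set_system Omega) (W : 'I_m -> R -> Omega -> R).
Hypotheses (filt : filtration F) (wien : wiener P F W).
Variables (tau : R) (x0 : 'rV[R]_d).
Hypotheses (tau_gt0 : 0 < tau).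
Implicit Types (c psi phi : 'rV[R]_d -> R) (t delta M Mc : R) (i : 'I_d) (l : 'I_m) (G H : Omega -> R).

Let X n := euler f sigma W tau x0 n.

(** It joins [X n] at [t = 0] to [X n.+1] at [t = tau]: a Taylor expansion in [t] read at [tau] is
    the expansion of one step. *)
Definition interpolation n t (w : Omega) : 'rV[R]_d :=
  \row_i (X n w 0 i + t * f i (X n w)
    + \sum_l sigma i l (X n w) * (W l (n%:R * tau + t) w - W l (n%:R * tau) w)).

Lemma interpolation0 n : interpolation n 0 = X n.
Proof.
apply/funext => w; apply/rowP => i; rewrite mxE mul0r !addr0 big1 ?addr0 // => l _.
by rewrite subrr mulr0.
Qed.

Lemma interpolation_tau n : interpolation n tau = X n.+1.
Proof.
apply/funext => w; apply/rowP => i; rewrite /X /= !mxE.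
by rewrite -[in RHS]natr1 mulrDl mul1r.
Qed.

(** The interpolation moves on from any intermediate time by an Euler increment with the same frozen
    coefficients, so [expected_taylor] applies at every [t]. *)
Lemma interpolationD n t delta w : interpolation n (t + delta) w
  = interpolation n t w + \row_i euler_increment W (n%:R * tau + t) delta
      (fun i w => f i (X n w)) (fun i l w => sigma i l (X n w)) i w.
Proof.
apply/rowP => i; rewrite !mxE /euler_increment /increment.
rewrite (eq_bigr (fun l => sigma i l (X n w) * (W l (n%:R * tau + t) w - W l (n%:R * tau) w)
  + sigma i l (X n w) * (W l (n%:R * tau + t + delta) w - W l (n%:R * tau + t) w))).
  by rewrite big_split /=; ring.
by move=> l _; rewrite addrA; ring.
Qed.

Let time_ge0 n : 0 <= n%:R * tau.
Proof. by rewrite mulr_ge0 // ltW. Qed.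

(** Stated relative to the adaptedness of [X n], since at [t = tau] it is also the induction step
    towards [X n.+1]. *)
Let adapted_of n : (forall i, adapted F (n%:R * tau) (fun w => X n w 0 i)) ->
  forall t, 0 <= t -> forall i, adapted F (n%:R * tau + t) (fun w => interpolation n t w 0 i).
Proof.
move=> aX t t0 i.
have st : n%:R * tau <= n%:R * tau + t by rewrite lerDl.
have aW G : adapted F (n%:R * tau) G -> adapted F (n%:R * tau + t) G.
  exact: (adaptedW filt (time_ge0 n) st).
have aC (g : 'rV[R]_d -> R) : smooth_torus g -> adapted F (n%:R * tau + t) (fun w => g (X n w)).
  by move=> [_ sg]; apply: aW; exact: adapted_continuous_comp aX (smooth_continuous sg).
rewrite /adapted; under eq_fun do rewrite mxE.
apply: measurable_funD.
  apply: measurable_funD; first exact: aW (aX i).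
  by apply: measurable_funM; [exact: measurable_cst|exact: aC].
apply: adapted_sum => l; apply: measurable_funM; first exact: aC.
apply: measurable_funB; last by apply: aW; exact: (adapted_wiener filt wien l (time_ge0 n)).
by apply: (adapted_wiener filt wien l); rewrite addr_ge0.
Qed.

Lemma adapted_euler n i : adapted F (n%:R * tau) (fun w => X n w 0 i).
Proof.
elim: n i => [|n IH] i; first exact: measurable_cst.
rewrite -interpolation_tau -natr1 mulrDl mul1r.
exact: (@adapted_of n IH tau (ltW tau_gt0) i).
Qed.

Lemma adapted_interpolation n t i : 0 <= t ->
  adapted F (n%:R * tau + t) (fun w => interpolation n t w 0 i).
Proof. by move=> t0; exact: (@adapted_of n (@adapted_euler n) t t0 i). Qed.

Let adapted_comp n g M : smooth_torus g -> (forall x, `|g x| <= M) ->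
  adapted_bounded F (n%:R * tau) M (fun w => g (X n w)).
Proof.
move=> [_ sg] bg; split; last by move=> w; exact: bg.
exact: (adapted_continuous_comp (@adapted_euler n) (smooth_continuous sg)).
Qed.

(** The class is applied here to bounded functions, which are dominated for the increments over any
    interval; [[0, 1]] is an arbitrary choice. *)
Notation dom := (dominated W (0 : R) (1 : R)).

Let eD G H : dom G -> dom H -> \int[P]_w (G w + H w) = \int[P]_w G w + \int[P]_w H w.
Proof. exact: (expectedD filt wien (lexx 0) ltr01). Qed.

Let eZ (a : R) G : dom G -> \int[P]_w (a * G w) = a * \int[P]_w G w.
Proof. exact: (expectedZ filt wien (lexx 0) ltr01). Qed.

Let eS (I : Type) (r : seq I) (G : I -> Omega -> R) : (forall q, dom (G q)) ->
  \int[P]_w (\sum_(q <- r) G q w) = \sum_(q <- r) \int[P]_w G q w.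
Proof. exact: (expected_sum filt wien (lexx 0) ltr01). Qed.

Let eB G M : measurable_fun setT G -> (forall w, `|G w| <= M) -> `|\int[P]_w G w| <= M.
Proof. exact: (expected_bound filt wien (lexx 0) ltr01). Qed.

Let dom_euler n g : smooth_torus g -> dom (fun w => g (X n w)).
Proof.
move=> sg; have [M /bounded_upto0 bg] := smooth_torus_bounded 0 sg.
have [aG bG] := adapted_comp n sg bg.
exact: bounded_dominated (adapted_measurable filt (time_ge0 n) aG) bG.
Qed.

Lemma expectation_euler n g : smooth_torus g ->
  ('E_P[fun w => g (X n w)] = (\int[P]_w g (X n w))%:E)%E.
Proof.
move=> sg; rewrite unlock fineK //; apply: (integrable_fin_num measurableT).
exact: (dominated_integrable filt wien (lexx 0) ltr01 (dom_euler n sg)).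
Qed.

Lemma euler_functional_bounded n : bounded_functional 1 (fun psi => \int[P]_w psi (X n w)).
Proof.
split.
- by move=> psi phi sp sf; exact: eD (dom_euler n sp) (dom_euler n sf).
- by move=> a psi sp; exact: eZ (dom_euler n sp).
- move=> psi M sp bp; rewrite mul1r.
  have [aG bG] := adapted_comp n sp bp.
  exact: eB (adapted_measurable filt (time_ge0 n) aG) bG.
- by rewrite (Rintegral_cst _ measurableT) [X in fine X]probability_setT mul1r.
Qed.

Let smooth_mul_f c i : smooth_torus c -> smooth_torus (fun x => c x * f i x).
Proof. by move=> sc; exact: (smooth_torusM sc (f_smooth i)). Qed.

Let smooth_mul_diffusion c i k : smooth_torus c ->
  smooth_torus (fun x => c x * diffusion sigma i k x).
Proof. by move=> sc; exact: (smooth_torusM sc (smooth_diffusion sigma_smooth i k)). Qed.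

(* [flow n j c psi] is the [j]-th derivative in [t] of
   [E (c (X n) psi (interpolation n t))]: differentiating replaces [psi] by the
   generator frozen at [X n] applied to [psi], and the frozen coefficients are
   moved into [c]. *)
Fixpoint flow n (j : nat) c psi t : R :=
  if j is j'.+1 then
    \sum_(i < d) flow n j' (fun x => c x * f i x) (partial i psi) t
    + \sum_(i < d) \sum_(k < d)
        flow n j' (fun x => c x * diffusion sigma i k x) (partial i (partial k psi)) t
  else \int[P]_w (c (X n w) * psi (interpolation n t w)).

Let product_adapted n t c psi Mc M : 0 <= t -> smooth_torus c -> (forall x, `|c x| <= Mc) ->
  smooth_torus psi -> (forall x, `|psi x| <= M) ->
  adapted_bounded F (n%:R * tau + t) (Mc * M) (fun w => c (X n w) * psi (interpolation n t w)).
Proof.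
move=> t0 sc bc [_ sp] bp; apply: adapted_boundedM.
  by apply: adapted_boundedW filt (time_ge0 n) _ (adapted_comp n sc bc); rewrite lerDl.
split; last by move=> w; exact: bp.
apply: adapted_continuous_comp (smooth_continuous sp) => i.
exact: adapted_interpolation.
Qed.

(** The cost of one time derivative in [flow]: [d] drift coefficients and [d ^+ 2] diffusion
    coefficients, each with its bound. *)
Definition flow_rate : R := d%:R * B + d%:R ^+ 2 * (2^-1 * (m%:R * B ^+ 2)).

Lemma diffusion_bound i k x : `|diffusion sigma i k x| <= 2^-1 * (m%:R * B ^+ 2).
Proof.
rewrite /diffusion normrM gtr0_norm ?invr_gt0 // ler_wpM2l // ?invr_ge0 //.
apply: (le_trans (ler_norm_sum _ _ _)).
rewrite -[m in X in _ <= X]card_ord mulr_natl -sumr_const; apply: ler_sum => l _.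
by rewrite normrM expr2 ler_pM.
Qed.

Let sum_norm_le (a : 'I_d -> R) (K : R) : (forall i, `|a i| <= K) -> `|\sum_i a i| <= d%:R * K.
Proof.
move=> H; apply: (le_trans (ler_norm_sum _ _ _)).
by rewrite -[d in X in _ <= X]card_ord mulr_natl -sumr_const; exact: ler_sum.
Qed.

Lemma flow_bound n j c psi Mc M t : 0 <= t -> smooth_torus c -> (forall x, `|c x| <= Mc) ->
  smooth_torus psi -> bounded_upto (j * 2) M psi ->
  `|flow n j c psi t| <= flow_rate ^+ j * Mc * M.
Proof.
move=> t0; elim: j c psi Mc M => [|j IH] c psi Mc M sc bc sp bp /=.
  move: bp => /bounded_upto0 bp; rewrite expr0 mul1r.
  have [aG bG] := product_adapted n t0 sc bc sp bp.
  exact: eB (adapted_measurable filt (addr_ge0 (time_ge0 n) t0) aG) bG.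
have bcM (g : 'rV[R]_d -> R) K : (forall x, `|g x| <= K) -> forall x, `|c x * g x| <= Mc * K.
  by move=> bg x; rewrite normrM ler_pM.
move: bp; rewrite mulSn => /bounded_uptoS [_ bp].
have -> : flow_rate ^+ j.+1 * Mc * M = d%:R * (flow_rate ^+ j * (Mc * B) * M)
   + d%:R * (d%:R * (flow_rate ^+ j * (Mc * (2^-1 * (m%:R * B ^+ 2))) * M)).
  by rewrite exprS {1}/flow_rate; ring.
apply: (le_trans (ler_normD _ _)); apply: lerD.
  apply: sum_norm_le => i; apply: IH.
  - exact: (smooth_mul_f i sc).
  - exact: bcM.
  - exact: smooth_torus_partial.
  - by apply: bounded_uptoW (bp i).
apply: sum_norm_le => i; apply: sum_norm_le => k; apply: IH.
- exact: (smooth_mul_diffusion i k sc).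
- by apply: bcM => x; exact: diffusion_bound.
- by do 2 apply: smooth_torus_partial.
- by have := bp k => /bounded_uptoS [_ /(_ i)].
Qed.

(** Unfolds [diffusion] into products of [sigma], to match the form of [expected_taylor]. *)
Let flow1E n c psi t : 0 <= t -> smooth_torus c -> smooth_torus psi ->
  flow n 1 c psi t = \sum_i \int[P]_w (c (X n w) * partial i psi (interpolation n t w) * f i (X n w))
    + \sum_i \sum_k 2^-1 * \sum_l \int[P]_w (c (X n w)
        * partial i (partial k psi) (interpolation n t w) * sigma i l (X n w) * sigma k l (X n w)).
Proof.
move=> t0 sc sp; congr (_ + _).
  by apply: eq_bigr => i _; apply: eq_Rintegral => w _; rewrite mulrAC.
apply: eq_bigr => i _; apply: eq_bigr => k _.
have [Mc /bounded_upto0 bc] := smooth_torus_bounded 0 sc.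
have spp := smooth_torus_partial i (smooth_torus_partial k sp).
have [M /bounded_upto0 bp] := smooth_torus_bounded 0 spp.
have dG l : dom (fun w => c (X n w) * partial i (partial k psi) (interpolation n t w)
    * sigma i l (X n w) * sigma k l (X n w)).
  have st : n%:R * tau <= n%:R * tau + t by rewrite lerDl.
  have as_ i' := adapted_boundedW filt (time_ge0 n) st
    (adapted_comp n (sigma_smooth i' l) (sigma_bound i' l)).
  have [aG bG] := adapted_boundedM (adapted_boundedM (product_adapted n t0 sc bc spp bp)
    (as_ i)) (as_ k).
  exact: bounded_dominated (adapted_measurable filt (addr_ge0 (time_ge0 n) t0) aG) bG.
rewrite -(eS _ dG) -(eZ _ (dominated_sum _ dG)); apply: eq_Rintegral => w _.
rewrite /diffusion mulrAC mulrCA mulr_sumr; congr (_ * _).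
by apply: eq_bigr => l _; ring.
Qed.

(** Only the case [j = 0] is probabilistic. For larger [j], [flow] is a finite sum of flows of lower
    index with other weights, and the expansions add up. *)
Lemma flow_expansion n j c psi : smooth_torus c -> smooth_torus psi ->
  increment_expansion (flow n j c psi) (flow n j.+1 c psi).
Proof.
elim: j c psi => [|j IH] c psi sc sp.
  have [Mc /bounded_upto0 bc] := smooth_torus_bounded 0 sc.
  have [M bp] := smooth_torus_bounded 3 sp.
  exists (Mc * M * step_const m d B) => t delta t0 delta0 delta1.
  rewrite flow1E // /flow; under eq_Rintegral do rewrite interpolationD.
  have st : n%:R * tau <= n%:R * tau + t by rewrite lerDl.
  have tr g K (sg : smooth_torus g) (bg : forall x, `|g x| <= K) :=
    adapted_boundedW filt (time_ge0 n) st (adapted_comp n sg bg).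
  have := @expected_taylor _ _ _ P F m W filt wien _ delta
    (addr_ge0 (time_ge0 n) t0) delta0 delta1 d (fun i w => f i (X n w))
    (fun i l w => sigma i l (X n w)) B (fun i => tr _ _ (f_smooth i) (f_bound i))
    (fun i l => tr _ _ (sigma_smooth i l) (sigma_bound i l))
    (interpolation n t) psi (fun w => c (X n w)) M Mc
    (fun i => @adapted_interpolation n t i t0) sp.2 bp (tr _ _ sc bc).
  exact.
apply: increment_expansionD.
  apply: (increment_expansion_sum (index_enum 'I_d)) => i; apply: IH; first exact: (smooth_mul_f i sc).
  exact: smooth_torus_partial.
apply: (increment_expansion_sum (index_enum 'I_d)) => i.
apply: (increment_expansion_sum (index_enum 'I_d)) => k; apply: IH.
  exact: (smooth_mul_diffusion i k sc).
by do 2 apply: smooth_torus_partial.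
Qed.

Let flow_holder n j c psi : smooth_torus c -> smooth_torus psi -> half_holder (flow n j c psi).
Proof.
move=> sc sp; have [Mc /bounded_upto0 bc] := smooth_torus_bounded 0 sc.
have [M bp] := smooth_torus_bounded (j.+1 * 2) sp.
apply: increment_expansion_holder (flow_expansion n j sc sp) _ => t t0.
exact: (flow_bound n t0 sc bc sp bp).
Qed.

(** At [t = 0] the interpolation is at [X n], where the coefficients gathered in the weight
    recombine with the derivatives into [frozen]. *)
Lemma flow0 n j c psi : smooth_torus c -> smooth_torus psi ->
  flow n j c psi 0 = \int[P]_w (c (X n w) * frozen f sigma j psi (X n w)).
Proof.
elim: j c psi => [|j IH] c psi sc sp /=; first by rewrite interpolation0.
have sf phi : smooth_torus phi -> smooth_torus (frozen f sigma j phi).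
  exact: (diff_op_smooth (diff_op_frozen f_smooth sigma_smooth j)).
have s1 i : smooth_torus (fun x => c x * f i x * frozen f sigma j (partial i psi) x).
  exact: (smooth_torusM (smooth_mul_f i sc) (sf _ (smooth_torus_partial i sp))).
have s2 i k : smooth_torus (fun x => c x * diffusion sigma i k x
    * frozen f sigma j (partial i (partial k psi)) x).
  exact: (smooth_torusM (smooth_mul_diffusion i k sc)
    (sf _ (smooth_torus_partial i (smooth_torus_partial k sp)))).
have d1 i := dom_euler n (s1 i).
have d2 i k := dom_euler n (s2 i k).
have d2' i := dominated_sum (index_enum 'I_d) (d2 i).
transitivity (\int[P]_w (\sum_i c (X n w) * f i (X n w) * frozen f sigma j (partial i psi) (X n w)
   + \sum_i \sum_k c (X n w) * diffusion sigma i k (X n w)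
    * frozen f sigma j (partial i (partial k psi)) (X n w))).
  rewrite (eD (dominated_sum _ d1) (dominated_sum _ d2')) (eS _ d1) (eS _ d2'); congr (_ + _).
    apply: eq_bigr => i _; apply: IH; first exact: (smooth_mul_f i sc).
    exact: smooth_torus_partial.
  apply: eq_bigr => i _; rewrite (eS _ (d2 i)); apply: eq_bigr => k _; apply: IH.
    exact: (smooth_mul_diffusion i k sc).
  by do 2 apply: smooth_torus_partial.
apply: eq_Rintegral => w _; rewrite mulrDr !mulr_sumr; congr (_ + _).
  by apply: eq_bigr => i _; rewrite mulrA.
by apply: eq_bigr => i _; rewrite mulr_sumr; apply: eq_bigr => k _; rewrite mulrA.
Qed.

(** [taylor_chain] for the flows with weight 1; the derivative of order [N.+1] uses [2 * N.+1]
    derivatives of [psi]. The absolute value makes the constant nonnegative without inspecting the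
    sign of [B]. *)
Lemma euler_step_expansion n N psi M : smooth_torus psi -> bounded_upto (2 * N).+2 M psi ->
  `|\int[P]_w psi (X n.+1 w)
    - \sum_(j < N.+1) tau ^+ j / j`!%:R * \int[P]_w (frozen f sigma j psi (X n w))|
  <= `|flow_rate| ^+ N.+1 * M * tau ^+ N.+1.
Proof.
move=> sp bp; have s1 := smooth_torus_cst (d := d) (1 : R).
have b1 (x : 'rV[R]_d) : `|(1 : R)| <= 1 by rewrite normr1.
have M0 := bounded_upto_ge0 bp.
have K0 : 0 <= `|flow_rate| ^+ N.+1 * M by rewrite mulr_ge0 ?exprn_ge0.
have := @taylor_chain _ (fun j => flow n j (fun=> 1) psi) tau (`|flow_rate| ^+ N.+1 * M) N tau_gt0.
have -> : flow n 0 (fun=> 1) psi tau = \int[P]_w psi (X n.+1 w).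
  by apply: eq_Rintegral => w _; rewrite mul1r interpolation_tau.
have -> : \sum_(j < N.+1) tau ^+ j / j`!%:R * flow n j (fun=> 1) psi 0
  = \sum_(j < N.+1) tau ^+ j / j`!%:R * \int[P]_w (frozen f sigma j psi (X n w)).
  apply: eq_bigr => j _; rewrite flow0 //; congr (_ * _).
  by apply: eq_Rintegral => w _; rewrite mul1r.
move=> H; apply: (le_trans (H _ _ _)).
- by move=> j; apply: half_holder_continuous; exact: flow_holder.
- move=> j t t0 _; apply: increment_expansion_derive t0; first exact: flow_expansion.
  exact: flow_holder.
- move=> t t0 _; have := @flow_bound n N.+1 (fun=> 1) psi 1 M t (ltW t0) s1 b1 sp.
  rewrite mulr1 => /(_ _)/le_trans; apply; first by rewrite mulnC mulnS.
  by rewrite ler_wpM2r // -normrX ler_norm.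
apply: ler_wpM2l => //; rewrite ler_pdivrMr ?ltr0n ?fact_gt0 // ler_peMr ?exprn_ge0 ?(ltW tau_gt0) //.
by rewrite ler1n fact_gt0.
Qed.

Lemma euler_functionals_expectation :
  euler_functionals f sigma (fun n => `|flow_rate| ^+ n.+1) tau
    (fun n psi => \int[P]_w psi (X n w)).
Proof.
split; first exact: euler_functional_bounded.
by move=> q n psi M; exact: euler_step_expansion.
Qed.

End EulerProcess.

Theorem theorem2p1 (R : realType) (d m : nat)
    (f : 'I_d -> 'rV[R]_d -> R) (sigma : 'I_d -> 'I_m -> 'rV[R]_d -> R)
    (f_smooth : forall i, smooth_torus (f i))
    (sigma_smooth : forall i l, smooth_torus (sigma i l))
    (u : ('rV[R]_d -> R) -> R -> 'rV[R]_d -> R)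
    (u_sol : solution_operator f sigma u)
    (rho : 'rV[R]_d -> R) (lambda : R)
    (h1 : H1 f sigma rho) (h2 : H2 f sigma rho) (h3 : H3 u rho lambda)
    (N : nat) (tau0 : R) (tau0_gt0 : 0 < tau0) :
  exists (mu : nat -> 'rV[R]_d -> R) (C : R) (P_N : {poly R}),
    (forall n, (1 <= n <= N)%N -> smooth_torus (mu n)) /\
    forall tau : R, 0 < tau -> tau <= tau0 ->
    let muN := fun x : 'rV[R]_d =>
      rho x + \sum_(1 <= n < N.+1) tau ^+ n * mu n x in
    torus_int muN = 1 /\
    forall (disp : measure_display) (Omega : measurableType disp)
      (P : probability Omega R) (F : R -> set_system Omega)
      (W : 'I_m -> R -> Omega -> R),
      filtration F -> wiener P F W ->
    forall phi : 'rV[R]_d -> R, smooth_torus phi ->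
    forall p : nat,
      let t_p := p%:R * tau in
      (sup_norm (fun x : 'rV[R]_d =>
         'E_P[fun w => phi (euler f sigma W tau x p w)]
         - (torus_int (fun y => phi y * muN y))%:E)
       <= (P_N.[t_p] * expR (- lambda * t_p) + C * tau ^+ N)%:E
          * Ck_norm (8 * N + 2) phi)%E.
Proof.
have [mu mu0 muP] := density_coeff_exists f_smooth sigma_smooth h1 h2 N.
have [B [f_bound sigma_bound]] : exists B, (forall i x, `|f i x| <= B) /\
    forall i l x, `|sigma i l x| <= B.
  have /choice [Bf Hf] : forall i, exists M, forall x, `|f i x| <= M.
    by move=> i; have [M /bounded_upto0 bM] := smooth_torus_bounded 0 (f_smooth i); exists M.
  have /choice [Bs Hs] : forall il : 'I_d * 'I_m, exists M, forall x, `|sigma il.1 il.2 x| <= M.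
    move=> il; have [M /bounded_upto0 bM] := smooth_torus_bounded 0 (sigma_smooth il.1 il.2).
    by exists M.
  have n1 : 0 <= \sum_i `|Bf i| by exact: sumr_ge0.
  have n2 : 0 <= \sum_il `|Bs il| by exact: sumr_ge0.
  exists (\sum_i `|Bf i| + \sum_il `|Bs il|); split=> [i x|i l x].
    apply: (le_trans (Hf i x)); apply: (le_trans (ler_norm _)).
    by rewrite (bigD1 i) //= -addrA lerDl addr_ge0 // sumr_ge0.
  apply: (le_trans (Hs (i, l) x)); apply: (le_trans (ler_norm _)).
  rewrite addrC (bigD1 (i, l)) //= -addrA lerDl addr_ge0 //.
  by apply: sumr_ge0 => il _; exact: normr_ge0.
pose mf tau psi := torus_int (fun x => psi x * modified_density N mu tau x).
have [Cm Cm0 HCm] := mean_modified_density_bounded muP tau0_gt0.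
have smd tau : smooth_torus (modified_density N mu tau) by exact: smooth_modified_density muP tau.
have mf_functional tau : 0 < tau -> tau <= tau0 -> bounded_functional Cm (mf tau).
  move=> tau_gt0 tau_le; split.
  - move=> psi phi sp sf; rewrite /mf.
    rewrite -(torus_intD (smooth_torusM sp (smd tau)) (smooth_torusM sf (smd tau))).
    by congr torus_int; apply/funext => x; rewrite mulrDl.
  - move=> a psi sp; rewrite /mf -(torus_intZ a (smooth_torusM sp (smd tau))).
    by congr torus_int; apply/funext => x; rewrite mulrA.
  - by move=> psi M sp bp; exact: HCm.
  - rewrite /mf -[RHS](torus_int_modified_density h1 mu0 muP tau).
    by congr torus_int; apply/funext => x; rewrite mul1r.
have mf_invariant n : (n <= N)%N -> exists2 C, 0 <= C &
    forall tau psi M, 0 < tau -> tau <= tau0 -> smooth_torus psi -> bounded_upto (2 * n) M psi ->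
    `|\sum_(j < n) tau ^+ j.+1 / j.+1`!%:R * mf tau (frozen f sigma j.+1 psi)|
      <= C * tau ^+ n.+1 * M.
  exact: (modified_density_almost_invariant f_smooth sigma_smooth muP tau0_gt0).
(* The constants are fixed here, before the probability space, the Wiener process and the initial
   point are introduced. *)
have [C [Q [C0 Q0 H]]] := weak_error f_smooth sigma_smooth u_sol h1 h3 tau0_gt0
  (fun n => `|@flow_rate R d m B| ^+ n.+1) Cm0 mf_functional mf_invariant (leqnn N).
exists mu, C, Q; split=> [n /andP[_ nN]|tau tau_gt0 tau_le muN]; first by case: (muP n nN).
have -> : muN = modified_density N mu tau.
  by apply/funext => x; rewrite (modified_densityE N mu0).
split; first exact: (torus_int_modified_density h1 mu0 muP tau).
move=> disp Omega P F W filt wien phi sphi p; cbv zeta.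
have [M0 bM0] := smooth_torus_bounded (8 * N + 2) sphi.
have Ck_le := Ck_norm_le bM0.
(* A smooth function on the torus has a finite norm, which can thus itself serve as the real bound
   [M] of the weak error estimate. *)
have Ck_fin : Ck_norm (8 * N + 2) phi \is a fin_num.
  rewrite fin_numE -ltNye -ltey; apply/andP; split; last exact: le_lt_trans Ck_le (ltry _).
  apply: (@lt_le_trans _ _ 0%E); first exact: ltNyr.
  apply: le_trans (_ : `|multi_partial [ffun=> 0%N] phi 0|%:E <= _)%E; first by rewrite lee_fin.
  apply: ereal_sup_ubound; exists [ffun=> 0%N], 0; split => //.
  by rewrite /multi_degree big1 // => i _; rewrite ffunE.
have bphi : bounded_upto (8 * N + 2) (fine (Ck_norm (8 * N + 2) phi)) phi.
  by apply: bounded_upto_Ck_norm; [exact: sphi.2|rewrite fineK].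
apply: ge_ereal_sup => _ [x _ <-].
rewrite (expectation_euler f_smooth sigma_smooth filt wien x tau_gt0 p sphi).
rewrite -EFinB abse_EFin -(fineK Ck_fin) -EFinM lee_fin.
have E := euler_functionals_expectation f_smooth sigma_smooth f_bound sigma_bound filt wien x tau_gt0.
exact: (H tau _ tau_gt0 tau_le E phi _ sphi bphi p).
Qed.
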